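(* Let $\mathsf{AffHS}$ be the symmetric two-coloured operad (first colour $\mathfrak g$, second colour $\mathfrak h$) generated by a unary operation $i:\mathfrak g\to\mathfrak h$, a skew-symmetric operation $\beta:\mathfrak g\otimes\mathfrak g\to\mathfrak g$ and an operation $m:\mathfrak g\otimes\mathfrak h\to\mathfrak h$ (no symmetry), subject to the relations $$\beta(\beta(x_1,x_2),x_3)-\beta(\beta(x_1,x_3),x_2)-\beta(x_1,\beta(x_2,x_3))=0,$$ $$m(\beta(x_1,x_2),x_3)+m(x_1,m(x_2,x_3))-m(x_2,m(x_1,x_3))=0,$$ $$i(\beta(x_1,x_2))+m(x_1,i(x_2))-m(x_2,i(x_1))=0.$$ Then the suboperad of $\mathsf{AffHS}$ generated by $m$ and $i$ is free, and there is an isomorphism of coloured symmetric collections $\mathsf{AffHS}\simeq(\mathsf{Lie};\mathcal F(m,i))$, i.e. the component of $\mathsf{AffHS}$ with output colour $\mathfrak g$ is the Lie operad (all inputs of colour $\mathfrak g$), and the component with output colour $\mathfrak h$ is isomorphic to the component with output colour $\mathfrak h$ of the free two-coloured symmetric operad $\mathcal F(m,i)$ generated by $m$ and $i$. Consequently the generating series of $\mathsf{AffHS}$ is $$F_{\mathsf{AffHS}}(t_1,t_2)=\left(-\ln(1-t_1);\ \frac{t_1+t_2}{1-t_1}\right).$$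
   Context: Work over a field $\Bbbk$ of characteristic $0$. For a finite set of colours $I=\{c_1,\dots,c_d\}$, a symmetric $I$-coloured collection $P$ consists of finite-dimensional spaces $P(n,\chi,c)$ for $n\ge 1$, $\chi:\{1,\dots,n\}\to I$ (input colours), $c\in I$ (output colour), with symmetric group actions $\sigma:P(n,\chi,c)\to P(n,\chi\sigma,c)$. A symmetric $I$-coloured operad is such a collection with partial compositions, defined when the colours match, and identities $\mathrm{id}_c$, satisfying the usual operad axioms. The generating series is the vector with components $F^i_P(t_1,\dots,t_d)=\sum_{m_1,\dots,m_d}\frac{\dim P(m_1+\dots+m_d,\chi,c_i)}{m_1!\cdots m_d!}t_1^{m_1}\cdots t_d^{m_d}$, where $\chi$ is any colouring with $|\chi^{-1}(c_j)|=m_j$; here $c_1=\mathfrak g$, $c_2=\mathfrak h$. *)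

(* Defs.v *)
From HB Require Import structures.
From mathcomp Require Import all_boot all_order all_fingroup all_algebra.
From mathcomp Require Import zify.
From mathcomp Require Import boolp generic_quotient.
From mathcomp Require Import finmap monalg.

Set Implicit Arguments.
Unset Strict Implicit.
Unset Printing Implicit Defensive.

Import GRing.Theory.
Local Open Scope ring_scope.
Local Open Scope quotient_scope.

Section LinearAlgebra.
Variable k : fieldType.

Definition is_submodule (V : lmodType k) (J : V -> Prop) : Prop :=
  J 0 /\ forall (a : k) (x y : V), J x -> J y -> J (a *: x + y).

Definition has_dim (V : lmodType k) (d : nat) : Prop :=
  exists f : V -> 'rV[k]_d, linear f /\ bijective f.

End LinearAlgebra.

Module QuotientModule.
Section QuotientModule.
Variables (k : fieldType) (V : lmodType k) (J : V -> Prop).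
Hypothesis HJ : is_submodule J.

Lemma sub0 : J 0. Proof. by case: HJ. Qed.
Lemma subZ a x : J x -> J (a *: x).
Proof. by case: HJ => J0 JS Jx; rewrite -[_ *: _]addr0; apply: JS. Qed.
Lemma subD x y : J x -> J y -> J (x + y).
Proof. by case: HJ => J0 JS Jx Jy; rewrite -[x]scale1r; apply: JS. Qed.
Lemma subN x : J x -> J (- x).
Proof. by move=> Jx; rewrite -scaleN1r; apply: subZ. Qed.

Definition eqmod_of of is_submodule J := fun x y : V => `[< J (x - y) >].
Local Notation eqmod := (eqmod_of HJ).

Lemma eqmodP x y : reflect (J (x - y)) (eqmod x y).
Proof. exact: asboolP. Qed.

Lemma eqmod_refl : reflexive eqmod.
Proof. by move=> x; apply/eqmodP; rewrite subrr; apply: sub0. Qed.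
Lemma eqmod_sym : symmetric eqmod.
Proof. by move=> x y; apply/eqmodP/eqmodP => /subN; rewrite opprB. Qed.
Lemma eqmod_trans : transitive eqmod.
Proof.
move=> y x z /eqmodP Jxy /eqmodP Jyz; apply/eqmodP.
by have := subD Jxy Jyz; rewrite addrA subrK.
Qed.

Canonical eqmod_equiv := EquivRel eqmod eqmod_refl eqmod_sym eqmod_trans.

Definition quot := {eq_quot eqmod}.
#[export]
HB.instance Definition _ := EqQuotient.copy quot {eq_quot eqmod}.
#[export]
HB.instance Definition _ := Choice.copy quot {eq_quot eqmod}.

Definition to_quot (x : V) : quot := \pi_quot x.

Lemma to_quotE (x y : V) : to_quot x = to_quot y <-> J (x - y).
Proof.
by split=> [/eqquotP/eqmodP | Jxy]; last by apply/eqquotP/eqmodP.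
Qed.

Lemma to_quot_surj (q : quot) : exists x, to_quot x = q.
Proof. by exists (repr q); apply: reprK. Qed.

Lemma to_quotD x x' y y' : to_quot x = to_quot x' -> to_quot y = to_quot y' ->
  to_quot (x + y) = to_quot (x' + y').
Proof.
move=> /to_quotE Jx /to_quotE Jy; apply/to_quotE.
by rewrite opprD addrACA; apply: subD.
Qed.

Lemma to_quotZ a x x' : to_quot x = to_quot x' ->
  to_quot (a *: x) = to_quot (a *: x').
Proof. by move=> /to_quotE Jx; apply/to_quotE; rewrite -scalerBr; apply: subZ. Qed.

Definition zero : quot := to_quot 0.
Definition opp (p : quot) : quot := to_quot (- repr p).
Definition add (p q : quot) : quot := to_quot (repr p + repr q).
Definition scale (a : k) (p : quot) : quot := to_quot (a *: repr p).

Lemma to_quot_repr q : to_quot (repr q) = q. Proof. exact: reprK. Qed.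

Lemma addE x y : add (to_quot x) (to_quot y) = to_quot (x + y).
Proof. by apply: to_quotD; rewrite to_quot_repr. Qed.
Lemma scaleE a x : scale a (to_quot x) = to_quot (a *: x).
Proof. by apply: to_quotZ; rewrite to_quot_repr. Qed.
Lemma oppE x : opp (to_quot x) = to_quot (- x).
Proof. by rewrite /opp -!scaleN1r; apply: to_quotZ; rewrite to_quot_repr. Qed.

Lemma addqA : associative add.
Proof.
move=> p q r; have [x <-] := to_quot_surj p; have [y <-] := to_quot_surj q.
by have [z <-] := to_quot_surj r; rewrite !addE addrA.
Qed.
Lemma addqC : commutative add.
Proof.
move=> p q; have [x <-] := to_quot_surj p; have [y <-] := to_quot_surj q.
by rewrite !addE addrC.
Qed.
Lemma add0q : left_id zero add.
Proof. by move=> p; have [x <-] := to_quot_surj p; rewrite addE add0r. Qed.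
Lemma addNq : left_inverse zero opp add.
Proof. by move=> p; have [x <-] := to_quot_surj p; rewrite oppE addE addNr. Qed.

#[export]
HB.instance Definition _ := GRing.isZmodule.Build quot addqA addqC add0q addNq.

Lemma scaleqA a b p : scale a (scale b p) = scale (a * b) p.
Proof. by have [x <-] := to_quot_surj p; rewrite !scaleE scalerA. Qed.
Lemma scale1q : left_id 1 scale.
Proof. by move=> p; have [x <-] := to_quot_surj p; rewrite scaleE scale1r. Qed.
Lemma scaleqDr : right_distributive scale +%R.
Proof.
move=> a p q; have [x <-] := to_quot_surj p; have [y <-] := to_quot_surj q.
by rewrite [_ + _]addE !scaleE scalerDr -addE.
Qed.
Lemma scaleqDl p : {morph scale^~ p : a b / a + b}.
Proof.
move=> a b; have [x <-] := to_quot_surj p.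
by rewrite !scaleE scalerDl -addE.
Qed.

#[export]
HB.instance Definition _ :=
  GRing.Zmodule_isLmodule.Build k quot scaleqA scale1q scaleqDr scaleqDl.

Lemma to_quot_is_linear : linear to_quot.
Proof. by move=> a x y; rewrite -addE -scaleE. Qed.

End QuotientModule.
Module Exports. HB.reexport. End Exports.
End QuotientModule.
Export QuotientModule.Exports.

(** In the partial composition at the [j]-th input, with an operation of
    arity [m], the input [i != j] becomes the input [shift_input j m i] (counting
    from 0), and the [l]-th input of the inserted operation becomes [j + l]. *)
Definition shift_input (j m i : nat) : nat := if (i < j)%N then i else (i + m).-1.

(** [grafts chi j d psi theta]: an operation with input colours [psi] and
    output colour [d] can be inserted into the [j]-th input of an operation
    with input colours [chi], and the result has input colours [theta]. *)
Definition grafts (I : finType) (n m r : nat) (chi : {ffun 'I_n -> I})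
    (j : 'I_n) (d : I) (psi : {ffun 'I_m -> I}) (theta : {ffun 'I_r -> I}) : Prop :=
  [/\ (n + m = r.+1)%N,
      chi j = d,
      forall (i : 'I_n) (u : 'I_r), i != j -> u = shift_input j m i :> nat -> theta u = chi i
    & forall (l : 'I_m) (u : 'I_r), u = (j + l)%N :> nat -> theta u = psi l].

(** [permutes chi s chi']: the colouring [chi'] is [chi \o s]. *)
Definition permutes (I : finType) (n : nat) (chi : {ffun 'I_n -> I}) (s : 'S_n)
    (chi' : {ffun 'I_n -> I}) : Prop := forall i, chi' i = chi (s i).

(** The permutation [rho] of the inputs of a partial composition that is
    induced by permuting the inputs of the two operations by [s] and [t]. *)
Definition block_perm (n m r : nat) (j : 'I_n) (s : 'S_n) (t : 'S_m) (rho : 'S_r) : Prop :=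
  (forall (i : 'I_n) (u : 'I_r), i != j -> u = shift_input j m i :> nat ->
     rho u = shift_input (s j) m (s i) :> nat) /\
  (forall (l : 'I_m) (u : 'I_r), u = (j + l)%N :> nat ->
     rho u = (s j + t l)%N :> nat).

(** Arities range over all of [nat], and [space 0] is required to vanish, which
    is the same as having arities [n >= 1] only.  Finite-dimensionality is not
    part of the structure: it fails for general free operads. The permutation
    product of the library satisfies [(s * t) i = t (s i)]. *)
Record collection (k : fieldType) (I : finType) := Collection {
  space :> forall n : nat, {ffun 'I_n -> I} -> I -> lmodType k;
  sact : forall n (chi : {ffun 'I_n -> I}) (s : 'S_n) (chi' : {ffun 'I_n -> I}) c,
    permutes chi s chi' -> space chi c -> space chi' c;
  act_linear : forall n (chi : {ffun 'I_n -> I}) s chi' c (H : permutes chi s chi'),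
    linear (@sact n chi s chi' c H);
  act1 : forall n (chi : {ffun 'I_n -> I}) c (H : permutes chi 1%g chi) (x : space chi c),
    sact H x = x;
  actM : forall n (chi : {ffun 'I_n -> I}) s chi' t chi'' c
      (H : permutes chi s chi') (H' : permutes chi' t chi'')
      (H'' : permutes chi (t * s)%g chi'') (x : space chi c),
    sact H' (sact H x) = sact H'' x;
  space0 : forall (chi : {ffun 'I_0 -> I}) c (x : space chi c), x = 0
}.
Arguments space {k I} _ {n}.
Arguments sact {k I} _ {n chi s chi' c}.

Record operad (k : fieldType) (I : finType) := Operad {
  coll :> collection k I;
  ident : forall (chi : {ffun 'I_1 -> I}) c, chi ord0 = c -> coll _ chi c;
  pcomp : forall n m r (chi : {ffun 'I_n -> I}) (j : 'I_n) d (psi : {ffun 'I_m -> I})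
      (theta : {ffun 'I_r -> I}) c,
    grafts chi j d psi theta -> coll _ chi c -> coll _ psi d -> coll _ theta c;
  comp_linear_l : forall n m r (chi : {ffun 'I_n -> I}) j d (psi : {ffun 'I_m -> I})
      (theta : {ffun 'I_r -> I}) c (H : grafts chi j d psi theta) (y : coll _ psi d),
    linear (fun x : coll _ chi c => pcomp H x y);
  comp_linear_r : forall n m r (chi : {ffun 'I_n -> I}) j d (psi : {ffun 'I_m -> I})
      (theta : {ffun 'I_r -> I}) c (H : grafts chi j d psi theta) (x : coll _ chi c),
    linear (pcomp H x);
  comp1l : forall n (chi : {ffun 'I_1 -> I}) c (psi : {ffun 'I_n -> I})
      (H : grafts chi ord0 c psi psi) (e : chi ord0 = c) (y : coll _ psi c),
    pcomp H (ident e) y = y;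
  comp1r : forall n (chi : {ffun 'I_n -> I}) (j : 'I_n) d (psi : {ffun 'I_1 -> I}) c
      (H : grafts chi j d psi chi) (e : psi ord0 = d) (x : coll _ chi c),
    pcomp H x (ident e) = x;
  (* (x o_i y) o_(i + j) z = x o_i (y o_j z) *)
  comp_seq : forall n m p r q w (chi : {ffun 'I_n -> I}) (psi : {ffun 'I_m -> I})
      (phi : {ffun 'I_p -> I}) (theta : {ffun 'I_r -> I}) (eta : {ffun 'I_q -> I})
      (omega : {ffun 'I_w -> I}) (i : 'I_n) (j : 'I_m) (l : 'I_r) c d e
      (H1 : grafts chi i d psi theta) (H2 : grafts theta l e phi omega)
      (H3 : grafts psi j e phi eta) (H4 : grafts chi i d eta omega)
      (x : coll _ chi c) (y : coll _ psi d) (z : coll _ phi e),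
    l = (i + j)%N :> nat ->
    pcomp H2 (pcomp H1 x y) z = pcomp H4 x (pcomp H3 y z);
  (* (x o_i y) o_(j + m - 1) z = (x o_j z) o_i y for i < j, y of arity m *)
  comp_par : forall n m p r q w (chi : {ffun 'I_n -> I}) (psi : {ffun 'I_m -> I})
      (phi : {ffun 'I_p -> I}) (theta : {ffun 'I_r -> I}) (eta : {ffun 'I_q -> I})
      (omega : {ffun 'I_w -> I}) (i j : 'I_n) (l : 'I_r) (i' : 'I_q) c d e
      (H1 : grafts chi i d psi theta) (H2 : grafts theta l e phi omega)
      (H3 : grafts chi j e phi eta) (H4 : grafts eta i' d psi omega)
      (x : coll _ chi c) (y : coll _ psi d) (z : coll _ phi e),
    (i < j)%N -> l = (j + m).-1 :> nat -> i' = i :> nat ->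
    pcomp H2 (pcomp H1 x y) z = pcomp H4 (pcomp H3 x z) y;
  comp_act : forall n m r (chi chi' : {ffun 'I_n -> I}) (psi psi' : {ffun 'I_m -> I})
      (theta theta' : {ffun 'I_r -> I}) (j : 'I_n) c d s t rho
      (Hs : permutes chi s chi') (Ht : permutes psi t psi')
      (Hrho : permutes theta rho theta')
      (H : grafts chi (s j) d psi theta) (H' : grafts chi' j d psi' theta')
      (x : coll _ chi c) (y : coll _ psi d),
    block_perm j s t rho ->
    pcomp H' (sact coll Hs x) (sact coll Ht y) = sact coll Hrho (pcomp H x y)
}.
Arguments ident {k I} _ {chi c}.
Arguments pcomp {k I} _ {n m r chi j d psi theta c}.

Section Morphisms.
Variables (k : fieldType) (I : finType).

Definition coll_map (P Q : collection k I) : Type :=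
  forall n (chi : {ffun 'I_n -> I}) c, P n chi c -> Q n chi c.

Definition is_coll_morphism (P Q : collection k I) (f : coll_map P Q) : Prop :=
  (forall n chi c, linear (@f n chi c)) /\
  (forall n chi s chi' c (H : permutes chi s chi') (x : P n chi c),
     f _ _ _ (sact P H x) = sact Q H (f _ _ _ x)).

Definition coll_isomorphic (P Q : collection k I) : Prop :=
  exists f : coll_map P Q,
    is_coll_morphism f /\ forall n chi c, bijective (@f n chi c).

Definition is_operad_morphism (P Q : operad k I) (f : coll_map P Q) : Prop :=
  [/\ is_coll_morphism f,
      forall (chi : {ffun 'I_1 -> I}) c (e : chi ord0 = c), f _ _ _ (ident P e) = ident Q e
    & forall n m r chi j d psi theta c (H : @grafts I n m r chi j d psi theta)
        (x : P n chi c) (y : P m psi d),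
      f _ _ _ (pcomp P H x y) = pcomp Q H (f _ _ _ x) (f _ _ _ y)].

Definition operad_isomorphic (P Q : operad k I) : Prop :=
  exists f : coll_map P Q,
    is_operad_morphism f /\ forall n chi c, bijective (@f n chi c).

(** A set of elements of a collection. *)
Definition elements (P : collection k I) : Type :=
  forall n (chi : {ffun 'I_n -> I}) c, P n chi c -> Prop.

Definition subfamily (P : collection k I) (A B : elements P) : Prop :=
  forall n chi c (x : P n chi c), A n chi c x -> B n chi c x.

Definition is_suboperad (P : operad k I) (S : elements P) : Prop :=
  [/\ forall n chi c, is_submodule (@S n chi c),
      forall n chi s chi' c (H : permutes chi s chi') (x : P n chi c),
        S _ _ _ x -> S _ _ _ (sact P H x),
      forall (chi : {ffun 'I_1 -> I}) c (e : chi ord0 = c), S _ _ _ (ident P e)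
    & forall n m r chi j d psi theta c (H : @grafts I n m r chi j d psi theta)
        (x : P n chi c) (y : P m psi d),
        S _ _ _ x -> S _ _ _ y -> S _ _ _ (pcomp P H x y)].

Definition suboperad_generated (P : operad k I) (A : elements P) : elements P :=
  fun n chi c x => forall S : elements P, is_suboperad S -> subfamily A S -> S n chi c x.

Definition is_ideal (P : operad k I) (J : elements P) : Prop :=
  [/\ forall n chi c, is_submodule (@J n chi c),
      forall n chi s chi' c (H : permutes chi s chi') (x : P n chi c),
        J _ _ _ x -> J _ _ _ (sact P H x),
      forall n m r chi j d psi theta c (H : @grafts I n m r chi j d psi theta)
        (x : P n chi c) (y : P m psi d), J _ _ _ x -> J _ _ _ (pcomp P H x y)
    & forall n m r chi j d psi theta c (H : @grafts I n m r chi j d psi theta)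
        (x : P n chi c) (y : P m psi d), J _ _ _ y -> J _ _ _ (pcomp P H x y)].

Definition ideal_generated (P : operad k I) (A : elements P) : elements P :=
  fun n chi c x => forall J : elements P, is_ideal J -> subfamily A J -> J n chi c x.

Lemma ideal_generated_is_ideal (P : operad k I) (A : elements P) :
  is_ideal (ideal_generated A).
Proof.
split.
- move=> n chi c; split=> [J HJ _ | a x y Jx Jy J HJ AJ].
    by case: HJ => sJ _ _ _; case: (sJ n chi c).
  case: (HJ) => sJ _ _ _; case: (sJ n chi c) => _; apply; first exact: Jx.
  exact: Jy.
- move=> n chi s chi' c H x Jx J HJ AJ; case: (HJ) => _ + _ _; apply.
  exact: Jx.
- move=> n m r chi j d psi theta c H x y Jx J HJ AJ; case: (HJ) => _ _ + _.
  by apply; apply: Jx.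
- move=> n m r chi j d psi theta c H x y Jy J HJ AJ; case: (HJ) => _ _ _.
  by apply; apply: Jy.
Qed.

End Morphisms.

Section Quotient.
Variables (k : fieldType) (I : finType) (P : operad k I) (J : elements P).
Hypothesis HJ : is_ideal J.

Let J_sub n chi c : is_submodule (@J n chi c). Proof. by case: HJ. Qed.

Definition qspace n (chi : {ffun 'I_n -> I}) c : lmodType k :=
  QuotientModule.quot (J_sub chi c).

Definition proj n (chi : {ffun 'I_n -> I}) c (x : P n chi c) : qspace chi c :=
  QuotientModule.to_quot (J_sub chi c) x.

Lemma projE n chi c (x y : P n chi c) : proj x = proj y <-> J (x - y).
Proof. exact: QuotientModule.to_quotE. Qed.

Lemma proj_surj n chi c (q : @qspace n chi c) : exists x, proj x = q.
Proof. exact: QuotientModule.to_quot_surj. Qed.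

Lemma proj_linear n chi c : linear (@proj n chi c).
Proof. exact: QuotientModule.to_quot_is_linear. Qed.

Definition qlift n chi c (q : @qspace n chi c) : P n chi c := repr q.

Lemma liftK n chi c (q : @qspace n chi c) : proj (qlift q) = q.
Proof. exact: QuotientModule.to_quot_repr. Qed.

Definition qact n (chi : {ffun 'I_n -> I}) (s : 'S_n) chi' c
    (H : permutes chi s chi') (q : qspace chi c) : qspace chi' c :=
  proj (sact P H (qlift q)).

Lemma linearB_of (V W : lmodType k) (f : V -> W) (x y : V) :
  linear f -> f x - f y = f (x - y).
Proof. move=> lf; have -> : x - y = -1 *: y + x by rewrite scaleN1r addrC.
by rewrite lf scaleN1r addrC. Qed.

Lemma qactE n chi s chi' c (H : permutes chi s chi') (x : P n chi c) :
  qact H (proj x) = proj (sact P H x).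
Proof.
apply/projE; rewrite linearB_of; last exact: act_linear.
by case: HJ => _ + _ _; apply; apply/projE; apply: liftK.
Qed.

Definition qcomp n m r (chi : {ffun 'I_n -> I}) (j : 'I_n) d (psi : {ffun 'I_m -> I})
    (theta : {ffun 'I_r -> I}) c (H : grafts chi j d psi theta)
    (p : qspace chi c) (q : qspace psi d) : qspace theta c :=
  proj (pcomp P H (qlift p) (qlift q)).

Lemma qcompE n m r chi j d psi theta c (H : @grafts I n m r chi j d psi theta)
    (x : P n chi c) (y : P m psi d) :
  qcomp H (proj x) (proj y) = proj (pcomp P H x y).
Proof.
apply: (@eq_trans _ _ (proj (pcomp P H x (qlift (proj y))))); apply/projE.
  rewrite (linearB_of _ _ (@comp_linear_l _ _ P _ _ _ _ _ _ _ _ c H (qlift (proj y)))).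
  by case: HJ => _ _ + _; apply; apply/projE; apply: liftK.
rewrite (linearB_of _ _ (@comp_linear_r _ _ P _ _ _ _ _ _ _ _ c H x)).
by case: HJ => _ _ _; apply; apply/projE; apply: liftK.
Qed.

Lemma qact_linear n chi s chi' c (H : permutes chi s chi') :
  linear (@qact n chi s chi' c H).
Proof.
move=> a p q; have [x <-] := proj_surj p; have [y <-] := proj_surj q.
by rewrite -proj_linear !qactE act_linear proj_linear.
Qed.

Lemma qact1 n chi c (H : permutes chi 1%g chi) (q : @qspace n chi c) : qact H q = q.
Proof. by have [x <-] := proj_surj q; rewrite qactE act1. Qed.

Lemma qactM n chi s chi' t chi'' c (H : permutes chi s chi')
    (H' : permutes chi' t chi'') (H'' : permutes chi (t * s)%g chi'')
    (q : @qspace n chi c) : qact H' (qact H q) = qact H'' q.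
Proof. by have [x <-] := proj_surj q; rewrite !qactE (actM H H' H''). Qed.

Lemma qspace0 chi c (q : @qspace 0 chi c) : q = 0.
Proof.
have [x <-] := proj_surj q; rewrite (space0 x).
by have := proj_linear 0 (0 : P 0 chi c) 0; rewrite scaler0 addr0 scale0r add0r => <-.
Qed.

Definition quotient_coll : collection k I :=
  Collection qact_linear qact1 qactM qspace0.

Definition quotient_operad : operad k I.
Proof.
apply: (@Operad k I quotient_coll (fun chi c e => proj (ident P e)) qcomp).
- move=> n m r chi j d psi theta c H q a p p'.
  have [x <-] := proj_surj p; have [x' <-] := proj_surj p'; have [y <-] := proj_surj q.
  by rewrite -proj_linear !qcompE comp_linear_l proj_linear.
- move=> n m r chi j d psi theta c H q a p p'.
  have [x <-] := proj_surj p; have [x' <-] := proj_surj p'; have [y <-] := proj_surj q.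
  by rewrite -proj_linear !qcompE comp_linear_r proj_linear.
- move=> n chi c psi H e q; have [y <-] := proj_surj q.
  by rewrite qcompE comp1l.
- move=> n chi j d psi c H e q; have [y <-] := proj_surj q.
  by rewrite qcompE comp1r.
- move=> n m p r q w chi psi phi theta eta omega i j l c d e H1 H2 H3 H4 x y z El.
  have [x' <-] := proj_surj x; have [y' <-] := proj_surj y; have [z' <-] := proj_surj z.
  by rewrite !qcompE (comp_seq H1 H2 H3 H4).
- move=> n m p r q w chi psi phi theta eta omega i j l i' c d e H1 H2 H3 H4 x y z.
  have [x' <-] := proj_surj x; have [y' <-] := proj_surj y; have [z' <-] := proj_surj z.
  by move=> lij El Ei; rewrite !qcompE (comp_par H1 H2 H3 H4).
- move=> n m r chi chi' psi psi' theta theta' j c d s t rho Hs Ht Hrho H H' x y Hb.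
  have [x' <-] := proj_surj x; have [y' <-] := proj_surj y.
  rewrite -[LHS]/(qcomp H' (qact Hs (proj x')) (qact Ht (proj y'))).
  by rewrite !qactE !qcompE (comp_act Hs Ht Hrho H H') // -qactE.
Defined.

End Quotient.

Section Pullback.
Variables (k : fieldType) (I I' : finType) (f : I' -> I) (P : operad k I).

Definition recolour n (chi : {ffun 'I_n -> I'}) : {ffun 'I_n -> I} :=
  [ffun i => f (chi i)].

Lemma recolour_permutes n (chi : {ffun 'I_n -> I'}) s chi' :
  permutes chi s chi' -> permutes (recolour chi) s (recolour chi').
Proof. by move=> H i; rewrite !ffunE H. Qed.

Lemma recolour_grafts n m r (chi : {ffun 'I_n -> I'}) (j : 'I_n) d
    (psi : {ffun 'I_m -> I'}) (theta : {ffun 'I_r -> I'}) :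
  grafts chi j d psi theta ->
  grafts (recolour chi) j (f d) (recolour psi) (recolour theta).
Proof.
case=> Hr Hd Hout Hin; split=> // [|i u ij Eu|l u Eu]; rewrite !ffunE ?Hd //.
  by rewrite (Hout i).
by rewrite (Hin l).
Qed.

Lemma recolour_one (chi : {ffun 'I_1 -> I'}) c :
  chi ord0 = c -> recolour chi ord0 = f c.
Proof. by rewrite ffunE => ->. Qed.

Definition pullback_coll : collection k I' :=
  @Collection k I' (fun n chi c => P n (recolour chi) (f c))
    (fun n chi s chi' c H => sact P (recolour_permutes H))
    (fun n chi s chi' c H => act_linear (recolour_permutes H))
    (fun n chi c H => act1 (recolour_permutes H))
    (fun n chi s chi' t chi'' c H H' H'' =>
       actM (recolour_permutes H) (recolour_permutes H') (recolour_permutes H''))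
    (fun chi c => @space0 k I P (recolour chi) (f c)).

Definition pullback_operad : operad k I'.
Proof.
apply: (@Operad k I' pullback_coll
  (fun chi c e => ident P (recolour_one e))
  (fun n m r chi j d psi theta c H => pcomp P (recolour_grafts H))).
- by move=> *; apply: comp_linear_l.
- by move=> *; apply: comp_linear_r.
- by move=> *; apply: comp1l.
- by move=> *; apply: comp1r.
- by move=> *; apply: comp_seq.
- by move=> *; apply: comp_par.
- by move=> *; apply: comp_act.
Defined.

End Pullback.

Section FreeModule.
Variables (k : fieldType) (K : choiceType) (V : lmodType k).
Implicit Types (f : K -> V) (x y : {malg k[K]}).

Definition mextend f x : V := \sum_(t <- msupp x) x@_t *: f t.

Lemma mextendEw f x (d : {fset K}) : (msupp x `<=` d)%fset ->
  mextend f x = \sum_(t <- d) x@_t *: f t.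
Proof.
move=> sub; rewrite /mextend (big_fset_incl _ sub) // => t _ /mcoeff_outdom ->.
by rewrite scale0r.
Qed.

Lemma mextend_linear f : linear (mextend f).
Proof.
move=> a x y; pose d := (msupp x `|` msupp y)%fset.
have sx : (msupp x `<=` d)%fset by apply: fsubsetUl.
have sy : (msupp y `<=` d)%fset by apply: fsubsetUr.
have sxy : (msupp (a *: x + y) `<=` d)%fset.
  apply: fsubset_trans (msuppD_le _ _) _; rewrite fsubUset sy andbT.
  exact: fsubset_trans (msuppZ_le _ _) sx.
rewrite !(mextendEw f (d := d)) // scaler_sumr -big_split /=.
by apply: eq_bigr => t _; rewrite mcoeffD mcoeffZ scalerDl scalerA.
Qed.

Lemma mextend_linear_fun a f g h x :
  (forall t, f t = a *: g t + h t) -> mextend f x = a *: mextend g x + mextend h x.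
Proof.
move=> E; rewrite /mextend scaler_sumr -big_split /=.
by apply: eq_bigr => t _; rewrite E scalerDr !scalerA mulrC.
Qed.

Lemma mextendU f t : mextend f << t >> = f t.
Proof.
by rewrite /mextend msuppU oner_eq0 big_seq_fset1 mcoeffUU scale1r.
Qed.

Lemma eq_linear_malg (f g : {malg k[K]} -> V) : linear f -> linear g ->
  (forall t, f << t >> = g << t >>) -> f =1 g.
Proof.
move=> lf lg E x.
have f0 : f 0 = 0 by have := lf (-1) 0 0; rewrite scaler0 addr0 scaleN1r addNr.
have g0 : g 0 = 0 by have := lg (-1) 0 0; rewrite scaler0 addr0 scaleN1r addNr.
rewrite [x]monalgE; elim: (enum_fset _) => [|t s IH]; first by rewrite !big_nil f0.
rewrite !big_cons.
have -> : << x@_t *g t >> = x@_t *: << t >> :> {malg k[K]}.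
  by apply/malgP => t'; rewrite mcoeffZ !mcoeffU mulr_natr.
by rewrite lf lg E IH.
Qed.

End FreeModule.

Lemma linear_mextend (k : fieldType) (K : choiceType) (V W : lmodType k) (f : V -> W)
    (g : K -> V) x : linear f -> f (mextend g x) = mextend (f \o g) x.
Proof.
move=> lf; apply: (eq_linear_malg (f := fun x => f (mextend g x))).
- by move=> a y z; rewrite mextend_linear lf.
- exact: mextend_linear.
- by move=> t; rewrite !mextendU.
Qed.

(** Generating operations with their input and output colours. The generators
    carry no symmetry: the free operad below is the one generated by free
    modules over the symmetric groups. *)
Record signature (I : finType) := Signature {
  gen :> choiceType;
  inputs : gen -> seq I;
  output : gen -> I;
  inputs_neq0 : forall g, inputs g != [::]
}.
Arguments inputs {I s}.
Arguments output {I s}.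

(** [Leaf l] stands for the [l]-th input, counting from 0. *)
Inductive tree (G : Type) := Leaf of nat | Node of G & seq (tree G).
Arguments Leaf {G}.

Section TreeInd.
Variables (G : Type) (K : tree G -> Prop).
Hypotheses (HL : forall l, K (Leaf l))
  (HN : forall g ts, (forall i, (i < size ts)%N -> K (nth (Leaf 0) ts i)) -> K (Node g ts)).
Fixpoint tree_nth_ind (t : tree G) : K t :=
  match t with
  | Leaf l => HL l
  | Node g ts => HN g
      ((fix aux (ts : seq (tree G)) : forall i, (i < size ts)%N -> K (nth (Leaf 0) ts i) :=
        match ts with
        | [::] => fun i H => False_ind _ (notF H)
        | t' :: ts' => fun i => match i with
           | 0 => fun _ => tree_nth_ind t'
           | i'.+1 => fun H => aux ts' i' H end
        end) ts)
  end.
End TreeInd.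

Section TreeChoice.
Variable G : choiceType.

Fixpoint encode (t : tree G) : GenTree.tree (nat + G) :=
  match t with
  | Leaf l => GenTree.Leaf (inl l)
  | Node g ts => GenTree.Node 0 (GenTree.Leaf (inr g) :: map encode ts)
  end.

Fixpoint decode (t : GenTree.tree (nat + G)) : tree G :=
  match t with
  | GenTree.Leaf (inl l) => Leaf l
  | GenTree.Node _ (GenTree.Leaf (inr g) :: ts) => Node g (map decode ts)
  | _ => Leaf 0
  end.

Lemma encodeK : cancel encode decode.
Proof.
elim/tree_nth_ind=> //= g ts IH; congr Node.
apply: (@eq_from_nth _ (Leaf 0)); rewrite -map_comp size_map // => i lti.
by rewrite (nth_map (Leaf 0)) //=; apply: IH.
Qed.

HB.instance Definition _ := Choice.copy (tree G) (can_type encodeK).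

End TreeChoice.

Section Trees.
Variables (I : finType) (G : signature I).
Implicit Types (t u : tree G) (lc : nat -> option I).

Fixpoint tsubst (s : nat -> tree G) t : tree G :=
  match t with
  | Leaf l => s l
  | Node g ts => Node g (map (tsubst s) ts)
  end.

Definition relabel (s : nat -> nat) : tree G -> tree G := tsubst (fun l => Leaf (s l)).

Definition graft (j m : nat) t u : tree G :=
  tsubst (fun l => if l == j then relabel (addn j) u else Leaf (shift_input j m l)) t.

Fixpoint leaves t : seq nat :=
  match t with
  | Leaf l => [:: l]
  | Node _ ts => flatten (map leaves ts)
  end.

(** [lc l] is the colour of the input [l], if there is such an input. *)
Definition out_colour lc t : option I :=
  match t with Leaf l => lc l | Node g _ => Some (output g) end.

Fixpoint well_coloured lc t : bool :=
  match t with
  | Leaf _ => true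
  | Node g ts => (map (out_colour lc) ts == map Some (inputs g)) && all (well_coloured lc) ts
  end.

Definition leaf_colour n (chi : {ffun 'I_n -> I}) (l : nat) : option I :=
  omap chi (insub l).

(** The tree monomials of arity [n], with every input used exactly once. *)
Definition monomial n (chi : {ffun 'I_n -> I}) (c : I) t : bool :=
  [&& out_colour (leaf_colour chi) t == Some c,
      well_coloured (leaf_colour chi) t
    & perm_eq (leaves t) (iota 0 n)].

Definition perm_nat n (s : 'S_n) (l : nat) : nat :=
  if insub l is Some i then s i : nat else l.

Lemma leaf_colourE n (chi : {ffun 'I_n -> I}) (i : 'I_n) :
  leaf_colour chi i = Some (chi i).
Proof. by rewrite /leaf_colour valK. Qed.

Lemma perm_natE n (s : 'S_n) (i : 'I_n) : perm_nat s i = s i.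
Proof. by rewrite /perm_nat valK. Qed.

Lemma leaf_colour_lt n (chi : {ffun 'I_n -> I}) l (ltl : (l < n)%N) :
  leaf_colour chi l = Some (chi (Ordinal ltl)).
Proof. exact: (leaf_colourE chi (Ordinal ltl)). Qed.

Lemma perm_nat_lt n (s : 'S_n) l (ltl : (l < n)%N) : perm_nat s l = s (Ordinal ltl).
Proof. exact: (perm_natE s (Ordinal ltl)). Qed.

Lemma subst_ext s s' t : {in leaves t, s =1 s'} -> tsubst s t = tsubst s' t.
Proof.
elim/tree_nth_ind: t => [l|g ts IH] /= E; first by apply: E; rewrite inE.
congr Node; apply/eq_in_map => t tts; have /(nthP (Leaf 0))[i lti Et] := tts.
rewrite -Et; apply: IH => // l; rewrite Et => lt; apply: E.
by apply/flatten_mapP; exists t.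
Qed.

Lemma subst_comp s s' t : tsubst s (tsubst s' t) = tsubst (fun l => tsubst s (s' l)) t.
Proof.
elim/tree_nth_ind: t => [l|g ts IH] //=; congr Node.
rewrite -map_comp; apply/eq_in_map => t /(nthP (Leaf 0))[i lti <-].
exact: IH.
Qed.

Lemma subst_id t : tsubst (fun l => Leaf l) t = t.
Proof.
elim/tree_nth_ind: t => [l|g ts IH] //=; congr Node.
rewrite -[RHS]map_id; apply/eq_in_map => t /(nthP (Leaf 0))[i lti <-].
exact: IH.
Qed.

Lemma leaves_subst s t : leaves (tsubst s t) = flatten [seq leaves (s l) | l <- leaves t].
Proof.
elim/tree_nth_ind: t => [l|g ts IH] /=; first by rewrite cats0.
elim: ts IH => [|t ts IHts] //= IH.
rewrite map_cat flatten_cat (IH 0%N) // IHts // => i lti.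
exact: (IH i.+1).
Qed.

Lemma leaves_relabel s t : leaves (relabel s t) = map s (leaves t).
Proof.
by rewrite leaves_subst -[RHS]flatten_seq1 -map_comp.
Qed.

Lemma out_colour_subst lc lc' s t :
    {in leaves t, forall l, out_colour lc' (s l) = lc l} ->
  out_colour lc' (tsubst s t) = out_colour lc t.
Proof. by case: t => //= l; apply; rewrite inE. Qed.

Lemma well_coloured_subst lc lc' s t :
    {in leaves t, forall l, out_colour lc' (s l) = lc l} ->
    {in leaves t, forall l, well_coloured lc' (s l)} ->
  well_coloured lc t -> well_coloured lc' (tsubst s t).
Proof.
elim/tree_nth_ind: t => [l|g ts IH] /= H1 H2; first by move=> _; apply: H2; rewrite inE.
have sub t l : t \in ts -> l \in leaves t -> l \in flatten (map leaves ts).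
  by move=> tts lt; apply/flatten_mapP; exists t.
case/andP=> /eqP Eg /allP wts; apply/andP; split.
  rewrite -Eg -map_comp; apply/eqP/eq_in_map => t tts /=.
  by apply: out_colour_subst => l lt; apply: H1; apply: sub lt.
apply/allP => _ /mapP[t tts ->].
have /(nthP (Leaf 0))[i lti Et] := tts.
rewrite -Et; apply: IH => // [l|l|]; rewrite Et ?wts // => lt.
  by apply: H1; apply: sub lt.
by apply: H2; apply: sub lt.
Qed.

Lemma leaves_lt n (chi : {ffun 'I_n -> I}) c t l :
  monomial chi c t -> l \in leaves t -> (l < n)%N.
Proof. by case/and3P=> _ _ /perm_mem ->; rewrite mem_iota. Qed.

Lemma leaves_neq0 lc t : well_coloured lc t -> leaves t != [::].
Proof.
elim/tree_nth_ind: t => [l|g ts IH] //= /andP[/eqP Eg /allP wts].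
case: ts Eg wts IH => [|t ts] /= Eg wts IH.
  by have := inputs_neq0 g; case: (inputs g) Eg.
have := IH 0%N isT (wts t (mem_head _ _)) => /=.
by case: (leaves t).
Qed.

Lemma monomial0 (chi : {ffun 'I_0 -> I}) c t : ~ monomial chi c t.
Proof.
case/and3P=> _ /leaves_neq0 + /perm_size /=.
by case: (leaves t).
Qed.

Lemma monomial_perm n (chi : {ffun 'I_n -> I}) s chi' c t :
  permutes chi s chi' -> monomial chi c t ->
  monomial chi' c (relabel (perm_nat (s^-1)%g) t).
Proof.
move=> H mt; have ltn_ l := leaves_lt mt (l := l).
case/and3P: mt => /eqP Ec wt pt; apply/and3P.
have E : {in leaves t, forall l,
    out_colour (leaf_colour chi') (Leaf (perm_nat (s^-1)%g l)) = leaf_colour chi l}.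
  move=> l /ltn_ ltl /=; rewrite -[l]/(val (Ordinal ltl)) perm_natE !leaf_colourE.
  by rewrite H permKV.
split.
- by rewrite (out_colour_subst E) Ec.
- exact: well_coloured_subst E _ wt.
rewrite leaves_relabel; apply: perm_trans (perm_map _ pt) _.
rewrite -val_enum_ord -map_comp.
have -> : map (perm_nat (s^-1)%g \o val) (enum 'I_n) = map val (map (s^-1)%g (enum 'I_n)).
  by rewrite -[RHS]map_comp; apply: eq_map => i /=; rewrite perm_natE.
apply: perm_map; apply: uniq_perm; last 1 first.
- by move=> i; rewrite mem_enum -[i](permK s) map_f ?mem_enum.
- by rewrite (map_inj_uniq (@perm_inj _ _)); apply: enum_uniq.
- by apply: enum_uniq.
Qed.

Lemma map_iota_shift (f : nat -> nat) a b q :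
  (forall l, (l < q)%N -> f (a + l)%N = (b + l)%N) -> map f (iota a q) = iota b q.
Proof.
move=> E; apply: (@eq_from_nth _ 0%N); rewrite size_map !size_iota // => l ltl.
by rewrite (nth_map 0%N) ?size_iota // !nth_iota ?E.
Qed.

Lemma iota_graft n m r j : (j < n)%N -> (n + m = r.+1)%N ->
  flatten [seq (if l == j then map (addn j) (iota 0 m) else [:: shift_input j m l])
          | l <- iota 0 n] = iota 0 r.
Proof.
move=> ltj Er; have -> : n = (j + (1 + (n - j.+1)))%N by lia.
have -> : r = (j + (m + (n - j.+1)))%N by lia.
rewrite !iotaD !map_cat !flatten_cat !add0n /= eqxx cats0; congr (_ ++ (_ ++ _)).
- have -> : [seq (if l == j then map (addn j) (iota 0 m) else [:: shift_input j m l])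
            | l <- iota 0 j] = [seq [:: id l] | l <- iota 0 j].
    apply/eq_in_map => l; rewrite mem_iota /shift_input => /andP[_ ltl].
    have -> : (l == j) = false by lia.
    by have -> : (l < j)%N by lia.
  by rewrite flatten_map1 map_id.
- by apply: map_iota_shift.
have -> : [seq (if l == j then map (addn j) (iota 0 m) else [:: shift_input j m l])
          | l <- iota (j + 1) (n - j.+1)]
        = [seq [:: shift_input j m l] | l <- iota (j + 1) (n - j.+1)].
  apply/eq_in_map => l; rewrite mem_iota => /andP[ltl _].
  by have -> : (l == j) = false by lia.
rewrite flatten_map1; apply: map_iota_shift => l ltl; rewrite /shift_input.
have -> : (j + 1 + l < j)%N = false by lia.
by lia.
Qed.

Lemma shift_lt n m r i j : (j < n)%N -> (n + m = r.+1)%N -> (i < n)%N -> i != j ->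
  (shift_input j m i < r)%N.
Proof. by rewrite /shift_input => ltj Er lti ij; case: (ltnP i j) => ? ; lia. Qed.

Lemma monomial_graft n m r (chi : {ffun 'I_n -> I}) j d (psi : {ffun 'I_m -> I})
    (theta : {ffun 'I_r -> I}) c t u :
  grafts chi j d psi theta -> monomial chi c t -> monomial psi d u ->
  monomial theta c (graft j m t u).
Proof.
case=> Er Ed Hout Hin mt mu; have ltn_ l := leaves_lt mt (l := l).
have ltm_ l := leaves_lt mu (l := l).
case/and3P: mt => /eqP Ec wt pt; case/and3P: mu => /eqP Ecu wu pu.
have ltj := ltn_ord j.
have Ein : {in leaves u, forall l,
    out_colour (leaf_colour theta) (Leaf (j + l)%N) = leaf_colour psi l}.
  move=> l /ltm_ ltl /=; have ltr : (j + l < r)%N by lia.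
  by rewrite (leaf_colour_lt _ ltr) (leaf_colour_lt _ ltl) (Hin (Ordinal ltl) (Ordinal ltr)).
have E : {in leaves t, forall l, out_colour (leaf_colour theta)
    (if l == j :> nat then relabel (addn j) u else Leaf (shift_input j m l)) = leaf_colour chi l}.
  move=> l /ltn_ ltl; case: eqVneq => [->|nlj].
    by rewrite leaf_colourE Ed (out_colour_subst Ein).
  have ltr := shift_lt ltj Er ltl nlj.
  by rewrite /= (leaf_colour_lt _ ltr) (leaf_colour_lt _ ltl) (Hout (Ordinal ltl) (Ordinal ltr)).
apply/and3P; split.
- by rewrite (out_colour_subst E) Ec.
- apply: well_coloured_subst E _ wt => l _.
  by case: eqP => // _; apply: well_coloured_subst Ein _ wu.
rewrite leaves_subst -(iota_graft ltj Er).
apply: perm_trans (perm_flatten (perm_map _ pt)) _.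
elim: (iota 0 n) => //= l s IH; apply: perm_cat => //.
by case: eqP => // _; rewrite leaves_relabel; apply: perm_map.
Qed.

Lemma graft_seq n m p w (chi : {ffun 'I_n -> I}) c i j t u v :
  monomial chi c t -> (i < n)%N -> (j < m)%N -> (m + p = w.+1)%N ->
  graft (i + j) p (graft i m t u) v = graft i w t (graft j p u v).
Proof.
move=> mt lti ltj Ew; rewrite /graft subst_comp; apply: subst_ext => l /(leaves_lt mt) ltl.
case: (eqVneq l i) => [_|nli].
  rewrite /relabel !subst_comp; apply: subst_ext => l' _ /=.
  rewrite eqn_add2l; case: eqP => nl'j; last first.
    by rewrite /shift_input ltn_add2l; case: (ltnP l' j) => ? //=; congr Leaf; lia.
  by rewrite subst_comp; apply: subst_ext => l'' _ /=; rewrite addnA.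
rewrite /= /shift_input; case: (ltnP l i) => Hli.
  have -> : (l == i + j)%N = false by lia.
  by have -> : (l < i + j)%N by lia.
have -> : ((l + m).-1 == i + j)%N = false by lia.
have -> : ((l + m).-1 < i + j)%N = false by lia.
by congr Leaf; lia.
Qed.

Lemma graft_par n m p (chi : {ffun 'I_n -> I}) c (psi : {ffun 'I_m -> I}) d i j t u v :
  monomial chi c t -> monomial psi d u -> (i < j)%N -> (j < n)%N ->
  graft (j + m).-1 p (graft i m t u) v = graft i m (graft j p t v) u.
Proof.
move=> mt mu lij ltj; rewrite /graft !subst_comp; apply: subst_ext => l _.
case: (eqVneq l i) => [->|nli].
  have -> : (i == j) = false by lia.
  rewrite /= /shift_input lij eqxx /relabel subst_comp; apply: subst_ext => l' lu /=.
  have ltm := leaves_lt mu lu.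
  have -> : (i + l' == (j + m).-1)%N = false by lia.
  by have -> : (i + l' < (j + m).-1)%N by lia.
case: (eqVneq l j) => [->|nlj].
  rewrite /= {1}/shift_input; have -> : (j < i)%N = false by lia.
  rewrite eqxx /relabel subst_comp; apply: subst_ext => l' lu /=.
  have -> : (j + l' == i)%N = false by lia.
  rewrite /shift_input; have -> : (j + l' < i)%N = false by lia.
  by congr Leaf; lia.
rewrite /= /shift_input.
case: (ltnP l i) => H1.
  have H2 : (l < j)%N by lia.
  rewrite H2; have -> : (l == (j + m).-1)%N = false by lia.
  rewrite (negPf nli) H1.
  by have -> : (l < (j + m).-1)%N by lia.
case: (ltnP l j) => H2.
  have -> : ((l + m).-1 == (j + m).-1)%N = false by lia.
  rewrite (negPf nli); have -> : (l < i)%N = false by lia.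
  by have -> : ((l + m).-1 < (j + m).-1)%N by lia.
have -> : ((l + m).-1 == (j + m).-1)%N = false by lia.
have -> : ((l + m).-1 < (j + m).-1)%N = false by lia.
have -> : ((l + p).-1 == i)%N = false by lia.
have -> : ((l + p).-1 < i)%N = false by lia.
by congr Leaf; lia.
Qed.

Lemma graft1l n u : graft 0 n (Leaf 0) u = u.
Proof. by rewrite /graft /= /relabel subst_id. Qed.

Lemma graft1r j t : graft j 1 t (Leaf 0) = t.
Proof.
rewrite -[RHS]subst_id; apply: subst_ext => l _.
case: eqVneq => [->|nlj]; first by rewrite /relabel /= addn0.
by rewrite /shift_input; case: (ltnP l j) => ? //; congr Leaf; lia.
Qed.

Lemma graft_relabel n m r (chi : {ffun 'I_n -> I}) c (psi : {ffun 'I_m -> I}) d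
    (j : 'I_n) (s : 'S_n) (s' : 'S_m) (rho : 'S_r) t u :
  (n + m = r.+1)%N -> monomial chi c t -> monomial psi d u -> block_perm j s s' rho ->
  graft j m (relabel (perm_nat (s^-1)%g) t) (relabel (perm_nat (s'^-1)%g) u)
  = relabel (perm_nat (rho^-1)%g) (graft (s j) m t u).
Proof.
move=> Er mt mu [Hout Hin]; rewrite /graft /relabel !subst_comp; apply: subst_ext => l lt.
have ltl := leaves_lt mt lt.
rewrite -[l]/(val (Ordinal ltl)); move: (Ordinal ltl) => i {l lt ltl}.
have ltj := ltn_ord j.
rewrite -[val i]/(nat_of_ord i) /= perm_natE.
have -> : ((s^-1)%g i == j :> nat) = (i == s j :> nat).
  by rewrite !(inj_eq val_inj) -(inj_eq (@perm_inj _ s)) permKV.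
case: (eqVneq (i : nat) (s j)) => [_|nij].
  rewrite /relabel !subst_comp; apply: subst_ext => l lu /=.
  have ltl := leaves_lt mu lu; congr Leaf.
  rewrite (perm_nat_lt _ ltl); have ltsj := ltn_ord (s j).
  have lt1 : (j + (s'^-1)%g (Ordinal ltl) < r)%N.
    by have := ltn_ord ((s'^-1)%g (Ordinal ltl)); lia.
  have lt2 : (s j + l < r)%N by lia.
  rewrite (perm_nat_lt _ lt2).
  have -> : Ordinal lt2 = rho (Ordinal lt1).
    by apply: val_inj; rewrite /= (Hin ((s'^-1)%g (Ordinal ltl)) (Ordinal lt1)) // permKV.
  by rewrite permK.
have nj : (s^-1)%g i != j.
  by rewrite -(inj_eq (@perm_inj _ s)) permKV; apply: contraNneq nij => ->.
rewrite /=; congr Leaf.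
have lt1 : (shift_input j m ((s^-1)%g i) < r)%N by apply: shift_lt Er _ _.
have lt2 : (shift_input (s j) m i < r)%N by apply: shift_lt Er _ _.
rewrite (perm_nat_lt _ lt2).
have -> : Ordinal lt2 = rho (Ordinal lt1).
  by apply: val_inj; rewrite /= (Hout ((s^-1)%g i) (Ordinal lt1)) // permKV.
by rewrite permK.
Qed.

Lemma monomial1 (chi : {ffun 'I_1 -> I}) c : chi ord0 = c -> monomial chi c (Leaf 0).
Proof.
move=> E; apply/and3P; split=> //=.
by rewrite -[0%N]/(val (@ord0 0)) leaf_colourE E.
Qed.


Section FreeOperad.
Variables (k : fieldType).

Definition tree_monomial n (chi : {ffun 'I_n -> I}) (c : I) : choiceType :=
  {t : tree G | monomial chi c t}.

Definition fspace n (chi : {ffun 'I_n -> I}) (c : I) : lmodType k :=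
  {malg k[tree_monomial chi c]}.

Definition mono n (chi : {ffun 'I_n -> I}) c t (Ht : monomial chi c t) : fspace chi c :=
  << exist _ t Ht : tree_monomial chi c >>.

Lemma mono_eq n (chi : {ffun 'I_n -> I}) c t t' (Ht : monomial chi c t)
  (Ht' : monomial chi c t') : t = t' -> mono Ht = mono Ht'.
Proof. by move=> E; subst t'; rewrite (bool_irrelevance Ht Ht'). Qed.

Definition fact n (chi : {ffun 'I_n -> I}) (s : 'S_n) chi' c (H : permutes chi s chi') :
    fspace chi c -> fspace chi' c :=
  mextend (fun t : tree_monomial chi c => mono (monomial_perm H (valP t))).

Definition fcomp n m r (chi : {ffun 'I_n -> I}) (j : 'I_n) d (psi : {ffun 'I_m -> I})
    (theta : {ffun 'I_r -> I}) c (H : grafts chi j d psi theta)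
    (x : fspace chi c) (y : fspace psi d) : fspace theta c :=
  mextend (fun t : tree_monomial chi c =>
    mextend (fun u : tree_monomial psi d => mono (monomial_graft H (valP t) (valP u))) y) x.

Lemma factE n (chi : {ffun 'I_n -> I}) s chi' c (H : permutes chi s chi') t
    (Ht : monomial chi c t) :
  fact H (mono Ht) = mono (monomial_perm H Ht).
Proof. by rewrite /fact mextendU; apply: mono_eq. Qed.

Lemma fcompE n m r chi j d psi theta c (H : @grafts I n m r chi j d psi theta) t u
    (Ht : monomial chi c t) (Hu : monomial psi d u) :
  fcomp H (mono Ht) (mono Hu) = mono (monomial_graft H Ht Hu).
Proof. by rewrite /fcomp !mextendU; apply: mono_eq. Qed.

Lemma fact_linear n chi s chi' c (H : permutes chi s chi') :
  linear (@fact n chi s chi' c H).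
Proof. exact: mextend_linear. Qed.

Lemma fcomp_linear_l n m r chi j d psi theta c (H : @grafts I n m r chi j d psi theta)
  (y : fspace psi d) : linear (fun x : fspace chi c => fcomp H x y).
Proof. exact: mextend_linear. Qed.

Lemma fcomp_linear_r n m r chi j d psi theta c (H : @grafts I n m r chi j d psi theta)
  (x : fspace chi c) : linear (fcomp H x).
Proof.
by move=> a y y'; apply: mextend_linear_fun => t; apply: mextend_linear.
Qed.

Lemma fspace_ext n (chi : {ffun 'I_n -> I}) c (V : lmodType k) (f g : fspace chi c -> V) :
  linear f -> linear g ->
  (forall t (Ht : monomial chi c t), f (mono Ht) = g (mono Ht)) -> f =1 g.
Proof. by move=> lf lg E; apply: eq_linear_malg => // -[t Ht]; apply: E. Qed.

Lemma linear_comp (U V W : lmodType k) (f : V -> W) (g : U -> V) :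
  linear f -> linear g -> linear (fun x => f (g x)).
Proof. by move=> lf lg a x y; rewrite lg lf. Qed.

Lemma linear_idfun (V : lmodType k) : linear (fun x : V => x).
Proof. by []. Qed.

Lemma fact1 n chi c (H : permutes chi 1%g chi) (x : @fspace n chi c) : fact H x = x.
Proof.
apply: (fspace_ext (@fact_linear _ _ _ _ _ _) (@linear_idfun _)) => t Ht.
rewrite factE; apply: mono_eq; rewrite /relabel -[RHS]subst_id invg1.
by apply: subst_ext => l /(leaves_lt Ht) ltl; rewrite (perm_nat_lt _ ltl) perm1.
Qed.

Lemma factM n chi s chi' (s' : 'S_n) chi'' c (H : permutes chi s chi')
    (H' : permutes chi' (s' : 'S_n) chi'') (H'' : permutes chi (s' * s)%g chi'')
    (x : @fspace n chi c) : fact H' (fact H x) = fact H'' x.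
Proof.
apply: (fspace_ext (linear_comp (@fact_linear _ _ _ _ _ _) (@fact_linear _ _ _ _ _ _))
         (@fact_linear _ _ _ _ _ _)) => u Hu.
rewrite !factE; apply: mono_eq; rewrite /relabel subst_comp.
apply: subst_ext => l /(leaves_lt Hu) ltl /=; congr Leaf.
by rewrite (perm_nat_lt (s^-1)%g ltl) perm_natE (perm_nat_lt _ ltl) invMg permM.
Qed.

Lemma fspace0 chi c (x : @fspace 0 chi c) : x = 0.
Proof.
pose z (y : fspace chi c) : fspace chi c := 0.
have lz : linear z by move=> a y y'; rewrite /z scaler0 addr0.
by apply: (fspace_ext (@linear_idfun _) lz) => t Ht; case: (monomial0 Ht).
Qed.

Definition free_coll : collection k I := Collection fact_linear fact1 factM fspace0.

Lemma fcomp1l n (chi : {ffun 'I_1 -> I}) c (psi : {ffun 'I_n -> I})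
    (H : grafts chi ord0 c psi psi) (e : chi ord0 = c) (y : fspace psi c) :
  fcomp H (mono (monomial1 e)) y = y.
Proof.
apply: (fspace_ext (@fcomp_linear_r _ _ _ _ _ _ _ _ _ _ _) (@linear_idfun _)) => u Hu.
by rewrite fcompE; apply: mono_eq; apply: graft1l.
Qed.

Lemma fcomp1r n (chi : {ffun 'I_n -> I}) (j : 'I_n) d (psi : {ffun 'I_1 -> I}) c
    (H : grafts chi j d psi chi) (e : psi ord0 = d) (x : fspace chi c) :
  fcomp H x (mono (monomial1 e)) = x.
Proof.
apply: (fspace_ext (@fcomp_linear_l _ _ _ _ _ _ _ _ _ _ _) (@linear_idfun _)) => t Ht.
by rewrite fcompE; apply: mono_eq; apply: graft1r.
Qed.

Lemma fcomp_seq n m p r q w (chi : {ffun 'I_n -> I}) (psi : {ffun 'I_m -> I})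
    (phi : {ffun 'I_p -> I}) (theta : {ffun 'I_r -> I}) (eta : {ffun 'I_q -> I})
    (omega : {ffun 'I_w -> I}) (i : 'I_n) (j : 'I_m) (l : 'I_r) c d e
    (H1 : grafts chi i d psi theta) (H2 : grafts theta l e phi omega)
    (H3 : grafts psi j e phi eta) (H4 : grafts chi i d eta omega)
    (x : fspace chi c) (y : fspace psi d) (z : fspace phi e) :
  l = (i + j)%N :> nat -> fcomp H2 (fcomp H1 x y) z = fcomp H4 x (fcomp H3 y z).
Proof.
have lc1 := fcomp_linear_l; have lc2 := fcomp_linear_r => El.
have [Eq _ _ _] := H3.
move: x; apply: fspace_ext.
- exact: linear_comp (lc1 _ _ _ _ _ _ _ _ _ H2 z) (lc1 _ _ _ _ _ _ _ _ _ H1 y).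
- exact: lc1.
move=> t Ht; move: y; apply: fspace_ext.
- exact: linear_comp (lc1 _ _ _ _ _ _ _ _ _ H2 z) (lc2 _ _ _ _ _ _ _ _ _ H1 _).
- exact: linear_comp (lc2 _ _ _ _ _ _ _ _ _ H4 _) (lc1 _ _ _ _ _ _ _ _ _ H3 z).
move=> u Hu; move: z; apply: fspace_ext.
- exact: lc2.
- exact: linear_comp (lc2 _ _ _ _ _ _ _ _ _ H4 _) (lc2 _ _ _ _ _ _ _ _ _ H3 _).
move=> v Hv; rewrite !fcompE; apply: mono_eq; rewrite El.
exact: (graft_seq _ _ Ht (ltn_ord i) (ltn_ord j) Eq).
Qed.

Lemma fcomp_par n m p r q w (chi : {ffun 'I_n -> I}) (psi : {ffun 'I_m -> I})
    (phi : {ffun 'I_p -> I}) (theta : {ffun 'I_r -> I}) (eta : {ffun 'I_q -> I})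
    (omega : {ffun 'I_w -> I}) (i j : 'I_n) (l : 'I_r) (i' : 'I_q) c d e
    (H1 : grafts chi i d psi theta) (H2 : grafts theta l e phi omega)
    (H3 : grafts chi j e phi eta) (H4 : grafts eta i' d psi omega)
    (x : fspace chi c) (y : fspace psi d) (z : fspace phi e) :
  (i < j)%N -> l = (j + m).-1 :> nat -> i' = i :> nat ->
  fcomp H2 (fcomp H1 x y) z = fcomp H4 (fcomp H3 x z) y.
Proof.
have lc1 := fcomp_linear_l; have lc2 := fcomp_linear_r => lij El Ei.
move: x; apply: fspace_ext.
- exact: linear_comp (lc1 _ _ _ _ _ _ _ _ _ H2 z) (lc1 _ _ _ _ _ _ _ _ _ H1 y).
- exact: linear_comp (lc1 _ _ _ _ _ _ _ _ _ H4 y) (lc1 _ _ _ _ _ _ _ _ _ H3 z).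
move=> t Ht; move: y; apply: fspace_ext.
- exact: linear_comp (lc1 _ _ _ _ _ _ _ _ _ H2 z) (lc2 _ _ _ _ _ _ _ _ _ H1 _).
- exact: lc2.
move=> u Hu; move: z; apply: fspace_ext.
- exact: lc2.
- exact: linear_comp (lc1 _ _ _ _ _ _ _ _ _ H4 _) (lc2 _ _ _ _ _ _ _ _ _ H3 _).
move=> v Hv; rewrite !fcompE; apply: mono_eq; rewrite El Ei.
exact: (graft_par _ _ Ht Hu lij (ltn_ord j)).
Qed.

Lemma fcomp_act n m r (chi chi' : {ffun 'I_n -> I}) (psi psi' : {ffun 'I_m -> I})
    (theta theta' : {ffun 'I_r -> I}) (j : 'I_n) c d s s' rho
    (Hs : permutes chi s chi') (Ht : permutes psi s' psi')
    (Hrho : permutes theta rho theta')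
    (H : grafts chi (s j) d psi theta) (H' : grafts chi' j d psi' theta')
    (x : fspace chi c) (y : fspace psi d) :
  block_perm j s s' rho ->
  fcomp H' (fact Hs x) (fact Ht y) = fact Hrho (fcomp H x y).
Proof.
have lc1 := fcomp_linear_l; have lc2 := fcomp_linear_r; have la := fact_linear => Hb.
have [Er _ _ _] := H.
move: x; apply: fspace_ext.
- exact: linear_comp (lc1 _ _ _ _ _ _ _ _ _ H' _) (la _ _ _ _ _ Hs).
- exact: linear_comp (la _ _ _ _ _ Hrho) (lc1 _ _ _ _ _ _ _ _ _ H y).
move=> u Hu; move: y; apply: fspace_ext.
- exact: linear_comp (lc2 _ _ _ _ _ _ _ _ _ H' _) (la _ _ _ _ _ Ht).
- exact: linear_comp (la _ _ _ _ _ Hrho) (lc2 _ _ _ _ _ _ _ _ _ H _).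
move=> v Hv.
rewrite !factE !fcompE factE; apply: mono_eq.
exact: (graft_relabel Er Hu Hv Hb).
Qed.

Definition free_operad : operad k I :=
  @Operad k I free_coll (fun chi c e => mono (monomial1 e)) fcomp
    fcomp_linear_l fcomp_linear_r fcomp1l fcomp1r fcomp_seq fcomp_par fcomp_act.

End FreeOperad.

End Trees.
Arguments free_operad {I} G k.
Arguments mono {I G} k {n chi c t}.

Section Presentations.
Variables (I : finType) (G : signature I) (k : fieldType).

Definition input_colouring (g : G) : {ffun 'I_(size (inputs g)) -> I} :=
  [ffun i => tnth (in_tuple (inputs g)) i].

Definition corolla (g : G) : tree G := Node g (map Leaf (iota 0 (size (inputs g)))).

Lemma corolla_monomial (g : G) : monomial (input_colouring g) (output g) (corolla g).
Proof.
apply/and3P; split=> //=.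
  apply/andP; split; last by apply/allP => _ /mapP[l _ ->].
  apply/eqP; rewrite -map_comp; apply: (@eq_from_nth _ None).
    by rewrite !size_map size_iota.
  move=> l; rewrite size_map size_iota => ltl.
  rewrite (nth_map 0%N) ?size_iota // nth_iota // add0n /= (leaf_colour_lt _ ltl).
  rewrite ffunE (tnth_nth (tnth (in_tuple (inputs g)) (Ordinal ltl))) /=.
  by rewrite (nth_map (tnth (in_tuple (inputs g)) (Ordinal ltl))).
by rewrite -map_comp flatten_map1 map_id.
Qed.

Definition generator (g : G) : free_operad G k _ (input_colouring g) (output g) :=
  mono k (corolla_monomial g).

Definition presented_operad (R : elements (free_operad G k)) : operad k I :=
  quotient_operad (ideal_generated_is_ideal R).

Definition operation (R : elements (free_operad G k)) (g : G) :
    presented_operad R _ (input_colouring g) (output g) :=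
  proj (ideal_generated_is_ideal R) (generator g).

Inductive family_of (P : operad k I)
    (a : forall g : G, P _ (input_colouring g) (output g)) :
    forall n (chi : {ffun 'I_n -> I}) c, P n chi c -> Prop :=
  FamilyOf g : family_of a (a g).

(** The suboperad of [P] generated by the operations [a g] is free on them: the
    canonical morphism from the free operad is an isomorphism onto it. *)
Definition generate_free_suboperad (P : operad k I)
    (a : forall g : G, P _ (input_colouring g) (output g)) : Prop :=
  exists f : coll_map (free_operad G k) P,
    [/\ is_operad_morphism f,
        forall g, f _ _ _ (generator g) = a g,
        forall n chi c, injective (@f n chi c)
      & forall n chi c (y : P n chi c),
          suboperad_generated (family_of a) y <-> exists x, f _ _ _ x = y].

Definition subsignature (p : pred G) : signature I :=
  @Signature I {g : G | p g} (fun g => inputs (val g)) (fun g => output (val g))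
    (fun g => inputs_neq0 (val g)).

End Presentations.
Arguments presented_operad {I G k}.
Arguments operation {I G k}.

Definition lie_sig : signature unit :=
  @Signature unit unit (fun _ => [:: tt; tt]) (fun _ => tt) (fun _ => isT).

Definition lie_bracket (t u : tree lie_sig) : tree lie_sig := @Node lie_sig tt [:: t; u].

Section Lie.
Variable k : fieldType.

(** [mono k H] is the tree monomial whose validity is [H]; this hypothesis
    determines the output colour and the input colours. *)
Inductive lie_relations : forall n (chi : {ffun 'I_n -> unit}) c,
    free_operad lie_sig k n chi c -> Prop :=
| Lie_skew (chi : {ffun 'I_2 -> unit}) c
    (H12 : monomial chi c (lie_bracket (Leaf 0) (Leaf 1)))
    (H21 : monomial chi c (lie_bracket (Leaf 1) (Leaf 0))) :
    lie_relations (mono k H12 + mono k H21)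
| Lie_jacobi (chi : {ffun 'I_3 -> unit}) c
    (H123 : monomial chi c (lie_bracket (lie_bracket (Leaf 0) (Leaf 1)) (Leaf 2)))
    (H231 : monomial chi c (lie_bracket (lie_bracket (Leaf 1) (Leaf 2)) (Leaf 0)))
    (H312 : monomial chi c (lie_bracket (lie_bracket (Leaf 2) (Leaf 0)) (Leaf 1))) :
    lie_relations (mono k H123 + mono k H231 + mono k H312).

Definition Lie : operad k unit := presented_operad lie_relations.

End Lie.

Variant colour := Cg | Ch.

Definition bool_of_colour c := if c is Cg then true else false.
Definition colour_of_bool (b : bool) := if b then Cg else Ch.
Lemma bool_of_colourK : cancel bool_of_colour colour_of_bool. Proof. by case. Qed.
HB.instance Definition _ := Countable.copy colour (can_type bool_of_colourK).
HB.instance Definition _ : isFinite colour := CanIsFinite bool_of_colourK.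

Variant aff_gen := Gi | Gbeta | Gm.

Definition nat_of_aff_gen g := match g with Gi => 0 | Gbeta => 1 | Gm => 2 end%N.
Definition aff_gen_of_nat n := match n with 0 => Gi | 1 => Gbeta | _ => Gm end%N.
Lemma nat_of_aff_genK : cancel nat_of_aff_gen aff_gen_of_nat. Proof. by case. Qed.
HB.instance Definition _ := Countable.copy aff_gen (can_type nat_of_aff_genK).

Definition aff_inputs (g : aff_gen) : seq colour :=
  match g with Gi => [:: Cg] | Gbeta => [:: Cg; Cg] | Gm => [:: Cg; Ch] end.
Definition aff_output (g : aff_gen) : colour :=
  match g with Gi => Ch | Gbeta => Cg | Gm => Ch end.
Lemma aff_inputs_neq0 g : aff_inputs g != [::]. Proof. by case: g. Qed.

Definition aff_sig : signature colour :=
  @Signature colour aff_gen aff_inputs aff_output aff_inputs_neq0.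

Definition op_i (t : tree aff_sig) : tree aff_sig := @Node aff_sig Gi [:: t].
Definition op_beta (t u : tree aff_sig) : tree aff_sig := @Node aff_sig Gbeta [:: t; u].
Definition op_m (t u : tree aff_sig) : tree aff_sig := @Node aff_sig Gm [:: t; u].

Section AffHS.
Variable k : fieldType.

Let x1 : tree aff_sig := Leaf 0.
Let x2 : tree aff_sig := Leaf 1.
Let x3 : tree aff_sig := Leaf 2.

(** The first relation is the skew-symmetry of [beta]. *)
Inductive aff_relations : forall n (chi : {ffun 'I_n -> colour}) c,
    free_operad aff_sig k n chi c -> Prop :=
| Aff_skew (chi : {ffun 'I_2 -> colour}) c
    (H1 : monomial chi c (op_beta x1 x2))
    (H2 : monomial chi c (op_beta x2 x1)) :
    aff_relations (mono k H1 + mono k H2)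
| Aff_jacobi (chi : {ffun 'I_3 -> colour}) c
    (H1 : monomial chi c (op_beta (op_beta x1 x2) x3))
    (H2 : monomial chi c (op_beta (op_beta x1 x3) x2))
    (H3 : monomial chi c (op_beta x1 (op_beta x2 x3))) :
    aff_relations (mono k H1 - mono k H2 - mono k H3)
| Aff_action (chi : {ffun 'I_3 -> colour}) c
    (H1 : monomial chi c (op_m (op_beta x1 x2) x3))
    (H2 : monomial chi c (op_m x1 (op_m x2 x3)))
    (H3 : monomial chi c (op_m x2 (op_m x1 x3))) :
    aff_relations (mono k H1 + mono k H2 - mono k H3)
| Aff_cocycle (chi : {ffun 'I_2 -> colour}) c
    (H1 : monomial chi c (op_i (op_beta x1 x2)))
    (H2 : monomial chi c (op_m x1 (op_i x2)))
    (H3 : monomial chi c (op_m x2 (op_i x1))) :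
    aff_relations (mono k H1 + mono k H2 - mono k H3).

Definition AffHS : operad k colour := presented_operad aff_relations.

Definition mi_sig : signature colour :=
  subsignature (G := aff_sig) [pred g : aff_gen | g != Gbeta].

Definition AffHS_mi (g : mi_sig) : AffHS _ (input_colouring g) (output g) :=
  operation aff_relations (val g).

Definition F_mi : operad k colour := free_operad mi_sig k.

End AffHS.

Section Pair.
Variables (k : fieldType) (L : collection k unit) (F : collection k colour).

Definition zero_module : lmodType k := 'rV[k]_0.

Definition if_space (b : bool) (V : lmodType k) : lmodType k :=
  if b then V else zero_module.

Definition if_map (b b' : bool) (V W : lmodType k) (f : V -> W) :
    if_space b V -> if_space b' W :=
  match b, b' return if_space b V -> if_space b' W with
  | true, true => f
  | _, _ => fun _ => 0
  end.

Definition all_g n (chi : {ffun 'I_n -> colour}) : bool := [forall i, chi i == Cg].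

Definition uncoloured n : {ffun 'I_n -> unit} := [ffun=> tt].

Lemma uncoloured_permutes n (s : 'S_n) : permutes (uncoloured n) s (uncoloured n).
Proof. by move=> i; rewrite !ffunE. Qed.

(** Output colour g: the operations of [L], with all inputs of colour g, and
    zero for all other input colours. Output colour h: that of [F]. *)
Definition pair_space n (chi : {ffun 'I_n -> colour}) (c : colour) : lmodType k :=
  match c with
  | Cg => if_space (all_g chi) (L n (uncoloured n) tt)
  | Ch => F n chi Ch
  end.

Definition pair_act n (chi : {ffun 'I_n -> colour}) (s : 'S_n) chi' c
    (H : permutes chi s chi') : pair_space chi c -> pair_space chi' c :=
  match c with
  | Cg => @if_map (all_g chi) (all_g chi') _ _ (sact L (uncoloured_permutes s))
  | Ch => sact F H
  end.

Lemma all_g_permutes n (chi : {ffun 'I_n -> colour}) s chi' :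
  permutes chi s chi' -> all_g chi' = all_g chi.
Proof.
move=> H; apply/forallP/forallP => E i; last by rewrite H.
by have := E (s^-1 i)%g; rewrite H permKV.
Qed.

Lemma zero_module0 (x : zero_module) : x = 0.
Proof. by apply/matrixP => i []. Qed.

Lemma if_map_linear b b' (V W : lmodType k) (f : V -> W) :
  linear f -> linear (@if_map b b' V W f).
Proof. by case: b; case: b' => //= lf a x y; rewrite scaler0 addr0. Qed.

Lemma if_map_id b (V : lmodType k) (f : V -> V) :
  (forall x, f x = x) -> forall x, @if_map b b V V f x = x.
Proof. by case: b => //= _ x; rewrite [x]zero_module0. Qed.

Lemma if_map_comp b b' b'' (U V W : lmodType k) (f : V -> W) (g : U -> V) (h : U -> W) :
  b' = b -> b'' = b' -> (forall x, f (g x) = h x) ->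
  forall x, @if_map b' b'' V W f (@if_map b b' U V g x) = @if_map b b'' U W h x.
Proof. by move=> -> ->; case: b. Qed.

Lemma pair_act_linear n chi s chi' c (H : permutes chi s chi') :
  linear (@pair_act n chi s chi' c H).
Proof. by case: c; [apply: if_map_linear|]; apply: act_linear. Qed.

Lemma pair_act1 n chi c (H : permutes chi 1%g chi) (x : @pair_space n chi c) :
  pair_act H x = x.
Proof. by case: c x => x; [apply: if_map_id => {}x|]; apply: act1. Qed.

Lemma pair_actM n chi s chi' t chi'' c (H : permutes chi s chi')
    (H' : permutes chi' t chi'') (H'' : permutes chi (t * s)%g chi'')
    (x : @pair_space n chi c) : pair_act H' (pair_act H x) = pair_act H'' x.
Proof.
case: c x => x; last exact: actM.
apply: if_map_comp (all_g_permutes H) (all_g_permutes H') _ x => x.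
exact: actM.
Qed.

Lemma pair_space0 chi c (x : @pair_space 0 chi c) : x = 0.
Proof.
case: c x => /= [|x]; last exact: space0.
by case: (all_g chi) => x; [apply: space0 | apply: zero_module0].
Qed.

Definition pair_coll : collection k colour :=
  Collection pair_act_linear pair_act1 pair_actM pair_space0.

End Pair.

(** Formal power series in [t1], [t2]: [f a b] is the coefficient of
    [t1 ^ a * t2 ^ b]. *)
Definition fps2 := nat -> nat -> rat.

Definition fconst (x : rat) : fps2 := fun a b => if (a == 0%N) && (b == 0%N) then x else 0.
Definition ft1 : fps2 := fun a b => ((a == 1%N) && (b == 0%N))%:R.
Definition ft2 : fps2 := fun a b => ((a == 0%N) && (b == 1%N))%:R.
Definition fadd (f g : fps2) : fps2 := fun a b => f a b + g a b.
Definition fopp (f : fps2) : fps2 := fun a b => - f a b.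
Definition fsub (f g : fps2) : fps2 := fadd f (fopp g).
Definition fmul (f g : fps2) : fps2 := fun a b =>
  \sum_(i < a.+1) \sum_(j < b.+1) f i j * g (a - i)%N (b - j)%N.
Definition fexp (f : fps2) (l : nat) : fps2 := iter l (fmul f) (fconst 1).

(** The sum of [c l * u ^ l] over all [l], for [u] without constant term. *)
Definition fsubst (c : nat -> rat) (u : fps2) : fps2 := fun a b =>
  \sum_(l < (a + b).+1) c l * fexp u l a b.

(** Inverse and logarithm of a series [f] with constant term 1. *)
Definition finv (f : fps2) : fps2 := fsubst (fun _ => 1) (fsub (fconst 1) f).
Definition fdiv (f g : fps2) : fps2 := fmul f (finv g).
Definition fln (f : fps2) : fps2 :=
  fsubst (fun l => if l == 0%N then 0 else (-1) ^+ l.+1 / l%:R) (fsub f (fconst 1)).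

(** In particular, all spaces of [P] are finite-dimensional. *)
Definition has_generating_series (k : fieldType) (P : collection k colour)
    (F : colour -> fps2) : Prop :=
  forall (m1 m2 : nat) (chi : {ffun 'I_(m1 + m2) -> colour}) (c : colour),
    #|[pred i | chi i == Cg]| = m1 -> #|[pred i | chi i == Ch]| = m2 ->
    exists2 d, has_dim (P _ chi c) d & F c m1 m2 = d%:R / (m1`! * m2`!)%:R.

(* Main.v *)
(** Evaluate tree monomials in the free associative algebra on the letters
    0, 1, 2, ..., with [beta] going to the commutator, [i] to the identity and
    [m a b] to the product [b a].  Evaluation is compatible with the operad
    structure and kills the relations, so that it descends to [Lie] and [AffHS].
    Modulo the relations, an operation with output colour g is a combination of
    left-normed commutators starting with the letter 0, and one with output colour
    h a combination of iterated actions of inputs on an input, that is of tree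
    monomials without [beta].  The former evaluate to elements with distinct leading
    words, the latter to distinct words; hence both are bases and evaluation is
    injective.  All the isomorphisms match elements with equal evaluations. *)
Require Import Defs.
From mathcomp Require Import all_boot all_order all_fingroup all_algebra.
From mathcomp Require Import zify finmap monalg boolp.
Import Defs.
Import GRing.Theory.
Set Implicit Arguments.
Unset Strict Implicit.
Unset Printing Implicit Defensive.
Local Open Scope ring_scope.

(** * Linear algebra *)

(** The reversed product for [m] is forced by signs: the second relation makes the operators [m x _]
    reverse brackets, as right multiplications do, and the third then holds with [i] sent to the
    identity; with left multiplications the terms would double instead of cancelling. Evaluation
    forgets colours, so one algebra receives Lie, AffHS and the free operad. A map between them is
    therefore defined by equality of values, and its linearity, equivariance and compatibility with
    composition follow from injectivity. Two obstacles shape the rest. Substituting an element for a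
    letter is linear in that element only when the letter occurs once, so compatibility with partial
    composition rests on the multilinearity of tree monomials. And relations are applied at
    arbitrary subtrees, while an ideal is closed only under permutations and partial compositions,
    which renumber inputs. Hence trees get arbitrary labels, relations are kept as formal
    combinations of labelled trees ([null]), and the spanning arguments carry a function of the
    current subtree ([sound]) instead of an explicit context. *)

Section Linear.
Variable k : fieldType.
Implicit Types U V W : lmodType k.

Lemma lin0 V W (f : V -> W) : linear f -> f 0 = 0.
Proof. by move=> lf; have := lf (-1) 0 0; rewrite scaler0 addr0 scaleN1r addNr. Qed.

Lemma linZ V W (f : V -> W) a x : linear f -> f (a *: x) = a *: f x.
Proof. by move=> lf; rewrite -[a *: x]addr0 lf (lin0 lf) addr0. Qed.

Lemma linD V W (f : V -> W) x y : linear f -> f (x + y) = f x + f y.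
Proof. by move=> lf; rewrite -[x in x + y]scale1r lf scale1r. Qed.

Lemma linN V W (f : V -> W) x : linear f -> f (- x) = - f x.
Proof. by move=> lf; rewrite -scaleN1r linZ // scaleN1r. Qed.

Lemma linB V W (f : V -> W) x y : linear f -> f (x - y) = f x - f y.
Proof. by move=> lf; rewrite linD // linN. Qed.

Lemma lin_sum V W (f : V -> W) T (s : seq T) (F : T -> V) :
  linear f -> f (\sum_(i <- s) F i) = \sum_(i <- s) f (F i).
Proof.
move=> lf; elim: s => [|i s IH]; first by rewrite !big_nil lin0.
by rewrite !big_cons linD // IH.
Qed.

Section Submodule.
Variables (V : lmodType k) (J : V -> Prop).
Hypothesis HJ : is_submodule J.

Lemma submod0 : J 0. Proof. exact: (QuotientModule.sub0 HJ). Qed.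
Lemma submodZ a x : J x -> J (a *: x). Proof. exact: (QuotientModule.subZ HJ). Qed.
Lemma submodD x y : J x -> J y -> J (x + y). Proof. exact: (QuotientModule.subD HJ). Qed.
Lemma submodN x : J x -> J (- x). Proof. exact: (QuotientModule.subN HJ). Qed.
Lemma submodB x y : J x -> J y -> J (x - y).
Proof. by move=> Jx Jy; apply/submodD/submodN. Qed.

Lemma submod_sum T (s : seq T) (F : T -> V) : (forall i, J (F i)) -> J (\sum_(i <- s) F i).
Proof. by move=> JF; apply: big_ind => // [|x y]; [apply: submod0 | apply: submodD]. Qed.

Lemma submod_preim U (f : U -> V) : linear f -> is_submodule (fun x => J (f x)).
Proof.
move=> lf; split=> [|a x y Jx Jy]; first by rewrite lin0 //; apply: submod0.
by rewrite lf; apply: submodD => //; apply: submodZ.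
Qed.

End Submodule.

(** Spanning is phrased as an induction principle over submodules, the form in which the rewriting
    arguments deliver it and in which it is used. *)
Definition spans V (T : eqType) (s : seq T) (v : T -> V) : Prop :=
  forall S : V -> Prop, is_submodule S -> (forall i, i \in s -> S (v i)) -> forall x, S x.

Section DualBasis.
Variables (V : lmodType k) (T : eqType) (s : seq T) (v : T -> V) (phi : T -> V -> k).
Hypotheses (uniq_s : uniq s) (phi_linear : forall i, linear (phi i : V -> k^o))
  (phi_v : forall i j, i \in s -> j \in s -> phi i (v j) = (i == j)%:R)
  (span_v : spans s v).

(** The vectors that satisfy the expansion form a submodule, so by spanning it is enough to check
    the [v j], where duality leaves one term. *)
Lemma dual_expansion x : x = \sum_(i <- s) phi i x *: v i.
Proof.
have lE : linear (fun x => \sum_(i <- s) phi i x *: v i).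
  move=> a y z; rewrite scaler_sumr -big_split /=; apply: eq_bigr => i _.
  by rewrite phi_linear scalerDl -scalerA.
apply: (span_v (S := fun x => x = \sum_(i <- s) phi i x *: v i)).
  split=> [|a y z Ey Ez]; first by rewrite [RHS](lin0 lE).
  by rewrite [RHS]lE -Ey -Ez.
move=> j js; rewrite (bigD1_seq j) //= phi_v // eqxx scale1r big1_seq ?addr0 // => i.
by case/andP=> ij is_; rewrite phi_v // (negPf ij) scale0r.
Qed.

Lemma dual_has_dim : has_dim V (size s).
Proof.
(* A nonempty list supplies the default element [j0] for [nth]; the empty one gives dimension
   zero. *)
case Es: s => [|j0 s'].
  exists (fun _ => 0); split=> [a x y|]; first by rewrite scaler0 addr0.
  exists (fun _ => 0) => [x|x]; last by apply/matrixP => i [].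
  by rewrite (dual_expansion x) Es big_nil.
rewrite -Es.
exists (fun x => \row_(i < size s) phi (nth j0 s i) x); split.
  by move=> a x y; apply/rowP => i; rewrite !mxE phi_linear.
exists (fun r : 'rV[k]_(size s) => \sum_(i < size s) r 0 i *: v (nth j0 s i)) => [x | r].
  rewrite [RHS]dual_expansion (big_nth j0) big_mkord.
  by apply: eq_bigr => i _; rewrite mxE.
apply/rowP => i; rewrite mxE.
rewrite [LHS](lin_sum _ (fun j => r 0 j *: v (nth j0 s j)) (phi_linear (nth j0 s i))).
rewrite (bigD1 i) //= (linZ _ _ (phi_linear _)) phi_v ?mem_nth // eqxx [_ *: _]mulr1.
rewrite big1 ?addr0 // => j ji; rewrite (linZ _ _ (phi_linear _)) phi_v ?mem_nth //.
by rewrite nth_uniq // (inj_eq val_inj) eq_sym (negPf ji) scaler0.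
Qed.

End DualBasis.

End Linear.

(** The free associative algebra on the letters 0, 1, 2, ... with its
    substitution endomorphisms. It is accessed through this interface only, since
    unification against the ring structure of [{malg _}] is prohibitively slow. *)
Record word_algebra (k : fieldType) := WordAlgebra {
  walg :> lmodType k;
  word : seq nat -> walg;
  coef : seq nat -> walg -> k;
  wmul : walg -> walg -> walg;
  substitution : (nat -> walg) -> walg -> walg;
  coef_linear w : linear (coef w : walg -> k^o);
  coef_word u v : coef u (word v) = (u == v)%:R;
  wmul_linear_l y : linear (fun x => wmul x y);
  wmul_linear_r x : linear (wmul x);
  wmul_word u v : wmul (word u) (word v) = word (u ++ v);
  substitution_linear e : linear (substitution e);
  substitution_letter e l : substitution e (word [:: l]) = e l;
  substitution_wmul e x y :
    substitution e (wmul x y) = wmul (substitution e x) (substitution e y)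
}.

Section FreeAlgebra.
Variable k : fieldType.
Local Notation A := {malg k[fmonom nat]}.

Let aword (w : seq nat) : A := << FMonom w >>.
Let acoef (w : seq nat) (x : A) : k := x@_(FMonom w).
Let amul (x y : A) : A := x * y.
Let asubst (e : nat -> A) : A -> A :=
  mextend (fun m : fmonom nat => \prod_(l <- fmonom_val m) e l).

Let amul_word u v : amul (aword u) (aword v) = aword (u ++ v).
Proof. by rewrite /amul malgM_def fgmulUU mulr1; congr << _ >>; apply: fmmulE. Qed.

Let acoef_linear w : linear (acoef w : A -> k^o).
Proof. by move=> a x y; rewrite /acoef mcoeffD mcoeffZ. Qed.

Let acoef_word u v : acoef u (aword v) = (u == v)%:R.
Proof. by rewrite /acoef mcoeffU1 fmP eq_sym. Qed.

Let word_ext (V : lmodType k) (f g : A -> V) : linear f -> linear g ->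
  (forall w, f (aword w) = g (aword w)) -> f =1 g.
Proof. by move=> lf lg E; apply: eq_linear_malg => // -[w]; apply: E. Qed.

Let amul_linear_l (x : A) : linear (fun y => amul y x).
Proof. by move=> a y z; rewrite /amul mulrDl scalerAl. Qed.

Let amul_linear_r (x : A) : linear (amul x).
Proof.
move=> a y z; rewrite /amul mulrDr; congr (_ + _).
rewrite (malgMEw (fsubset_refl _) (msuppZ_le _ _)) malgME scaler_sumr.
apply: eq_bigr => u _; rewrite scaler_sumr; apply: eq_bigr => v _.
apply/malgP => w; rewrite (mcoeffZ a y v) mulrCA.
by rewrite mcoeffU [RHS]mcoeffZ mcoeffU mulrnAr.
Qed.

Let asubst_linear e : linear (asubst e).
Proof. exact: mextend_linear. Qed.

Let asubst_word e w : asubst e (aword w) = \prod_(l <- w) e l.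
Proof. by rewrite /asubst mextendU. Qed.

Let asubst_letter e l : asubst e (aword [:: l]) = e l.
Proof. by rewrite asubst_word big_seq1. Qed.

Let asubst_mul e x y : asubst e (amul x y) = amul (asubst e x) (asubst e y).
Proof.
have ls := asubst_linear e.
move: x; apply: word_ext => [|| u].
- exact: linear_comp ls (amul_linear_l y).
- exact: linear_comp (amul_linear_l _) ls.
move: y; apply: word_ext => [|| v].
- exact: linear_comp ls (amul_linear_r _).
- exact: linear_comp (amul_linear_r _) ls.
by rewrite amul_word !asubst_word big_cat.
Qed.

Definition free_algebra : word_algebra k :=
  WordAlgebra acoef_linear acoef_word amul_linear_l amul_linear_r amul_word
    asubst_linear asubst_letter asubst_mul.

End FreeAlgebra.

(** * Evaluation of trees *)

Section Evaluation.
Variable k : fieldType.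
Variable A : word_algebra k.

Definition letter (l : nat) : A := word A [:: l].

(** Operands are read with default 0, so argument lists of any length have a value; substitutions
    fix 0 and hence commute with this. *)
Definition gen_value (c : aff_gen) (s : seq A) : A :=
  match c with
  | Gi => s`_0
  | Gbeta => wmul s`_0 s`_1 - wmul s`_1 s`_0
  | Gm => wmul s`_1 s`_0
  end.

Lemma gen_value_substitution e c s :
  substitution e (gen_value c s) = gen_value c (map (substitution e) s).
Proof.
have ls := substitution_linear e.
have E i : (map (substitution e) s)`_i = substitution e s`_i.
  case: (ltnP i (size s)) => lis; first by rewrite (nth_map 0).
  by rewrite !nth_default ?size_map // (lin0 ls).
case: c; rewrite /gen_value.
- by rewrite E.
- by rewrite (linB _ _ ls) !substitution_wmul (E 0%N) (E 1%N).
- by rewrite substitution_wmul (E 0%N) (E 1%N).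
Qed.

Variables (I : finType) (G : signature I) (kind : G -> aff_gen).
Implicit Types (t u : tree G) (e : nat -> A).

Fixpoint ev e t : A :=
  match t with
  | Leaf l => e l
  | Node g ts => gen_value (kind g) (map (ev e) ts)
  end.

Lemma ev_subst e s t : ev e (tsubst s t) = ev (fun l => ev e (s l)) t.
Proof.
elim/tree_nth_ind: t => //= g ts IH; rewrite -map_comp; congr gen_value.
by apply/eq_in_map => t /(nthP (Leaf 0))[i lti <-]; apply: IH.
Qed.

Lemma ev_ext e e' t : {in leaves t, e =1 e'} -> ev e t = ev e' t.
Proof.
elim/tree_nth_ind: t => [l|g ts IH] /= E; first by apply: E; rewrite inE.
congr gen_value; apply/eq_in_map => t tts; have /(nthP (Leaf 0))[i lti Et] := tts.
rewrite -Et; apply: IH => // l; rewrite Et => lt; apply: E.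
by apply/flatten_mapP; exists t.
Qed.

Lemma substitution_ev e' e t : substitution e' (ev e t) = ev (fun l => substitution e' (e l)) t.
Proof.
elim/tree_nth_ind: t => //= g ts IH; rewrite gen_value_substitution -map_comp.
congr gen_value; apply/eq_in_map => t /(nthP (Leaf 0))[i lti <-]; exact: IH.
Qed.

Hypothesis arity_kind : forall g, size (inputs g) = size (aff_inputs (kind g)).

Definition upd (T : Type) (e : nat -> T) j b l := if l == j then b else e l.

(** Each generator is linear in each argument, and since leaves do not repeat, [j] lies in exactly
    one argument; the others are constant in [b]. A repeated letter would already give a quadratic
    expression. *)
Lemma ev_linear lc e j t : well_coloured lc t -> uniq (leaves t) -> j \in leaves t ->
  linear (fun b => ev (upd e j b) t).
Proof.
elim/tree_nth_ind: t => [l|g ts IH] /=.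
  by move=> _ _; rewrite inE => /eqP <- a x y; rewrite /upd eqxx.
have cst u x y : j \notin leaves u -> ev (upd e j x) u = ev (upd e j y) u.
  by move=> ju; apply: ev_ext => l lu; rewrite /upd; case: eqP ju => // <-; rewrite lu.
case/andP=> /eqP/(congr1 size); rewrite !size_map arity_kind.
case: (kind g) ts IH => /= [] [|t [|u [|v ts]]] //= IH _.
- case/andP=> wt _; rewrite cats0 => ut jt; exact: (IH 0%N).
- have {IH}[IHt IHu] := (IH 0%N isT, IH 1%N isT); rewrite /= in IHt IHu.
  rewrite andbT cats0 => /andP[wt wu]; rewrite cat_uniq mem_cat => /and3P[ut dtu uu].
  have [jt _|jt /= ju] := boolP (j \in leaves t).
    have ju : j \notin leaves u by apply: contra dtu => ju; apply/hasP; exists j.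
    move=> a x y; rewrite (cst u _ 0 ju) (cst u x 0 ju) (cst u y 0 ju) IHt //.
    by rewrite (wmul_linear_l _) (wmul_linear_r _) scalerBr opprD addrACA.
  move=> a x y; rewrite (cst t _ 0 jt) (cst t x 0 jt) (cst t y 0 jt) IHu //.
  by rewrite (wmul_linear_l _) (wmul_linear_r _) scalerBr opprD addrACA.
- have {IH}[IHt IHu] := (IH 0%N isT, IH 1%N isT); rewrite /= in IHt IHu.
  rewrite andbT cats0 => /andP[wt wu]; rewrite cat_uniq mem_cat => /and3P[ut dtu uu].
  have [jt _|jt /= ju] := boolP (j \in leaves t).
    have ju : j \notin leaves u by apply: contra dtu => ju; apply/hasP; exists j.
    move=> a x y; rewrite (cst u _ 0 ju) (cst u x 0 ju) (cst u y 0 ju) IHt //.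
    by rewrite (wmul_linear_r _).
  move=> a x y; rewrite (cst t _ 0 jt) (cst t x 0 jt) (cst t y 0 jt) IHu //.
  by rewrite (wmul_linear_l _).
Qed.

Definition wact n (s : 'S_n) : A -> A :=
  substitution (fun l => letter (perm_nat (s^-1)%g l)).

(** The shadow of [pcomp] on words. It is always linear in [a], but in [b] only when [a] is linear
    in the letter [j]. *)
Definition wcomp (j m : nat) (a b : A) : A :=
  substitution (fun l => if l == j then substitution (fun l' => letter (j + l')) b
                         else letter (shift_input j m l)) a.

Definition rl n (chi : {ffun 'I_n -> I}) c : free_operad G k n chi c -> A :=
  mextend (fun t : tree_monomial G chi c => ev letter (val t)).

Lemma rl_mono n (chi : {ffun 'I_n -> I}) c t (Ht : monomial chi c t) :
  rl (mono k Ht) = ev letter t.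
Proof. by rewrite /rl mextendU. Qed.

Lemma rl_linear n (chi : {ffun 'I_n -> I}) c : linear (@rl n chi c).
Proof. exact: mextend_linear. Qed.

Lemma ev_relabel s t : ev letter (relabel s t) = substitution (fun l => letter (s l)) (ev letter t).
Proof.
rewrite ev_subst substitution_ev; apply: ev_ext => l _ /=.
by rewrite substitution_letter.
Qed.

Lemma sact_mono n chi s chi' c (H : @permutes I n chi s chi') t (Ht : monomial chi c t) :
  sact (free_operad G k) H (mono k Ht) = mono k (monomial_perm H Ht).
Proof. exact (Defs.factE k H Ht). Qed.

Lemma pcomp_mono n m r chi j d psi theta c (H : @grafts I n m r chi j d psi theta) t u
    (Ht : monomial chi c t) (Hu : monomial psi d u) :
  pcomp (free_operad G k) H (mono k Ht) (mono k Hu) = mono k (monomial_graft H Ht Hu).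
Proof. exact (fcompE k H Ht Hu). Qed.

Lemma rl_act n chi s chi' c (H : permutes chi s chi') (x : free_operad G k n chi c) :
  rl (sact (free_operad G k) H x) = wact s (rl x).
Proof.
move: x; apply: fspace_ext => [||t Ht].
- exact: linear_comp (@rl_linear _ _ _) (@fact_linear _ _ _ _ _ _ _ _ _).
- exact: linear_comp (substitution_linear _) (@rl_linear _ _ _).
by rewrite sact_mono !rl_mono ev_relabel.
Qed.

Lemma rl_ident (chi : {ffun 'I_1 -> I}) c (e : chi ord0 = c) :
  rl (ident (free_operad G k) e) = letter 0.
Proof. by rewrite rl_mono. Qed.

Lemma rl_comp n m r chi j d psi theta c (H : @grafts I n m r chi j d psi theta)
    (x : free_operad G k n chi c) (y : free_operad G k m psi d) :
  rl (pcomp (free_operad G k) H x y) = wcomp j m (rl x) (rl y).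
Proof.
move: x; apply: fspace_ext => [||t Ht].
- exact: linear_comp (@rl_linear _ _ _) (@fcomp_linear_l _ _ _ _ _ _ _ _ _ _ _ _ _ _).
- exact: linear_comp (substitution_linear _) (@rl_linear _ _ _).
pose e l := letter (shift_input j m l).
have E b : wcomp j m (rl (mono k Ht)) b
    = ev (upd e j (substitution (fun l' => letter (j + l')) b)) t.
  rewrite rl_mono /wcomp substitution_ev; apply: ev_ext => l _.
  by rewrite substitution_letter.
(* Linearity in [y] is not formal: it holds because the monomial [t] uses the letter [j] exactly
   once. *)
have le : linear (fun b => ev (upd e j b) t).
  case/and3P: (Ht) => _ wt pt; apply: (ev_linear _ wt).
    by rewrite (perm_uniq pt) iota_uniq.
  by rewrite (perm_mem pt) mem_iota /=.
move: y; apply: fspace_ext => [||u Hu].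
- exact: linear_comp (@rl_linear _ _ _) (@fcomp_linear_r _ _ _ _ _ _ _ _ _ _ _ _ _ _).
- move=> a y z; rewrite !E rl_linear substitution_linear; exact: le.
rewrite E pcomp_mono !rl_mono ev_subst; apply: ev_ext => l _.
by rewrite /upd; case: eqP => //= _; rewrite ev_relabel.
Qed.

Definition rl_kernel : elements (free_operad G k) := fun n chi c x => rl x = 0.

Lemma rl_kernel_ideal : is_ideal rl_kernel.
Proof.
split.
- move=> n chi c; split; first by rewrite /rl_kernel (lin0 (@rl_linear _ _ _)).
  by move=> a x y Ex Ey; rewrite /rl_kernel rl_linear Ex Ey scaler0 addr0.
- move=> n chi s chi' c H x Ex; rewrite /rl_kernel rl_act Ex.
  exact: lin0 (substitution_linear _).
- move=> n m r chi j d psi theta c H x y Ex; rewrite /rl_kernel rl_comp Ex.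
  exact: lin0 (substitution_linear _).
- move=> n m r chi j d psi theta c H x y Ey; rewrite /rl_kernel rl_comp Ey.
  (* As [wcomp] need not be linear in its second argument, its value at 0 is found by comparison
     with the composite of [x] and 0. *)
  have := rl_comp H x 0; rewrite (lin0 (@rl_linear _ psi d)) => <-.
  by rewrite (lin0 (comp_linear_r _ _)) (lin0 (@rl_linear _ _ _)).
Qed.

End Evaluation.

(** * Trees with arbitrary labels *)

Section LabelledTrees.
Variables (k : fieldType) (I : finType) (G : signature I).
Implicit Types (t u : tree G) (lc : nat -> I) (D : seq nat).
Local Notation P := (free_operad G k).

(** Leaves carry arbitrary labels from a duplicate-free list [D]; the label in
    position [i] of [D] stands for the [i]-th input. *)
Definition lmono lc D c t : bool :=
  [&& out_colour (Some \o lc) t == Some c, well_coloured (Some \o lc) t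
    & perm_eq (leaves t) D].

Definition labelled lc D n (chi : {ffun 'I_n -> I}) : Prop :=
  n = size D /\ forall i : 'I_n, chi i = lc (nth 0%N D i).

(** The value 0 on trees that are not monomials makes this a total function of [t], so sums over
    trees carry no validity proofs. *)
Definition tm n (chi : {ffun 'I_n -> I}) c t : P n chi c :=
  if insub t is Some s then (<< s : tree_monomial G chi c >> : fspace G k chi c) else 0.

Lemma tmE n (chi : {ffun 'I_n -> I}) c t (Ht : monomial chi c t) : tm chi c t = mono k Ht.
Proof. by rewrite /tm (insubT _ Ht). Qed.

(** A label becomes the input given by its position in [D]; reordering [D] thus amounts to acting by
    a permutation. *)
Definition nt n (chi : {ffun 'I_n -> I}) c D t : P n chi c :=
  tm chi c (relabel (index^~ D) t).

Lemma eq_lmono lc lc' D c t : {in D, lc =1 lc'} -> lmono lc D c t -> lmono lc' D c t.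
Proof.
move=> E /and3P[/eqP oc wt pt].
have E' : {in leaves t, forall l, out_colour (Some \o lc') (Leaf l : tree G) = (Some \o lc) l}.
  by move=> l; rewrite (perm_mem pt) => /E /= ->.
rewrite -[t]subst_id; apply/and3P; split.
- by rewrite (out_colour_subst E') oc.
- exact: well_coloured_subst E' _ wt.
- by rewrite subst_id.
Qed.

Lemma perm_lmono lc D D' c t : perm_eq D D' -> lmono lc D c t -> lmono lc D' c t.
Proof. by move=> p /and3P[oc wt pt]; apply/and3P; split=> //; apply: perm_trans pt p. Qed.

Lemma lmono_monomial lc D n (chi : {ffun 'I_n -> I}) c t :
  labelled lc D chi -> uniq D -> lmono lc D c t -> monomial chi c (relabel (index^~ D) t).
Proof.
case=> En Ec uD /and3P[/eqP oc wt pt].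
have E : {in leaves t, forall l,
    out_colour (leaf_colour chi) (Leaf (index l D) : tree G) = (Some \o lc) l}.
  move=> l; rewrite (perm_mem pt) => lD /=.
  have lt : (index l D < n)%N by rewrite En index_mem.
  by rewrite (leaf_colour_lt _ lt) Ec /= nth_index.
apply/and3P; split.
- by rewrite (out_colour_subst E) oc.
- exact: well_coloured_subst E _ wt.
rewrite leaves_relabel; apply: perm_trans (perm_map _ pt) _.
suff -> : map (index^~ D) D = iota 0 n by [].
apply: (@eq_from_nth _ 0%N); rewrite size_map ?size_iota // => i lti.
by rewrite (nth_map 0%N) // index_uniq // nth_iota ?En.
Qed.

Lemma lmono_subst lc D1 z D2 D' c t u : uniq (D1 ++ z :: D2) ->
  lmono lc (D1 ++ z :: D2) c t -> lmono lc D' (lc z) u ->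
  lmono lc (D1 ++ D' ++ D2) c (tsubst (upd Leaf z u) t).
Proof.
move=> uD /and3P[/eqP oc wt pt] /and3P[/eqP ocu wu pu].
have E : {in leaves t, forall l, out_colour (Some \o lc) (upd Leaf z u l) = (Some \o lc) l}.
  by move=> l _; rewrite /upd; case: eqP => [->|].
apply/and3P; split.
- by rewrite (out_colour_subst E) oc.
- by apply: well_coloured_subst E _ wt => l _; rewrite /upd; case: eqP.
rewrite leaves_subst; apply: perm_trans (perm_flatten (perm_map _ pt)) _.
rewrite map_cat /= flatten_cat /=.
have E1 s : z \notin s -> flatten [seq leaves (upd Leaf z u l) | l <- s] = s.
  move=> zs; rewrite -[RHS]flatten_seq1; congr flatten; apply/eq_in_map => l ls.
  by rewrite /upd; case: eqP zs => // <-; rewrite ls.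
move: uD; rewrite cat_uniq /= negb_or => /and3P[_ /andP[z1 _] /andP[z2 _]].
by rewrite !E1 // {1}/upd eqxx perm_cat2l perm_cat2r.
Qed.

(** The permutation sends a position in [D'] to the position of the same label in [D]. It depends on
    the lists and not on the tree, so a single group element moves a whole linear combination. *)
Lemma nt_perm lc D D' n (chi chi' : {ffun 'I_n -> I}) :
  labelled lc D chi -> labelled lc D' chi' -> uniq D -> perm_eq D D' ->
  exists s, exists H : permutes chi s chi',
    forall c t, lmono lc D c t -> sact P H (nt chi c D t) = nt chi' c D' t.
Proof.
move=> hD hD' uD pD; have [En Ec] := hD; have [En' Ec'] := hD'.
have uD' : uniq D' by rewrite -(perm_uniq pD).
have lt (i : 'I_n) : (index (nth 0%N D' i) D < n)%N.
  by rewrite [X in (_ < X)%N]En index_mem (perm_mem pD) mem_nth // -En'.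
have inj : injective (fun i => Ordinal (lt i)).
  move=> i j /(congr1 val) /= /(congr1 (nth 0%N D)).
  rewrite !nth_index ?(perm_mem pD) ?mem_nth -?En' // => /eqP.
  by rewrite nth_uniq -?En' // => /eqP/val_inj.
pose s := perm inj.
have sE i : nth 0%N D (s i) = nth 0%N D' i.
  by rewrite permE /= nth_index // (perm_mem pD) mem_nth // -En'.
have H : permutes chi s chi' by move=> i; rewrite Ec Ec' sE.
exists s, H => c t lt_.
have mt := lmono_monomial hD uD lt_.
rewrite /nt (tmE mt) sact_mono (tmE (lmono_monomial hD' uD' (perm_lmono pD lt_))).
apply: mono_eq; rewrite /relabel subst_comp; apply: subst_ext => l.
case/and3P: lt_ => _ _ /perm_mem -> lD /=; congr Leaf.
have lt1 : (index l D < n)%N by rewrite En index_mem.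
have lt2 : (index l D' < n)%N by rewrite En' index_mem -(perm_mem pD).
rewrite (perm_nat_lt _ lt1).
suff -> : Ordinal lt1 = s (Ordinal lt2) by rewrite permK.
by apply: val_inj; rewrite permE /= nth_index // -(perm_mem pD).
Qed.

(** On labels, partial composition is plain substitution for [z]: the shifts of inputs are absorbed
    by positions in the concatenated lists. The slot and the grafting data do not depend on the
    trees, so the formula extends to linear combinations. *)
Lemma nt_comp lc D1 z D2 D' n m r (chi : {ffun 'I_n -> I}) (psi : {ffun 'I_m -> I})
    (theta : {ffun 'I_r -> I}) :
  labelled lc (D1 ++ z :: D2) chi -> labelled lc D' psi -> labelled lc (D1 ++ D' ++ D2) theta ->
  uniq (D1 ++ z :: D2) -> uniq (D1 ++ D' ++ D2) ->
  exists j, exists H : grafts chi j (lc z) psi theta,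
    forall c t u, lmono lc (D1 ++ z :: D2) c t -> lmono lc D' (lc z) u ->
      pcomp P H (nt chi c (D1 ++ z :: D2) t) (nt psi (lc z) D' u)
      = nt theta c (D1 ++ D' ++ D2) (tsubst (upd Leaf z u) t).
Proof.
move=> hD hD' hD'' uD uD''; have [En Ec] := hD; have [Em Ec'] := hD'; have [Er Ec''] := hD''.
have Es : size (D1 ++ z :: D2) = (size D1 + (size D2).+1)%N by rewrite size_cat.
have ltj : (size D1 < n)%N by rewrite En Es; lia.
pose j := Ordinal ltj.
have nthD i d : (i < size D1)%N -> nth 0%N (D1 ++ d) i = nth 0%N D1 i.
  by move=> lti; rewrite nth_cat lti.
have nthR i d : nth 0%N (D1 ++ d) (size D1 + i) = nth 0%N d i.
  by rewrite nth_cat ltnNge leq_addr /= addKn.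
have H : grafts chi j (lc z) psi theta.
  split.
  - by rewrite En Em Er !size_cat /=; lia.
  - by rewrite Ec /= -[size D1]addn0 nthR.
  - move=> i v ij Ev; rewrite Ec Ec''; congr lc; rewrite Ev /shift_input /=.
    have nij : (i : nat) != size D1 by apply: contra ij => /eqP E; apply/eqP/val_inj.
    case: ltnP => lti; first by rewrite !nthD.
    have -> : (i + m).-1 = (size D1 + (m + (i - (size D1).+1)))%N by lia.
    rewrite nthR nth_cat Em ltnNge leq_addr /= addKn.
    have {2}-> : (i : nat) = (size D1 + (i - (size D1).+1).+1)%N by lia.
    by rewrite nthR.
  - by move=> l v Ev; rewrite Ec'' Ec' Ev /= nthR nth_cat -Em ltn_ord.
exists j, H => c t u lt_ lu.
have uD' : uniq D' by move: uD''; rewrite !cat_uniq => /and3P[_ _ /andP[]].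
have lt'' := lmono_subst uD lt_ lu.
rewrite /nt (tmE (lmono_monomial hD uD lt_)) (tmE (lmono_monomial hD' uD' lu)).
rewrite (tmE (lmono_monomial hD'' uD'' lt'')) pcomp_mono; apply: mono_eq.
rewrite /graft /relabel !subst_comp; apply: subst_ext => l.
case/and3P: lt_ => _ _ /perm_mem -> lD /=.
have z1 : z \notin D1 by move: uD; rewrite cat_uniq /= negb_or => /and3P[_ /andP[]].
have indz : index z (D1 ++ z :: D2) = size D1.
  by rewrite index_cat (negPf z1) /= eqxx addn0.
have -> : (index l (D1 ++ z :: D2) == size D1) = (l == z).
  apply/eqP/eqP => [E|->//].
  rewrite -(nth_index 0%N lD) E -[size D1]addn0 nthR //.
rewrite /upd; case: eqP => [Elz|/eqP nlz].
  apply: subst_ext => l'.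
  case/and3P: lu => _ _ /perm_mem -> l'D' /=; congr Leaf.
  have l'1 : l' \notin D1.
    move: uD''; rewrite cat_uniq => /and3P[_ + _]; apply: contra => l'1.
    by apply/hasP; exists l'; rewrite ?mem_cat ?l'D'.
  by rewrite !index_cat (negPf l'1) l'D'.
rewrite /= /shift_input; congr Leaf; rewrite !index_cat.
case: (boolP (l \in D1)) => l1; first by rewrite index_mem l1.
have -> : (size D1 + index l (z :: D2) < size D1)%N = false by lia.
move: lD; rewrite mem_cat inE (negPf l1) (negPf nlz) /= => l2.
have -> : (l \in D') = false.
  apply/negP => l'; move: uD''; rewrite !cat_uniq => /and3P[_ _ /and3P[_ + _]].
  by case/hasP; exists l.
by rewrite eq_sym (negPf nlz) -Em; lia.
Qed.

End LabelledTrees.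

(** * Relations between labelled trees modulo an ideal *)

Section Null.
Variables (k : fieldType) (I : finType) (G : signature I).
Implicit Types (t u : tree G) (lc : nat -> I) (D : seq nat) (F : seq (k * tree G)).
Local Notation P := (free_operad G k).

(** The combination stays a formal list [F], so that the same relation can be evaluated by different
    functions [v] in different spaces. *)
Definition lincomb (V : lmodType k) (v : tree G -> V) F : V := \sum_(p <- F) p.1 *: v p.2.

Definition map_trees (f : tree G -> tree G) F := [seq (p.1, f p.2) | p <- F].

Lemma lincomb_map (V : lmodType k) (v : tree G -> V) f F :
  lincomb v (map_trees f F) = lincomb (fun t => v (f t)) F.
Proof. by rewrite /lincomb big_map. Qed.

Lemma eq_map_trees f f' F :
  (forall p, p \in F -> f p.2 = f' p.2) -> map_trees f F = map_trees f' F.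
Proof. by move=> E; apply/eq_in_map => p /E ->. Qed.

Lemma eq_lincomb (V : lmodType k) (v v' : tree G -> V) F :
  (forall p, p \in F -> v p.2 = v' p.2) -> lincomb v F = lincomb v' F.
Proof. by move=> E; apply: eq_big_seq => p /E ->. Qed.

Lemma linear_lincomb (V W : lmodType k) (f : V -> W) (v : tree G -> V) F : linear f ->
  f (lincomb v F) = lincomb (fun t => f (v t)) F.
Proof. by move=> lf; rewrite /lincomb lin_sum //; apply: eq_bigr => p _; rewrite linZ. Qed.

Definition all_lmono lc D c F := forall p, p \in F -> lmono lc D c p.2.

Variable J : elements P.

(** The arity [n] is a separate variable, tied to [size D] only through [labelled]; this avoids
    transporting elements along equalities of arities when [D] is rearranged. *)
Definition null lc D c F : Prop :=
  all_lmono lc D c F /\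
  forall n (chi : {ffun 'I_n -> I}), labelled lc D chi -> J (lincomb (nt k chi c D) F).

Lemma eq_null lc lc' D c F : {in D, lc =1 lc'} -> null lc D c F -> null lc' D c F.
Proof.
move=> E [mF JF]; split=> [p /mF|n chi [En Ec]]; first exact: eq_lmono.
by apply: JF; split=> // i; rewrite Ec E // mem_nth // -En.
Qed.

Hypothesis HJ : is_ideal J.

Definition label_colouring lc D : {ffun 'I_(size D) -> I} := [ffun i : 'I__ => lc (nth 0%N D i)].

Lemma label_colouringP lc D : labelled lc D (label_colouring lc D).
Proof. by split=> // i; rewrite ffunE. Qed.

Lemma null_perm lc D D' c F : uniq D -> perm_eq D D' -> null lc D c F -> null lc D' c F.
Proof.
case: HJ => _ Jact _ _ uD pD [mF JF]; split=> [p /mF|n chi' hD']; first exact: perm_lmono.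
have [En' _] := hD'.
have En : n = size D by rewrite En' (perm_size pD).
pose chi := [ffun i : 'I_n => lc (nth 0%N D i)].
have hD : labelled lc D chi by split=> // i; rewrite ffunE.
have [s [H E]] := nt_perm k G hD hD' uD pD.
have := Jact _ _ _ _ _ H _ (JF _ _ hD).
rewrite linear_lincomb; last exact: act_linear.
by rewrite (eq_lincomb (v' := nt k chi' c D')) // => p /mF; apply: E.
Qed.

(** Closure of the ideal when its element is the outer factor of a composition; [null_context] is
    the case of the inner factor. Together they give instances of relations inside arbitrary
    trees. *)
Lemma null_graft lc D1 z D2 D' c F u :
  uniq (D1 ++ z :: D2) -> uniq (D1 ++ D' ++ D2) ->
  null lc (D1 ++ z :: D2) c F -> lmono lc D' (lc z) u ->
  null lc (D1 ++ D' ++ D2) c (map_trees (tsubst (upd Leaf z u)) F).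
Proof.
case: HJ => _ _ Jl _ uD uD'' [mF JF] mu; split=> [p /mapP[q /mF mq ->]|n theta hD''].
  exact: lmono_subst mu.
have hD := label_colouringP lc (D1 ++ z :: D2); have hD' := label_colouringP lc D'.
have [j [H E]] := nt_comp k G hD hD' hD'' uD uD''.
have := Jl _ _ _ _ _ _ _ _ _ H _ (nt k _ _ D' u) (JF _ _ hD).
have /= -> := linear_lincomb (nt k _ c _) F (comp_linear_l (c := c) H (nt k _ _ D' u)).
rewrite lincomb_map.
by rewrite (eq_lincomb (v' := fun t => nt k theta c (D1 ++ D' ++ D2) (tsubst (upd Leaf z u) t)))
  // => p /mF mp; apply: E.
Qed.

Lemma null_context lc D1 z D2 D' c F t :
  uniq (D1 ++ z :: D2) -> uniq (D1 ++ D' ++ D2) ->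
  lmono lc (D1 ++ z :: D2) c t -> null lc D' (lc z) F ->
  null lc (D1 ++ D' ++ D2) c (map_trees (fun u => tsubst (upd Leaf z u) t) F).
Proof.
case: HJ => _ _ _ Jr uD uD'' mt [mF JF]; split=> [p /mapP[q /mF mq ->]|n theta hD''].
  exact: lmono_subst mq.
have hD := label_colouringP lc (D1 ++ z :: D2); have hD' := label_colouringP lc D'.
have [j [H E]] := nt_comp k G hD hD' hD'' uD uD''.
have := Jr _ _ _ _ _ _ _ _ _ H (nt k _ c (D1 ++ z :: D2) t) _ (JF _ _ hD').
rewrite (linear_lincomb _ F (comp_linear_r H _)).
rewrite lincomb_map.
by rewrite (eq_lincomb (v' := fun u => nt k theta c (D1 ++ D' ++ D2) (tsubst (upd Leaf z u) t)))
  // => p /mF mp; apply: E.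
Qed.

Lemma subst_fresh z u t : z \notin leaves t -> tsubst (upd Leaf z u) t = t.
Proof.
move=> zt; rewrite -[RHS]subst_id; apply: subst_ext => l lt.
by rewrite /upd; case: eqP zt => // <-; rewrite lt.
Qed.

Definition fresh D := (\max_(l <- D) l).+1.

Lemma fresh_gt D l : l \in D -> (l < fresh D)%N.
Proof. by move=> lD; rewrite ltnS; exact: (leq_bigmax_seq (P := xpredT) (F := fun i => i) l lD). Qed.

Lemma fresh_notin D i : (fresh D + i)%N \notin D.
Proof. by apply/negP => /fresh_gt; rewrite ltnNge leq_addr. Qed.

(** The context is the same node with a fresh leaf [z] in the free slot. The colouring is changed at
    [z] alone, to give the slot the colour [d]. *)
Lemma null_node lc (g : G) us1 us2 d D1 D D2 F :
  null lc D d F -> uniq (D1 ++ D ++ D2) ->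
  map (out_colour (Some \o lc)) us1 ++ Some d :: map (out_colour (Some \o lc)) us2
    = map Some (inputs g) ->
  all (well_coloured (Some \o lc)) (us1 ++ us2) ->
  perm_eq (flatten (map (@leaves I G) us1)) D1 -> perm_eq (flatten (map (@leaves I G) us2)) D2 ->
  null lc (D1 ++ D ++ D2) (output g) (map_trees (fun t => Node g (us1 ++ t :: us2)) F).
Proof.
move=> nF uD Eg wus p1 p2; set D0 := D1 ++ D ++ D2.
pose z := fresh D0; pose lc' := upd lc z d.
have nz l : l \in D0 -> (l == z) = false by move=> /fresh_gt lt; apply/eqP => E; rewrite E ltnn in lt.
have E : {in D0, lc =1 lc'} by move=> l /nz; rewrite /lc' /upd => ->.
have sub1 : {subset D1 <= D0} by move=> l; rewrite !mem_cat => ->.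
have sub2 : {subset D2 <= D0} by move=> l; rewrite !mem_cat => ->; rewrite !orbT.
have subD : {subset D <= D0} by move=> l; rewrite !mem_cat => ->; rewrite orbT.
have lcz : lc' z = d by rewrite /lc' /upd eqxx.
have nF' : null lc' D (lc' z) F by rewrite lcz; apply: eq_null nF => l /subD /E.
apply: (@eq_null lc'); first by move=> l /E.
have ul u us : u \in us -> {subset leaves u <= flatten (map (@leaves I G) us)}.
  by move=> uus l lu; apply/flatten_mapP; exists u.
have E' u : {subset leaves u <= D0} ->
    {in leaves u, forall l, out_colour (Some \o lc') (Leaf l : tree G) = (Some \o lc) l}.
  by move=> su l /su lu /=; rewrite -E.
have wc u : {subset leaves u <= D0} -> well_coloured (Some \o lc) u ->
    well_coloured (Some \o lc') u.
  by move=> su wu; rewrite -[u]subst_id; apply: (well_coloured_subst (E' u su)).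
have oc u : {subset leaves u <= D0} -> out_colour (Some \o lc') u = out_colour (Some \o lc) u.
  by move=> su; rewrite -{1}[u]subst_id; apply: (out_colour_subst (E' u su)).
have s1 u : u \in us1 -> {subset leaves u <= D0}.
  by move=> /ul uus l /uus; rewrite (perm_mem p1) => /sub1.
have s2 u : u \in us2 -> {subset leaves u <= D0}.
  by move=> /ul uus l /uus; rewrite (perm_mem p2) => /sub2.
have mt : lmono lc' (D1 ++ z :: D2) (output g) (Node g (us1 ++ Leaf z :: us2)).
  apply/and3P; split=> //=.
  - apply/andP; split.
      rewrite map_cat /= lcz -Eg; apply/eqP; congr (_ ++ (_ :: _)); apply/eq_in_map => u.
        by move/s1/oc.
      by move/s2/oc.
    move: wus; rewrite !all_cat /= => /andP[/allP w1 /allP w2].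
    by apply/andP; split; apply/allP => u uu; [apply: wc (s1 _ uu) (w1 _ uu)
      | apply: wc (s2 _ uu) (w2 _ uu)].
  - by rewrite map_cat flatten_cat /= perm_cat // perm_cons.
have zD0 : z \notin D0 by rewrite -[z]addn0 fresh_notin.
have uDz : uniq (D1 ++ z :: D2).
  move: uD; rewrite uniq_catCA cat_uniq => /and3P[_ _].
  rewrite -cat1s uniq_catCA cat1s cons_uniq => ->; rewrite andbT.
  by apply: contra zD0; rewrite mem_cat => /orP[/sub1|/sub2].
have := null_context uDz uD mt nF'.
rewrite (eq_map_trees (f' := fun t => Node g (us1 ++ t :: us2))) // => p _.
rewrite /=; congr Node; rewrite map_cat /= {2}/upd eqxx.
by congr (_ ++ (_ :: _)); rewrite -[RHS]map_id; apply/eq_in_map => v vus;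
  apply: subst_fresh; [have := s1 v vus z | have := s2 v vus z]; case: (_ \in leaves v) => // /(_ isT);
  rewrite (negPf zD0).
Qed.

(** Simultaneous substitution into a relation is obtained from partial compositions, one input at a
    time. The inputs are first renamed to [M + i], beyond all labels of the inserted trees, so that
    no later substitution touches an inserted tree. *)
Lemma null_instance lc (col : nat -> I) c F (us : seq (tree G)) (Ds : seq (seq nat)) :
  (forall n (chi : {ffun 'I_n -> I}), labelled col (iota 0 (size us)) chi ->
     J (lincomb (tm k chi c) F)) ->
  all_lmono col (iota 0 (size us)) c F -> size Ds = size us -> uniq (flatten Ds) ->
  (forall i, (i < size us)%N -> lmono lc (nth [::] Ds i) (col i) (nth (Leaf 0) us i)) ->
  null lc (flatten Ds) c (map_trees (tsubst (nth (Leaf 0) us)) F).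
Proof.
set a := size us => JF mF sD uD mus.
pose M := fresh (flatten Ds).
pose lc' l := if (l < M)%N then lc l else col (l - M)%N.
have E : {in flatten Ds, lc' =1 lc} by move=> l /fresh_gt lt; rewrite /lc' lt.
apply: (eq_null E).
have subD i : {subset nth [::] Ds i <= flatten Ds}.
  move=> l lD; apply/flattenP; exists (nth [::] Ds i) => //; apply: mem_nth.
  by case: ltnP lD => // /(nth_default _) ->.
(* After [j] steps the inputs below [j] carry their trees and the others are still the leaves
   [M + i]. *)
pose f j i := if (i < j)%N then nth (Leaf 0) us i else Leaf (M + i) : tree G.
suff main : forall j, (j <= a)%N ->
    null lc' (flatten (take j Ds) ++ iota (M + j) (a - j)) c (map_trees (tsubst (f j)) F).
  have := main a (leqnn a); rewrite -{1}sD take_size subnn cats0.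
  rewrite (eq_map_trees (f' := tsubst (nth (Leaf 0) us))) // => p /mF.
  case/and3P=> _ _ pp; apply: subst_ext => l.
  by rewrite (perm_mem pp) mem_iota /f => /andP[_ ->].
have uDj j : (j <= a)%N -> uniq (flatten (take j Ds) ++ iota (M + j) (a - j)).
  move=> lej; have : uniq (flatten (take j Ds)).
    by move: uD; rewrite -{1}(cat_take_drop j Ds) flatten_cat cat_uniq => /andP[].
  rewrite cat_uniq iota_uniq => ->; rewrite /= andbT; apply/hasPn => l.
  rewrite mem_iota => /andP[leM _]; apply/negP => lD.
  suff /fresh_gt : l \in flatten Ds by rewrite -/M; lia.
  by rewrite -(cat_take_drop j Ds) flatten_cat mem_cat lD.
elim=> [_|j IH ltj].
  (* With nothing inserted this is the relation itself: the position of [M + i] in the list of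
     labels is [i]. *)
  rewrite take0 subn0 /= addn0; split=> [p|].
    case/mapP=> q /mF/and3P[/eqP oc wt pt] ->.
    have E' : {in leaves q.2, forall l, out_colour (Some \o lc') (f 0%N l) = (Some \o col) l}.
      by move=> l _; rewrite /f /= /lc' ltnNge leq_addr /= addKn.
    apply/and3P; split=> /=.
    - by rewrite (out_colour_subst E') oc.
    - exact: well_coloured_subst E' _ wt.
    rewrite -[tsubst _ _]/(relabel (addn M) q.2) leaves_relabel.
    by apply: perm_trans (perm_map _ pt) _; rewrite -iotaDl addn0.
  move=> n chi [En Ec]; rewrite lincomb_map.
  rewrite (eq_lincomb (v' := tm k chi c)); last first.
    move=> p /mF/and3P[_ _ pp]; congr tm; rewrite /relabel subst_comp -[RHS]subst_id.
    apply: subst_ext => l; rewrite (perm_mem pp) mem_iota /= => ltl; congr Leaf.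
    by rewrite -[(M + l)%N](nth_iota 0%N M ltl) index_uniq ?iota_uniq ?size_iota.
  apply: JF; split=> [|i]; first by rewrite En !size_iota.
  have lti : (i < a)%N by rewrite -[a](size_iota M) -En.
  by rewrite Ec !nth_iota // /lc' ltnNge leq_addr /= addKn.
have ltjD : (j < size Ds)%N by rewrite sD.
have Ea : (a - j = (a - j.+1).+1)%N by lia.
have {IH} := IH (ltnW ltj); rewrite Ea /= => IH.
have lcz : lc' (M + j)%N = col j by rewrite /lc' ltnNge leq_addr /= addKn.
have mu : lmono lc' (nth [::] Ds j) (lc' (M + j)%N) (nth (Leaf 0) us j).
  by rewrite lcz; apply: eq_lmono (mus j ltj) => l /subD /E.
have uDz := uDj j (ltnW ltj); rewrite Ea /= in uDz.
have := uDj j.+1 ltj; rewrite (take_nth [::] ltjD) flatten_rcons -catA addnS => uD'.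
have := null_graft uDz uD' IH mu.
rewrite [map_trees _ (map_trees _ _)]/map_trees -map_comp.
rewrite -/(map_trees (fun t => tsubst (upd Leaf (M + j) (nth (Leaf 0) us j)) (tsubst (f j) t)) F).
rewrite (eq_map_trees (f' := tsubst (f j.+1))) // => p /mF.
case/and3P=> _ _ pp /=; rewrite subst_comp; apply: subst_ext => l.
rewrite (perm_mem pp) mem_iota /= => ltl; rewrite /f ltnS.
case: ltngtP => [ltlj|ltjl|Elj] /=.
- apply: subst_fresh; case/and3P: (mus l ltl) => _ _ /perm_mem ->.
  by apply: contra (fresh_notin (flatten Ds) j) => /subD.
- by rewrite /upd eqn_add2l; case: eqP => // El; rewrite El ltnn in ltjl.
- by rewrite Elj /upd eqxx.
Qed.

Lemma null_ext lc D c F F' : null lc D c F -> all_lmono lc D c F' ->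
  (forall (V : lmodType k) (v : tree G -> V), lincomb v F' = lincomb v F) -> null lc D c F'.
Proof. by case=> _ JF mF' E; split=> // n chi hD; rewrite E; apply: JF. Qed.

Lemma null_cat lc D c F F' : null lc D c F -> null lc D c F' -> null lc D c (F ++ F').
Proof.
case: HJ => sJ _ _ _ [mF JF] [mF' JF']; split=> [p|n chi hD].
  by rewrite mem_cat => /orP[/mF|/mF'].
rewrite /lincomb big_cat; apply: submodD => //; [exact: JF | exact: JF'].
Qed.

Lemma null_opp lc D c F : null lc D c F -> null lc D c [seq (- p.1, p.2) | p <- F].
Proof.
case: HJ => sJ _ _ _ [mF JF]; split=> [p /mapP[q /mF mq ->] //|n chi hD].
rewrite /lincomb big_map (eq_bigr (fun p => - (p.1 *: nt k chi c D p.2))) => [|p _].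
  by rewrite sumrN; apply: submodN => //; apply: JF.
by rewrite scaleNr.
Qed.

(** Typically [v] is the class of a tree placed in fixed surroundings. Replacing [v] by a function
    such as [fun t => v (Node g [:: t; u])] deepens the surroundings, and [sound_l] and [sound_r]
    say that relations are still respected modulo [S]. *)
Definition sound (V : lmodType k) (S : V -> Prop) (v : tree G -> V) lc D0 c : Prop :=
  forall D F, perm_eq D D0 -> null lc D c F -> S (lincomb v F).

End Null.

Section WellTyped.
Variables (I : finType) (G : signature I).
Implicit Types (t u : tree G) (lc : nat -> I).

Definition wt lc c t : bool :=
  (out_colour (Some \o lc) t == Some c) && well_coloured (Some \o lc) t.

Lemma lmonoE lc D c t : lmono lc D c t = wt lc c t && perm_eq (leaves t) D.
Proof. by rewrite /lmono /wt andbA. Qed.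

Lemma wt_leaf lc c l : wt lc c (Leaf l : tree G) = (lc l == c).
Proof. by rewrite /wt /= andbT; apply/eqP/eqP => [[]|->]. Qed.

Lemma wt_node1 lc c g t a : inputs g = [:: a] ->
  wt lc c (Node g [:: t]) = (output g == c) && wt lc a t.
Proof.
move=> Eg; rewrite /wt /= Eg /= andbT eqseq_cons andbT.
by congr (_ && _); apply/eqP/eqP => [[]|->].
Qed.

Lemma wt_node2 lc c g t u a b : inputs g = [:: a; b] ->
  wt lc c (Node g [:: t; u]) = [&& output g == c, wt lc a t & wt lc b u].
Proof.
move=> Eg; rewrite /wt /= Eg /= !andbT !eqseq_cons andbT.
have -> : (Some (output g) == Some c) = (output g == c) by apply/eqP/eqP => [[]|->].
by case: (output g == c); case: (_ == Some a); case: (_ == Some b);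
  case: (well_coloured _ t) => //=; rewrite ?andbF.
Qed.

Lemma wt_node2_inv lc c g ts a b : inputs g = [:: a; b] -> wt lc c (Node g ts) ->
  exists t u, ts = [:: t; u].
Proof.
move=> Eg /andP[_ /= /andP[/eqP E _]]; move: E; rewrite Eg.
by case: ts => [|t [|u []]] //= _; exists t, u.
Qed.

Lemma wt_node1_inv lc c g ts a : inputs g = [:: a] -> wt lc c (Node g ts) ->
  exists t, ts = [:: t].
Proof.
move=> Eg /andP[_ /= /andP[/eqP E _]]; move: E; rewrite Eg.
by case: ts => [|t []] //= _; exists t.
Qed.

Lemma leaves2 (g : G) t u : leaves (Node g [:: t; u]) = leaves t ++ leaves u.
Proof. by rewrite /= cats0. Qed.

Lemma leaves1 (g : G) t : leaves (Node g [:: t]) = leaves t.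
Proof. by rewrite /= cats0. Qed.

End WellTyped.

(* Reduces [perm_eq] goals, modulo [perm_eq] hypotheses, to linear arithmetic on
   the numbers of occurrences. *)
Ltac perms :=
  let a := fresh "a" in
  apply/seq.permP => a;
  repeat match goal with H : is_true (perm_eq _ _) |- _ =>
    generalize (elimT seq.permP H a); clear H end;
  rewrite /= ?cats0 ?count_cat /= ?cats0 ?count_cat /=;
  repeat match goal with |- context [count a ?s] => move: (count a s) end;
  clear; lia.

Section Nodes.
Variables (k : fieldType) (I : finType) (G : signature I) (J : elements (free_operad G k)).
Hypothesis HJ : is_ideal J.
Implicit Types (t u : tree G) (lc : nat -> I).
Variables (V : lmodType k) (S : V -> Prop) (v : tree G -> V).

Lemma sound_perm lc D D' c : perm_eq D D' -> sound J S v lc D c -> sound J S v lc D' c.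
Proof. by move=> p sv D'' F p' nF; apply: sv nF; rewrite (permPl p') perm_sym. Qed.

Lemma sound_l lc (g : G) a b u D0 D : inputs g = [:: a; b] -> uniq D0 ->
  perm_eq (D ++ leaves u) D0 -> wt lc b u -> sound J S v lc D0 (output g) ->
  sound J S (fun t => v (Node g [:: t; u])) lc D a.
Proof.
move=> Eg uD p /andP[/eqP ou wu] sv D' F p' nF.
have p'' : perm_eq ([::] ++ D' ++ leaves u) D0 by rewrite /= -(permPr p) perm_cat2r.
have := sv _ _ p'' (@null_node _ _ _ _ HJ lc g [::] [:: u] a [::] D' (leaves u) F nF _ _ _ _ _).
rewrite lincomb_map; apply=> //.
- by rewrite (perm_uniq p'').
- by rewrite /= ou Eg.
- by rewrite /= wu.
- by rewrite /= cats0.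
Qed.

Lemma sound_r lc (g : G) a b u D0 D : inputs g = [:: a; b] -> uniq D0 ->
  perm_eq (leaves u ++ D) D0 -> wt lc a u -> sound J S v lc D0 (output g) ->
  sound J S (fun t => v (Node g [:: u; t])) lc D b.
Proof.
move=> Eg uD p /andP[/eqP ou wu] sv D' F p' nF.
have p'' : perm_eq (leaves u ++ D' ++ [::]) D0 by rewrite cats0 -(permPr p) perm_cat2l.
have := sv _ _ p'' (@null_node _ _ _ _ HJ lc g [:: u] [::] b (leaves u) D' [::] F nF _ _ _ _ _).
rewrite lincomb_map; apply=> //.
- by rewrite (perm_uniq p'').
- by rewrite /= ou Eg.
- by rewrite /= wu.
- by rewrite /= cats0.
Qed.

End Nodes.

(** * Spanning sets *)

Section Combs.
Variables (k : fieldType) (I : finType) (G : signature I) (g : G) (c : I).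
Hypotheses (inputs_g : inputs g = [:: c; c]) (output_g : output g = c).
Implicit Types (t u : tree G) (lc : nat -> I).

Definition bracket t u : tree G := Node g [:: t; u].

Definition comb x s : tree G := foldl (fun t l => bracket t (Leaf l)) (Leaf x) s.

Lemma comb_rcons x s l : comb x (rcons s l) = bracket (comb x s) (Leaf l).
Proof. by rewrite /comb -cats1 foldl_cat. Qed.

Lemma wt_bracket lc t u : wt lc c (bracket t u) = wt lc c t && wt lc c u.
Proof. by rewrite /bracket (wt_node2 _ _ _ _ inputs_g) output_g eqxx. Qed.

Lemma leaves_comb x s : leaves (comb x s) = x :: s.
Proof.
elim/last_ind: s => [|s l IH] //; first by rewrite comb_rcons leaves2 IH -cats1.
Qed.

Lemma wt_comb lc x s : wt lc c (comb x s) = all (fun l => lc l == c) (x :: s).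
Proof.
elim/last_ind: s => [|s l IH]; first by rewrite /= andbT wt_leaf.
by rewrite comb_rcons wt_bracket IH wt_leaf /= all_rcons -andbA [X in _ && X]andbC.
Qed.

(** As [g] is the only generator with output [c] and its inputs have colour [c] too, trees of colour
    [c] are bracketings of leaves of colour [c]. *)
Lemma wt_bracket_ind lc (Q : tree G -> Prop) : (forall g', output g' = c -> g' = g) ->
  (forall l, lc l = c -> Q (Leaf l)) ->
  (forall t u, wt lc c t -> wt lc c u -> Q t -> Q u -> Q (bracket t u)) ->
  forall t, wt lc c t -> Q t.
Proof.
move=> only QL QN; elim/tree_nth_ind=> [l|g' ts IH wts].
  by rewrite wt_leaf => /eqP; apply: QL.
have Eg : g' = g by apply: only; case/andP: wts => /eqP[].
subst g'; have [t [u Et]] := wt_node2_inv inputs_g wts; subst ts.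
move: wts; rewrite -/(bracket t u) wt_bracket => /andP[wt_ wu].
by apply: QN => //; [apply: (IH 0%N) | apply: (IH 1%N)].
Qed.

Lemma wt_colours lc t : (forall g', output g' = c -> g' = g) -> wt lc c t ->
  all (fun l => lc l == c) (leaves t).
Proof.
move=> only; elim/wt_bracket_ind => // [l E|{}t u _ _ at_ au]; first by rewrite /= E eqxx.
by rewrite leaves2 all_cat at_.
Qed.

Variable J : elements (free_operad G k).
Hypotheses (HJ : is_ideal J) (only_g : forall g', output g' = c -> g' = g).
Hypothesis skew : forall lc t u, uniq (leaves t ++ leaves u) -> wt lc c t -> wt lc c u ->
  null J lc (leaves t ++ leaves u) c [:: (1, bracket t u); (1, bracket u t)].
Hypothesis jacobi : forall lc t u w, uniq (leaves t ++ leaves u ++ leaves w) ->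
  wt lc c t -> wt lc c u -> wt lc c w ->
  null J lc (leaves t ++ leaves u ++ leaves w) c
    [:: (1, bracket t (bracket u w)); (-1, bracket (bracket t u) w);
        (1, bracket (bracket t w) u)].

Section Span.
Variables (V : lmodType k) (S : V -> Prop) (lc : nat -> I).
Hypothesis HS : is_submodule S.

(** By Jacobi, [[q, [u, w]] = [[q, u], w] - [[q, w], u]]: bracketing a comb with a compound tree
    reduces to bracketing successively with its parts. The induction on [u] must keep [v] and [D]
    free, since the context deepens and the comb grows. *)
Lemma bracket_comb_span u : wt lc c u -> forall (v : tree G -> V) x D,
  uniq (D ++ leaves u) -> all (fun l => lc l == c) D -> x \in D ->
  sound J S v lc (D ++ leaves u) c ->
  (forall s, perm_eq (x :: s) (D ++ leaves u) -> S (v (comb x s))) ->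
  forall s, perm_eq (x :: s) D -> S (v (bracket (comb x s) u)).
Proof.
elim/wt_bracket_ind => // [l lcl|{}u w wu ww IHu IHw] v x D uD aD xD sv Sv s ps.
  rewrite -comb_rcons; apply: Sv; rewrite -cats1 -cat_cons; by rewrite perm_cat2r.
rewrite leaves2 in uD sv Sv.
have uDs : uniq (D ++ leaves u ++ leaves w) by [].
have wc : wt lc c (comb x s).
  by rewrite wt_comb; apply/allP => l; rewrite (perm_mem ps); apply: (allP aD).
have pD : perm_eq (leaves (comb x s) ++ leaves u ++ leaves w) (D ++ leaves u ++ leaves w).
  by rewrite leaves_comb perm_cat2r.
have uc : uniq (leaves (comb x s) ++ leaves u ++ leaves w) by rewrite (perm_uniq pD).
have := sv _ _ pD (jacobi uc wc wu ww).
rewrite /lincomb !big_cons big_nil /= !scale1r scaleN1r addr0 => Sj.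
set v1 := v _ in Sj *; set v2 := v _ in Sj; set v3 := v _ in Sj.
have -> : v1 = v1 + (- v2 + v3) + v2 - v3.
  by rewrite -!addrA [v2 - v3]addrC addNKr addNr addr0.
(* Symmetric in the two subtrees, so it serves both terms: [a] is absorbed into the comb inside the
   context of [b], and then [b] into the longer comb. *)
have key a b : wt lc c a -> wt lc c b -> perm_eq (leaves a ++ leaves b) (leaves u ++ leaves w) ->
    (forall (v : tree G -> V) x D,
      uniq (D ++ leaves a) -> all (fun l => lc l == c) D -> x \in D ->
      sound J S v lc (D ++ leaves a) c ->
      (forall s, perm_eq (x :: s) (D ++ leaves a) -> S (v (comb x s))) ->
      forall s, perm_eq (x :: s) D -> S (v (bracket (comb x s) a))) ->
    (forall (v : tree G -> V) x D,
      uniq (D ++ leaves b) -> all (fun l => lc l == c) D -> x \in D ->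
      sound J S v lc (D ++ leaves b) c ->
      (forall s, perm_eq (x :: s) (D ++ leaves b) -> S (v (comb x s))) ->
      forall s, perm_eq (x :: s) D -> S (v (bracket (comb x s) b))) ->
    S (v (bracket (bracket (comb x s) a) b)).
  move=> wa wb pab IHa IHb.
  have pDab : perm_eq ((D ++ leaves a) ++ leaves b) (D ++ leaves u ++ leaves w) by perms.
  have uDab : uniq ((D ++ leaves a) ++ leaves b) by rewrite (perm_uniq pDab).
  have uDa : uniq (D ++ leaves a) by move: uDab; rewrite cat_uniq => /andP[].
  apply: (IHa (fun y => v (bracket y b)) x D) => //.
    apply: (sound_l HJ inputs_g uDs pDab wb); by rewrite output_g.
  move=> s' ps'; apply: (IHb v x (D ++ leaves a)) => //.
  - by rewrite all_cat aD; apply: wt_colours.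
  - by rewrite mem_cat xD.
  - by apply: sound_perm sv; rewrite perm_sym.
  - by move=> s'' ps''; apply: Sv; apply: perm_trans ps'' _.
by apply: submodB => //; first apply: submodD => //; apply: key => //; perms.
Qed.

(** Any leaf [x] may head the combs: skew-symmetry moves the factor containing [x] to the left,
    induction turns it into combs headed by [x], and [bracket_comb_span] absorbs the other
    factor. *)
Lemma comb_span t : wt lc c t -> forall (v : tree G -> V) x,
  uniq (leaves t) -> x \in leaves t -> sound J S v lc (leaves t) c ->
  (forall s, perm_eq (x :: s) (leaves t) -> S (v (comb x s))) -> S (v t).
Proof.
elim/wt_bracket_ind => // [l lcl v x _|{}t u wt_ wu IHt IHu v x].
  by rewrite inE => /eqP <- _ Sv; apply: (Sv [::]).
rewrite leaves2 mem_cat => utu xtu sv Sv.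
have key a b : wt lc c a -> wt lc c b -> perm_eq (leaves a ++ leaves b) (leaves t ++ leaves u) ->
    x \in leaves a -> (forall (v : tree G -> V) x,
      uniq (leaves a) -> x \in leaves a -> sound J S v lc (leaves a) c ->
      (forall s, perm_eq (x :: s) (leaves a) -> S (v (comb x s))) -> S (v a)) ->
    S (v (bracket a b)).
  move=> wa wb pab xa IHa.
  have uab : uniq (leaves a ++ leaves b) by rewrite (perm_uniq pab).
  apply: (IHa (fun y => v (bracket y b)) x) => //.
  - by move: uab; rewrite cat_uniq => /andP[].
  - by apply: (sound_l HJ inputs_g utu pab wb); rewrite output_g.
  move=> s ps; apply: (bracket_comb_span wb uab _ xa) => //.
  - exact: wt_colours.
  - by apply: sound_perm sv; rewrite perm_sym.
  - by move=> s' ps'; apply: Sv; apply: perm_trans ps' _.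
case/orP: xtu => [xt|xu]; first exact: (key t u).
have := sv _ _ (perm_refl _) (skew utu wt_ wu).
rewrite /lincomb !big_cons big_nil /= !scale1r addr0 => Ss.
rewrite -[v _](addrK (v (bracket u t))); apply: submodB => //.
by apply: (key u t) => //; rewrite perm_catC.
Qed.

End Span.
End Combs.

Section RightCombs.
Variables (k : fieldType) (G : signature colour) (gi gm : G).
Hypotheses (inputs_i : inputs gi = [:: Cg]) (output_i : output gi = Ch).
Hypotheses (inputs_m : inputs gm = [:: Cg; Ch]) (output_m : output gm = Ch).
Implicit Types (t u : tree G) (lc : nat -> colour).

Definition app_i t : tree G := Node gi [:: t].
Definition app_m t u : tree G := Node gm [:: t; u].

(** The iterated action [m (s_r, ... m (s_1, b))] where [b] is the leaf [x], turned
    into an operation with output colour h by [i] if needed. *)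
Definition rcomb lc x s : tree G :=
  foldl (fun t l => app_m (Leaf l) t) (if lc x == Cg then app_i (Leaf x) else Leaf x) s.

Lemma rcomb_rcons lc x s l : rcomb lc x (rcons s l) = app_m (Leaf l) (rcomb lc x s).
Proof. by rewrite /rcomb -cats1 foldl_cat. Qed.

Lemma wt_i lc t : wt lc Ch (app_i t) = wt lc Cg t.
Proof. by rewrite /app_i (wt_node1 _ _ _ inputs_i) output_i eqxx. Qed.

Lemma wt_m lc t u : wt lc Ch (app_m t u) = wt lc Cg t && wt lc Ch u.
Proof. by rewrite /app_m (wt_node2 _ _ _ _ inputs_m) output_m eqxx. Qed.

Lemma leaves_rcomb lc x s : perm_eq (leaves (rcomb lc x s)) (x :: s).
Proof.
elim/last_ind: s => [|s l IH]; first by rewrite /rcomb /=; case: (lc x).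
by rewrite rcomb_rcons leaves2 /= -cats1; perms.
Qed.

Lemma wt_rcomb lc x s : wt lc Ch (rcomb lc x s) = all (fun l => lc l == Cg) s.
Proof.
elim/last_ind: s => [|s l IH].
  rewrite /rcomb /=; case: eqP => [E|]; first by rewrite wt_i wt_leaf E.
  by rewrite wt_leaf; case: (lc x).
by rewrite rcomb_rcons wt_m IH wt_leaf all_rcons.
Qed.

Lemma wt_h_ind lc (Q : tree G -> Prop) :
  (forall g, output g = Ch -> g = gi \/ g = gm) ->
  (forall l, lc l = Ch -> Q (Leaf l)) ->
  (forall t, wt lc Cg t -> Q (app_i t)) ->
  (forall t u, wt lc Cg t -> wt lc Ch u -> Q u -> Q (app_m t u)) ->
  forall t, wt lc Ch t -> Q t.
Proof.
move=> only QL Qi Qm; elim/tree_nth_ind=> [l|g ts IH wts].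
  by rewrite wt_leaf => /eqP; apply: QL.
have : output g = Ch by case/andP: wts => /eqP[].
case/only => Eg; subst g.
  have [t Et] := wt_node1_inv inputs_i wts; subst ts.
  by move: wts; rewrite -/(app_i t) wt_i => wt_; apply: Qi.
have [t [u Et]] := wt_node2_inv inputs_m wts; subst ts.
move: wts; rewrite -/(app_m t u) wt_m => /andP[wt_ wu].
by apply: Qm => //; apply: (IH 1%N).
Qed.

Variables (gb : G) (J : elements (free_operad G k)).
Hypotheses (inputs_b : inputs gb = [:: Cg; Cg]) (output_b : output gb = Cg).
Hypotheses (HJ : is_ideal J) (only_g : forall g', output g' = Cg -> g' = gb)
  (only_h : forall g, output g = Ch -> g = gi \/ g = gm).
Local Notation bracket := (bracket gb).
Hypothesis action : forall lc t u w, uniq (leaves t ++ leaves u ++ leaves w) ->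
  wt lc Cg t -> wt lc Cg u -> wt lc Ch w ->
  null J lc (leaves t ++ leaves u ++ leaves w) Ch
    [:: (1, app_m (bracket t u) w); (1, app_m t (app_m u w)); (-1, app_m u (app_m t w))].
Hypothesis cocycle : forall lc t u, uniq (leaves t ++ leaves u) ->
  wt lc Cg t -> wt lc Cg u ->
  null J lc (leaves t ++ leaves u) Ch
    [:: (1, app_i (bracket t u)); (1, app_m t (app_i u)); (-1, app_m u (app_i t))].

Section Span.
Variables (V : lmodType k) (S : V -> Prop) (lc : nat -> colour).
Hypothesis HS : is_submodule S.
Local Notation is_g := (fun l => lc l == Cg).

Let submod_rel (a b c : V) : S (a + (b + - c)) -> S b -> S c -> S a.
Proof.
move=> Sabc Sb Sc; rewrite -[a](addrK (b - c)); apply: submodB => //.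
exact: submodB.
Qed.

(** The action relation reads [m([t, u], r) = m(u, m(t, r)) - m(t, m(u, r))], so brackets in the
    acting element dissolve into successive actions. The inner action is normalised first, in the
    context of the outer one. *)
Lemma m_rcomb_span t : wt lc Cg t -> forall (v : tree G -> V) D,
  uniq (leaves t ++ D) -> sound J S v lc (leaves t ++ D) Ch ->
  (forall x s, perm_eq (x :: s) (leaves t ++ D) -> all is_g s -> S (v (rcomb lc x s))) ->
  forall x s, perm_eq (x :: s) D -> all is_g s -> S (v (app_m t (rcomb lc x s))).
Proof.
move=> wt_t; elim/(@wt_bracket_ind _ _ _ _ inputs_b output_b): t / wt_t => //.
  move=> l lcl v D uD sv Sv x s ps gs; rewrite -rcomb_rcons; apply: Sv.
    by rewrite -cats1; perms.
  by rewrite all_rcons lcl eqxx.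
move=> t u wt_ wu IHt IHu v D; rewrite leaves2 => uD sv Sv x s ps gs.
have wr : wt lc Ch (rcomb lc x s) by rewrite wt_rcomb.
have pr := leaves_rcomb lc x s.
have pD : perm_eq (leaves t ++ leaves u ++ leaves (rcomb lc x s)) ((leaves t ++ leaves u) ++ D).
  by perms.
have ur : uniq (leaves t ++ leaves u ++ leaves (rcomb lc x s)) by rewrite (perm_uniq pD).
have := sv _ _ pD (action ur wt_ wu wr).
rewrite /lincomb !big_cons big_nil /= !scale1r scaleN1r addr0 => /submod_rel.
have key a b : wt lc Cg a -> wt lc Cg b -> perm_eq (leaves a ++ leaves b) (leaves t ++ leaves u) ->
  (forall (v : tree G -> V) D,
    uniq (leaves a ++ D) -> sound J S v lc (leaves a ++ D) Ch ->
    (forall x s, perm_eq (x :: s) (leaves a ++ D) -> all is_g s -> S (v (rcomb lc x s))) ->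
    forall x s, perm_eq (x :: s) D -> all is_g s -> S (v (app_m a (rcomb lc x s)))) ->
  (forall (v : tree G -> V) D,
    uniq (leaves b ++ D) -> sound J S v lc (leaves b ++ D) Ch ->
    (forall x s, perm_eq (x :: s) (leaves b ++ D) -> all is_g s -> S (v (rcomb lc x s))) ->
    forall x s, perm_eq (x :: s) D -> all is_g s -> S (v (app_m b (rcomb lc x s)))) ->
  S (v (app_m a (app_m b (rcomb lc x s)))).
  move=> wa wb pab IHa IHb.
  have pabD : perm_eq (leaves a ++ leaves b ++ D) ((leaves t ++ leaves u) ++ D) by perms.
  have uabD : uniq (leaves a ++ leaves b ++ D) by rewrite (perm_uniq pabD).
  apply: (IHb (fun y => v (app_m a y)) D) => //.
  - by move: uabD; rewrite cat_uniq => /and3P[].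
  - by apply: (sound_r HJ inputs_m uD pabD wa); rewrite output_m.
  move=> y s' ps' gs'; apply: (IHa v (leaves b ++ D)) => //.
  - by apply: sound_perm sv; rewrite perm_sym.
  - by move=> z s'' ps''; apply: Sv; apply: perm_trans ps'' _.
by apply; apply: key => //; rewrite perm_catC.
Qed.

(** The cocycle relation reads [i([t, u]) = m(u, i(t)) - m(t, i(u))]: induction normalises the inner
    [i], and [m_rcomb_span] absorbs the acting factor. *)
Lemma i_span t : wt lc Cg t -> forall v : tree G -> V,
  uniq (leaves t) -> sound J S v lc (leaves t) Ch ->
  (forall x s, perm_eq (x :: s) (leaves t) -> all is_g s -> S (v (rcomb lc x s))) ->
  S (v (app_i t)).
Proof.
move=> wt_t; elim/(@wt_bracket_ind _ _ _ _ inputs_b output_b): t / wt_t => //.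
  move=> l lcl v _ _ Sv; have := Sv l [::] (perm_refl _) isT.
  by rewrite /rcomb /= lcl.
move=> t u wt_ wu IHt IHu v; rewrite leaves2 => uD sv Sv.
have := sv _ _ (perm_refl _) (cocycle uD wt_ wu).
rewrite /lincomb !big_cons big_nil /= !scale1r scaleN1r addr0 => /submod_rel.
have key a b : wt lc Cg a -> wt lc Cg b -> perm_eq (leaves a ++ leaves b) (leaves t ++ leaves u) ->
  (forall v : tree G -> V,
    uniq (leaves b) -> sound J S v lc (leaves b) Ch ->
    (forall x s, perm_eq (x :: s) (leaves b) -> all is_g s -> S (v (rcomb lc x s))) ->
    S (v (app_i b))) ->
  S (v (app_m a (app_i b))).
  move=> wa wb pab IHb.
  have uab : uniq (leaves a ++ leaves b) by rewrite (perm_uniq pab).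
  apply: (IHb (fun y => v (app_m a y))) => //.
  - by move: uab; rewrite cat_uniq => /and3P[].
  - by apply: (sound_r HJ inputs_m uD pab wa); rewrite output_m.
  apply: m_rcomb_span => //.
  - by apply: sound_perm sv; rewrite perm_sym.
  - by move=> z s'' ps''; apply: Sv; apply: perm_trans ps'' _.
by apply; apply: key => //; rewrite perm_catC.
Qed.

Lemma rcomb_span t : wt lc Ch t -> forall v : tree G -> V,
  uniq (leaves t) -> sound J S v lc (leaves t) Ch ->
  (forall x s, perm_eq (x :: s) (leaves t) -> all is_g s -> S (v (rcomb lc x s))) ->
  S (v t).
Proof.
elim/wt_h_ind => //.
- move=> l lcl v _ _ Sv; have := Sv l [::] (perm_refl _) isT.
  by rewrite /rcomb /= lcl.
- by move=> {}t wt_ v; rewrite leaves1; apply: i_span.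
move=> {}t u wt_ wu IHu v; rewrite leaves2 => uD sv Sv.
apply: (IHu (fun y => v (app_m t y))).
- by move: uD; rewrite cat_uniq => /and3P[].
- by apply: (sound_r HJ inputs_m uD (perm_refl _) wt_); rewrite output_m.
exact: m_rcomb_span.
Qed.

End Span.
End RightCombs.

(** * The relations *)

Section SignedWords.
Variables (k : fieldType) (A : word_algebra k).
Implicit Types X Y : seq (bool * seq nat).

(** Sums of signed words, on which evaluation becomes a computation. *)
Definition swsum X : A := \sum_(p <- X) (if p.1 then - word A p.2 else word A p.2).

Definition sopp X := [seq (~~ p.1, p.2) | p <- X].
Definition smul X Y := [seq (p.1 (+) q.1, p.2 ++ q.2) | p <- X, q <- Y].

Lemma swsum_cat X Y : swsum (X ++ Y) = swsum X + swsum Y.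
Proof. by rewrite /swsum big_cat. Qed.

Lemma swsum_opp X : swsum (sopp X) = - swsum X.
Proof.
by rewrite /swsum big_map -sumrN; apply: eq_bigr => -[[] w] _ /=; rewrite ?opprK.
Qed.

Lemma swsum_mul X Y : swsum (smul X Y) = wmul (swsum X) (swsum Y).
Proof.
rewrite /swsum big_allpairs_dep (lin_sum _ _ (wmul_linear_l (swsum Y))).
apply: eq_bigr => p _; rewrite (lin_sum _ _ (wmul_linear_r _)); apply: eq_bigr => q _.
have l y a := linN a (wmul_linear_l (k := k) (w0 := A) y).
have r x a := linN a (wmul_linear_r (k := k) (w0 := A) x).
by case: p q => [[] u] [[] v] /=; rewrite ?l ?r ?opprK wmul_word.
Qed.

(** Matching negative words with positive ones as multisets is a boolean condition, so each defining
    relation is verified by computation, with [isT] as proof. *)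
Lemma swsum_eq0 X :
  perm_eq [seq p.2 | p <- X & p.1] [seq p.2 | p <- X & ~~ p.1] -> swsum X = 0.
Proof.
move=> p; rewrite /swsum (bigID (fun p => p.1)) /=.
rewrite (eq_bigr (fun p => - word A p.2)) => [|q ->] //.
rewrite [X in _ + X](eq_bigr (fun p => word A p.2)) => [|q /negPf ->] //.
have E Q : \sum_(p <- X | Q p) word A p.2 = \sum_(w <- [seq p.2 | p <- X & Q p]) word A w.
  by rewrite big_map big_filter.
by rewrite sumrN (E (fun p => p.1)) (E (fun p => ~~ p.1)) (perm_big _ p) /= addNr.
Qed.

Definition sgen (c : aff_gen) (s : seq (seq (bool * seq nat))) :=
  match c with
  | Gi => nth [::] s 0
  | Gbeta => smul (nth [::] s 0) (nth [::] s 1) ++ sopp (smul (nth [::] s 1) (nth [::] s 0))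
  | Gm => smul (nth [::] s 1) (nth [::] s 0)
  end.

Variables (I : finType) (G : signature I) (kind : G -> aff_gen).

Fixpoint sev (t : tree G) :=
  match t with
  | Leaf l => [:: (false, [:: l])]
  | Node g ts => sgen (kind g) (map sev ts)
  end.

Lemma sevE t : ev kind (letter A) t = swsum (sev t).
Proof.
elim/tree_nth_ind: t => [l|g ts IH] /=; first by rewrite /swsum big_seq1.
have E i : (map (ev kind (letter A)) ts)`_i = swsum (nth [::] (map sev ts) i).
  case: (ltnP i (size ts)) => lti; last by rewrite !nth_default ?size_map // /swsum big_nil.
  by rewrite (nth_map (Leaf 0)) // (nth_map (Leaf 0)) //; apply: IH.
by case: (kind g); rewrite /= !E // ?swsum_cat ?swsum_opp ?swsum_mul.
Qed.

Section Represented.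
Variables (n : nat) (chi : {ffun 'I_n -> I}) (c : I).
Implicit Types x y : free_operad G k n chi c.

Lemma rl_mono_swsum t (Ht : monomial chi c t) : rl A kind (mono k Ht) = swsum (sev t).
Proof. by rewrite rl_mono sevE. Qed.

Lemma rl_add_swsum x y X Y : rl A kind x = swsum X -> rl A kind y = swsum Y ->
  rl A kind (x + y) = swsum (X ++ Y).
Proof. by move=> Ex Ey; rewrite (linD _ _ (@rl_linear _ _ _ _ _ _ _ _)) Ex Ey swsum_cat. Qed.

Lemma rl_sub_swsum x y X Y : rl A kind x = swsum X -> rl A kind y = swsum Y ->
  rl A kind (x - y) = swsum (X ++ sopp Y).
Proof.
by move=> Ex Ey; rewrite (linB _ _ (@rl_linear _ _ _ _ _ _ _ _)) Ex Ey swsum_cat swsum_opp.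
Qed.

Lemma rl_swsum_eq0 x X : rl A kind x = swsum X ->
  perm_eq [seq p.2 | p <- X & p.1] [seq p.2 | p <- X & ~~ p.1] -> rl A kind x = 0.
Proof. by move=> -> /swsum_eq0. Qed.

End Represented.

End SignedWords.

Section Relations.
Variables (k : fieldType) (A : word_algebra k).

Definition lie_kind (_ : lie_sig) := Gbeta.
Definition aff_kind (g : aff_sig) : aff_gen := g.
Definition mi_kind (g : mi_sig) : aff_gen := val g.

Lemma lie_relations_kernel :
  subfamily (ideal_generated (@lie_relations k)) (rl_kernel A lie_kind).
Proof.
move=> n chi c x; apply; first by apply: rl_kernel_ideal.
have M := rl_mono_swsum A lie_kind.
move=> m psi d y [{m psi d y}psi d H1 H2|{m psi d y}psi d H1 H2 H3].
- exact: rl_swsum_eq0 (rl_add_swsum (M _ _ _ _ H1) (M _ _ _ _ H2)) isT.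
- exact: rl_swsum_eq0 (rl_add_swsum (rl_add_swsum (M _ _ _ _ H1) (M _ _ _ _ H2)) (M _ _ _ _ H3)) isT.
Qed.

Lemma aff_relations_kernel :
  subfamily (ideal_generated (@aff_relations k)) (rl_kernel A aff_kind).
Proof.
move=> n chi c x; apply; first by apply: rl_kernel_ideal.
have M := rl_mono_swsum A aff_kind.
move=> m psi d y [{m psi d y}psi d H1 H2|{m psi d y}psi d H1 H2 H3|{m psi d y}psi d H1 H2 H3|{m psi d y}psi d H1 H2 H3].
- exact: rl_swsum_eq0 (rl_add_swsum (M _ _ _ _ H1) (M _ _ _ _ H2)) isT.
- exact: rl_swsum_eq0 (rl_sub_swsum (rl_sub_swsum (M _ _ _ _ H1) (M _ _ _ _ H2)) (M _ _ _ _ H3)) isT.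
- exact: rl_swsum_eq0 (rl_sub_swsum (rl_add_swsum (M _ _ _ _ H1) (M _ _ _ _ H2)) (M _ _ _ _ H3)) isT.
- exact: rl_swsum_eq0 (rl_sub_swsum (rl_add_swsum (M _ _ _ _ H1) (M _ _ _ _ H2)) (M _ _ _ _ H3)) isT.
Qed.

End Relations.

Section RelationInstances.
Variables (k : fieldType) (I : finType) (G : signature I).
Implicit Types (t u : tree G) (lc : nat -> I).

Lemma lmono_iota lc n (chi : {ffun 'I_n -> I}) c t :
  labelled lc (iota 0 n) chi -> lmono lc (iota 0 n) c t -> monomial chi c t.
Proof.
move=> hD lt_; have := lmono_monomial hD (iota_uniq 0 n) lt_.
rewrite (_ : relabel _ t = t) // -[RHS]subst_id; apply: subst_ext => l.
case/and3P: lt_ => _ _ /perm_mem ->; rewrite mem_iota /= => ltl; congr Leaf.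
by rewrite -[l in LHS](nth_iota 0%N 0%N ltl) index_uniq ?iota_uniq ?size_iota.
Qed.

Lemma lincomb2 (V : lmodType k) (v : tree G -> V) r1 r2 :
  lincomb v [:: (1, r1); (1, r2)] = v r1 + v r2.
Proof. by rewrite /lincomb !big_cons big_nil /= !scale1r addr0. Qed.

Lemma lincomb3 (V : lmodType k) (v : tree G -> V) r1 r2 r3 (b2 b3 : bool) :
  lincomb v [:: (1, r1); ((-1) ^+ b2, r2); ((-1) ^+ b3, r3)]
  = v r1 + (if b2 then - v r2 else v r2) + (if b3 then - v r3 else v r3).
Proof.
rewrite /lincomb !big_cons big_nil /= scale1r addr0 addrA.
by case: b2; case: b3; rewrite /= ?expr0 ?expr1 ?scale1r ?scaleN1r.
Qed.

Variable R : elements (free_operad G k).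
Local Notation J := (ideal_generated R).

Lemma null_instance2 lc (col : nat -> I) c (r1 r2 : tree G) us Ds :
  (forall (chi : {ffun 'I_(size us) -> I}) (H1 : monomial chi c r1) (H2 : monomial chi c r2),
     R (mono k H1 + mono k H2)) ->
  lmono col (iota 0 (size us)) c r1 -> lmono col (iota 0 (size us)) c r2 ->
  size Ds = size us -> uniq (flatten Ds) ->
  (forall i, (i < size us)%N -> lmono lc (nth [::] Ds i) (col i) (nth (Leaf 0) us i)) ->
  null J lc (flatten Ds) c
    [:: (1, tsubst (nth (Leaf 0) us) r1); (1, tsubst (nth (Leaf 0) us) r2)].
Proof.
move=> HR m1 m2 sD uD mus.
apply: (null_instance (F := [:: (1, r1); (1, r2)]) _ _ _ sD uD mus).
- exact: ideal_generated_is_ideal.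
- move=> n chi hD; have En : n = size us by case: (hD) => En _; rewrite En size_iota.
  subst n; rewrite lincomb2.
  have H1 := lmono_iota hD m1; have H2 := lmono_iota hD m2.
  by rewrite (tmE k H1) (tmE k H2) => K _; apply; apply: HR.
- by move=> p; rewrite !inE => /orP[]/eqP ->.
Qed.

(** Boolean signs let one statement cover every three-term relation of the two presentations. *)
Lemma null_instance3 (b2 b3 : bool) lc (col : nat -> I) c (r1 r2 r3 : tree G) us Ds :
  (forall (chi : {ffun 'I_(size us) -> I}) (H1 : monomial chi c r1) (H2 : monomial chi c r2)
      (H3 : monomial chi c r3),
     R (mono k H1 + (if b2 then - mono k H2 else mono k H2)
        + (if b3 then - mono k H3 else mono k H3))) ->
  [&& lmono col (iota 0 (size us)) c r1, lmono col (iota 0 (size us)) c r2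
    & lmono col (iota 0 (size us)) c r3] ->
  size Ds = size us -> uniq (flatten Ds) ->
  (forall i, (i < size us)%N -> lmono lc (nth [::] Ds i) (col i) (nth (Leaf 0) us i)) ->
  null J lc (flatten Ds) c
    [:: (1, tsubst (nth (Leaf 0) us) r1); ((-1) ^+ b2, tsubst (nth (Leaf 0) us) r2);
        ((-1) ^+ b3, tsubst (nth (Leaf 0) us) r3)].
Proof.
move=> HR /and3P[m1 m2 m3] sD uD mus.
apply: (null_instance (F := [:: (1, r1); ((-1) ^+ b2, r2); ((-1) ^+ b3, r3)]) _ _ _ sD uD mus).
- exact: ideal_generated_is_ideal.
- move=> n chi hD; have En : n = size us by case: (hD) => En _; rewrite En size_iota.
  subst n; rewrite lincomb3.
  have H1 := lmono_iota hD m1; have H2 := lmono_iota hD m2; have H3 := lmono_iota hD m3.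
  by rewrite (tmE k H1) (tmE k H2) (tmE k H3) => K _; apply; apply: HR.
- by move=> p; rewrite !inE => /or3P[]/eqP ->.
Qed.

End RelationInstances.

Lemma lmono_leaves (I : finType) (G : signature I) lc c (t : tree G) :
  wt lc c t -> lmono lc (leaves t) c t.
Proof. by rewrite lmonoE => ->; rewrite perm_refl. Qed.

Section AffRelations.
Variable k : fieldType.
Local Notation J := (ideal_generated (@aff_relations k)).
Implicit Types (t u : tree aff_sig) (lc : nat -> colour).

Lemma aff_skew lc t u : uniq (leaves t ++ leaves u) -> wt lc Cg t -> wt lc Cg u ->
  null J lc (leaves t ++ leaves u) Cg [:: (1, op_beta t u); (1, op_beta u t)].
Proof.
move=> uD wt_ wu.
have := @null_instance2 k _ _ _ lc (fun _ => Cg) Cg (op_beta (Leaf 0) (Leaf 1))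
  (op_beta (Leaf 1) (Leaf 0)) [:: t; u] [:: leaves t; leaves u]
  (fun chi H1 H2 => Aff_skew k H1 H2) isT isT erefl.
rewrite /flatten /= cats0; apply=> //.
by case=> [|[]] // _; apply: lmono_leaves.
Qed.

Lemma aff_jacobi lc t u w : uniq (leaves t ++ leaves u ++ leaves w) ->
  wt lc Cg t -> wt lc Cg u -> wt lc Cg w ->
  null J lc (leaves t ++ leaves u ++ leaves w) Cg
    [:: (1, op_beta t (op_beta u w)); (-1, op_beta (op_beta t u) w);
        (1, op_beta (op_beta t w) u)].
Proof.
move=> uD wt_ wu ww.
have := @null_instance3 k _ _ _ true true lc (fun _ => Cg) Cg
  (op_beta (op_beta (Leaf 0) (Leaf 1)) (Leaf 2)) (op_beta (op_beta (Leaf 0) (Leaf 2)) (Leaf 1))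
  (op_beta (Leaf 0) (op_beta (Leaf 1) (Leaf 2)))
  [:: t; u; w] [:: leaves t; leaves u; leaves w]
  (fun chi H1 H2 H3 => Aff_jacobi k H1 H2 H3) isT erefl.
rewrite /flatten /= cats0 => N; have {}N := N uD _.
(* In the defining relation [op_beta t (op_beta u w)] has coefficient -1, whereas the spanning
   argument solves for it with coefficient 1. *)
have {}N := null_opp (ideal_generated_is_ideal _) (N _).
apply: (null_ext (N _)).
- by case=> [|[|[]]] // _; apply: lmono_leaves.
- by move=> p; rewrite !inE => /or3P[]/eqP -> /=; rewrite lmonoE
    !(wt_node2 _ _ _ _ (erefl : @inputs _ aff_sig Gbeta = [:: Cg; Cg])) wt_ wu ww /=; perms.
move=> V v; rewrite /lincomb !big_cons !big_nil /= !opprK !scale1r !scaleN1r !addr0.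
by rewrite [LHS]addrC -addrA.
Qed.

Lemma aff_action lc t u w : uniq (leaves t ++ leaves u ++ leaves w) ->
  wt lc Cg t -> wt lc Cg u -> wt lc Ch w ->
  null J lc (leaves t ++ leaves u ++ leaves w) Ch
    [:: (1, op_m (op_beta t u) w); (1, op_m t (op_m u w)); (-1, op_m u (op_m t w))].
Proof.
move=> uD wt_ wu ww.
have := @null_instance3 k _ _ _ false true lc (fun i => if i == 2 then Ch else Cg) Ch
  (op_m (op_beta (Leaf 0) (Leaf 1)) (Leaf 2)) (op_m (Leaf 0) (op_m (Leaf 1) (Leaf 2)))
  (op_m (Leaf 1) (op_m (Leaf 0) (Leaf 2)))
  [:: t; u; w] [:: leaves t; leaves u; leaves w]
  (fun chi H1 H2 H3 => Aff_action k H1 H2 H3) isT erefl.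
rewrite /flatten /= cats0 expr0; apply=> //.
by case=> [|[|[]]] // _; apply: lmono_leaves.
Qed.

Lemma aff_cocycle lc t u : uniq (leaves t ++ leaves u) -> wt lc Cg t -> wt lc Cg u ->
  null J lc (leaves t ++ leaves u) Ch
    [:: (1, op_i (op_beta t u)); (1, op_m t (op_i u)); (-1, op_m u (op_i t))].
Proof.
move=> uD wt_ wu.
have := @null_instance3 k _ _ _ false true lc (fun _ => Cg) Ch
  (op_i (op_beta (Leaf 0) (Leaf 1))) (op_m (Leaf 0) (op_i (Leaf 1)))
  (op_m (Leaf 1) (op_i (Leaf 0)))
  [:: t; u] [:: leaves t; leaves u]
  (fun chi H1 H2 H3 => Aff_cocycle k H1 H2 H3) isT erefl.
rewrite /flatten /= cats0 expr0; apply=> //.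
by case=> [|[]] // _; apply: lmono_leaves.
Qed.

End AffRelations.

Section LieRelations.
Variable k : fieldType.
Local Notation J := (ideal_generated (@lie_relations k)).
Implicit Types (t u : tree lie_sig) (lc : nat -> unit).

Lemma lie_skew lc t u : uniq (leaves t ++ leaves u) -> wt lc tt t -> wt lc tt u ->
  null J lc (leaves t ++ leaves u) tt [:: (1, lie_bracket t u); (1, lie_bracket u t)].
Proof.
move=> uD wt_ wu.
have := @null_instance2 k _ _ _ lc (fun _ => tt) tt (lie_bracket (Leaf 0) (Leaf 1))
  (lie_bracket (Leaf 1) (Leaf 0)) [:: t; u] [:: leaves t; leaves u]
  (fun chi H1 H2 => Lie_skew k H1 H2) isT isT erefl.
rewrite /flatten /= cats0; apply=> //.
by case=> [|[]] // _; apply: lmono_leaves.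
Qed.

(* The cyclic Jacobi identity, corrected by two instances of skew-symmetry. *)
Lemma lie_jacobi lc t u w : uniq (leaves t ++ leaves u ++ leaves w) ->
  wt lc tt t -> wt lc tt u -> wt lc tt w ->
  null J lc (leaves t ++ leaves u ++ leaves w) tt
    [:: (1, lie_bracket t (lie_bracket u w)); (-1, lie_bracket (lie_bracket t u) w);
        (1, lie_bracket (lie_bracket t w) u)].
Proof.
move=> uD wt_ wu ww; have HJ := ideal_generated_is_ideal (@lie_relations k).
have wb a b : wt lc tt a -> wt lc tt b -> wt lc tt (lie_bracket a b).
  by move=> wa wb; rewrite (wt_node2 _ _ _ _ (erefl : @inputs _ lie_sig tt = [:: tt; tt])) wa.
have := @null_instance3 k _ _ _ false false lc (fun _ => tt) tt
  (lie_bracket (lie_bracket (Leaf 0) (Leaf 1)) (Leaf 2))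
  (lie_bracket (lie_bracket (Leaf 1) (Leaf 2)) (Leaf 0))
  (lie_bracket (lie_bracket (Leaf 2) (Leaf 0)) (Leaf 1))
  [:: t; u; w] [:: leaves t; leaves u; leaves w]
  (fun chi H1 H2 H3 => Lie_jacobi k H1 H2 H3) isT erefl.
rewrite /flatten /= cats0 expr0 => N; have {}N := N uD _.
have {N}N1 := null_opp HJ (N _).
have utw : uniq (leaves t ++ leaves w).
  by move: uD; rewrite !cat_uniq has_cat negb_or => /and3P[-> /andP[_ ->] /and3P[_ _ ->]].
have p2 : perm_eq (leaves t ++ leaves (lie_bracket u w)) (leaves t ++ leaves u ++ leaves w) by perms.
have u2 : uniq (leaves t ++ leaves (lie_bracket u w)) by rewrite (perm_uniq p2).
have N2 := null_perm HJ u2 p2 (lie_skew u2 wt_ (wb _ _ wu ww)).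
have N0 := lie_skew utw wt_ ww.
have p3 : perm_eq ([::] ++ (leaves t ++ leaves w) ++ leaves u) (leaves t ++ leaves u ++ leaves w).
  by perms.
have u3 : uniq ([::] ++ (leaves t ++ leaves w) ++ leaves u) by rewrite (perm_uniq p3).
have N3 := @null_node _ _ _ _ HJ lc (tt : lie_sig) [::] [:: u] tt [::] _ (leaves u) _ N0 u3 _ _ _ _.
have {}N3 := null_perm HJ u3 p3 (N3 _ _ _ _).
apply: (null_ext (null_cat HJ (N1 _) (null_cat HJ N2 (N3 _ _ _ _)))).
- by case=> [|[|[]]] // _; apply: lmono_leaves.
- by case/andP: wu => /eqP /= ->.
- by case/andP: wu => /= _ ->.
- by [].
- by rewrite /= cats0.
- by move=> p; rewrite !inE => /or3P[]/eqP -> /=; rewrite lmonoE !wb //=; perms.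
move=> V v; rewrite /lincomb !big_cat !big_cons !big_nil /= !scale1r !scaleN1r !addr0.
set a := v _; set b := v _; set c := v _.
set d := v (lie_bracket (lie_bracket u w) t); set e := v (lie_bracket (lie_bracket w t) u).
rewrite -[RHS]/(- b + (- d - e) + (a + d + (c + e))).
by rewrite [a + d + _]addrACA -opprD [RHS]addrACA addNr addr0 addrCA.
Qed.

End LieRelations.

(** * Realizations by words *)

Section Realizations.
Variables (k : fieldType) (A : word_algebra k) (I : finType).

Definition realization (C : collection k I) : Type :=
  forall n (chi : {ffun 'I_n -> I}) c, C n chi c -> A.

(** A faithful model in one algebra shared by all arities and colours; an identity in [C] may be
    checked on values. *)
Definition coll_realization (C : collection k I) (r : realization C) : Prop :=
  [/\ forall n chi c, linear (r n chi c), forall n chi c, injective (r n chi c)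
    & forall n chi s chi' c (H : permutes chi s chi') (x : C n chi c),
        r _ _ _ (sact C H x) = wact s (r _ _ _ x)].

Definition operad_realization (P : operad k I) (r : realization P) : Prop :=
  [/\ coll_realization r,
      forall (chi : {ffun 'I_1 -> I}) c (e : chi ord0 = c), r _ _ _ (ident P e) = letter A 0
    & forall n m r' chi j d psi theta c (H : @grafts I n m r' chi j d psi theta)
        (x : P n chi c) (y : P m psi d),
      r _ _ _ (pcomp P H x y) = wcomp j m (r _ _ _ x) (r _ _ _ y)].

(** The image of [x] is any element with the same value. Injectivity of [rQ] makes it unique, and
    then linear and equivariant because the values are. *)
Lemma coll_transfer (P Q : collection k I) (rP : realization P) (rQ : realization Q) :
  coll_realization rP -> coll_realization rQ ->
  (forall n chi c (x : P n chi c), exists y, rQ n chi c y = rP n chi c x) ->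
  exists f : coll_map P Q, [/\ is_coll_morphism f,
    forall n chi c x, rQ n chi c (f n chi c x) = rP n chi c x
    & forall n chi c, injective (f n chi c)].
Proof.
case=> lP iP aP [lQ iQ aQ] sub.
pose f n chi c (x : P n chi c) : Q n chi c := sval (cid (sub n chi c x)).
have fE n chi c x : rQ n chi c (f n chi c x) = rP n chi c x by rewrite /f; case: cid.
exists f; split=> //; last first.
  by move=> n chi c x y E; apply: (iP n chi c); rewrite -!fE E.
split=> [n chi c a x y|n chi s chi' c H x].
  by apply: (iQ n chi c); rewrite fE lP lQ !fE.
by apply: (iQ n chi' c); rewrite fE aP aQ fE.
Qed.

Lemma operad_transfer (P Q : operad k I) (rP : realization P) (rQ : realization Q) :
  operad_realization rP -> operad_realization rQ ->
  (forall n chi c (x : P n chi c), exists y, rQ n chi c y = rP n chi c x) ->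
  exists f : coll_map P Q, [/\ is_operad_morphism f,
    forall n chi c x, rQ n chi c (f n chi c x) = rP n chi c x
    & forall n chi c, injective (f n chi c)].
Proof.
case=> cP eP mP [cQ eQ mQ] sub; have [f [mf fE jf]] := coll_transfer cP cQ sub.
have [_ iQ _] := cQ; exists f; split=> //; split=> // [chi c e|n m r chi j d psi theta c H x y].
  by apply: (iQ 1%N chi c); rewrite fE eP eQ.
by apply: (iQ r theta c); rewrite fE mP mQ !fE.
Qed.

Lemma transfer_bijective (P Q : collection k I) (rP : realization P) (rQ : realization Q)
    (f : coll_map P Q) : coll_realization rQ ->
  (forall n chi c x, rQ n chi c (f n chi c x) = rP n chi c x) ->
  (forall n chi c, injective (f n chi c)) ->
  (forall n chi c (y : Q n chi c), exists x, rP n chi c x = rQ n chi c y) ->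
  forall n chi c, bijective (f n chi c).
Proof.
case=> _ iQ _ fE jf sub n chi c.
have fK y : f n chi c (sval (cid (sub n chi c y))) = y.
  by apply: (iQ n chi c); rewrite fE; case: cid.
by exists (fun y => sval (cid (sub n chi c y))) => // x; apply: (jf n chi c).
Qed.

Variables (G : signature I) (kind : G -> aff_gen).
Hypothesis arity_kind : forall g, size (inputs g) = size (aff_inputs (kind g)).

Lemma free_realization : (forall n chi c, injective (@rl k A I G kind n chi c)) ->
  operad_realization (P := free_operad G k) (@rl k A I G kind).
Proof.
move=> inj; split=> [|chi c e|n m r chi j d psi theta c H x y].
- split=> // [n chi c|n chi s chi' c H x]; [exact: rl_linear | exact: rl_act].
- exact: rl_ident.
- exact: rl_comp.
Qed.

Variable R : elements (free_operad G k).
Hypothesis kerR : subfamily (ideal_generated R) (rl_kernel A kind).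
Local Notation P := (presented_operad R).

(** The value of a chosen representative; as the ideal lies in the kernel, [qrl_proj] shows that the
    choice is immaterial. *)
Definition qrl n (chi : {ffun 'I_n -> I}) c (q : P n chi c) : A := rl A kind (qlift q).

Lemma qrl_proj n (chi : {ffun 'I_n -> I}) c (x : free_operad G k n chi c) :
  qrl (proj (ideal_generated_is_ideal R) x) = rl A kind x.
Proof.
apply/eqP; rewrite -subr_eq0 /qrl -(linB _ _ (@rl_linear _ _ _ _ _ _ _ _)); apply/eqP/kerR.
by apply/(projE (ideal_generated_is_ideal R)); apply: liftK.
Qed.

Lemma qrl_linear n (chi : {ffun 'I_n -> I}) c : linear (@qrl n chi c).
Proof.
move=> a p q; have [x <-] := proj_surj p; have [y <-] := proj_surj q.
by rewrite -proj_linear !qrl_proj rl_linear.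
Qed.

Lemma presented_realization : (forall n chi c, injective (@qrl n chi c)) ->
  operad_realization (P := P) qrl.
Proof.
move=> inj; split=> [|chi c e|n m r chi j d psi theta c H p q].
- split=> // [n chi c|n chi s chi' c H q]; first exact: qrl_linear.
  have [x <-] := proj_surj q.
  rewrite (_ : sact P H _ = proj (ideal_generated_is_ideal R) (sact _ H x)); last exact: qactE.
  by rewrite !qrl_proj rl_act.
- by rewrite [LHS]qrl_proj rl_ident.
- have [x <-] := proj_surj p; have [y <-] := proj_surj q.
  rewrite (_ : pcomp P H _ _ = proj (ideal_generated_is_ideal R) (pcomp _ H x y)); last first.
    exact: qcompE.
  by rewrite !qrl_proj rl_comp.
Qed.

End Realizations.

(** * Bases detected by coefficients of words *)

Section WordBasis.
Variables (k : fieldType) (A : word_algebra k).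

(** Basis elements are indexed by the words that detect them. The matrix of coefficients is required
    to be the identity, not just triangular, so these coefficients are the dual basis. *)
Definition word_basis (V : lmodType k) (r : V -> A) (s : seq (seq nat)) (v : seq nat -> V) :=
  [/\ linear r, uniq s, spans s v
    & forall i j, i \in s -> j \in s -> coef i (r (v j)) = (i == j)%:R].

Variables (V : lmodType k) (r : V -> A) (s : seq (seq nat)) (v : seq nat -> V).
Hypothesis basis_v : word_basis r s v.

Let phi_linear i : linear (fun x => coef i (r x) : k^o).
Proof. by case: basis_v => lr _ _ _ a x y; rewrite lr coef_linear. Qed.

Lemma word_basis_inj : injective r.
Proof.
case: basis_v => lr us sv dv x y E.
rewrite (dual_expansion us phi_linear dv sv x) (dual_expansion us phi_linear dv sv y).
by apply: eq_bigr => i _; rewrite E.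
Qed.

Lemma word_basis_dim : has_dim V (size s).
Proof. by case: basis_v => lr us sv dv; apply: dual_has_dim us phi_linear dv sv. Qed.

Lemma word_basis_image (W : lmodType k) (r' : W -> A) : linear r' ->
  (forall i, i \in s -> exists y, r' y = r (v i)) -> forall x, exists y, r' y = r x.
Proof.
case: basis_v => lr _ sv _ lr' E x; apply: (sv (fun x => exists y, r' y = r x)) => //.
split=> [|a y z [y' Ey] [z' Ez]]; first by exists 0; rewrite !lin0.
by exists (a *: y' + z'); rewrite lr lr' Ey Ez.
Qed.

End WordBasis.

Section Family.
Variables (k : fieldType) (I : finType) (G : signature I).
Variables (n : nat) (chi : {ffun 'I_n -> I}) (c : I).
Local Notation P := (free_operad G k).

(** A total version of [leaf_colour chi]; the default [c] concerns only labels that are not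
    inputs. *)
Definition input_label (l : nat) : I := odflt c (leaf_colour chi l).

Lemma input_labelP : labelled input_label (iota 0 n) chi.
Proof.
split=> [|i]; first by rewrite size_iota.
by rewrite nth_iota // /input_label leaf_colourE.
Qed.

Lemma monomial_wt (t : tree G) : monomial chi c t ->
  wt input_label c t /\ perm_eq (leaves t) (iota 0 n).
Proof.
move=> mt; have ltn_ l := leaves_lt mt (l := l); case/and3P: (mt) => /eqP oc wt_ pt.
split=> //; have E : {in leaves t, forall l,
    out_colour (Some \o input_label) (Leaf l : tree G) = leaf_colour chi l}.
  by move=> l /ltn_ ltl; rewrite /= /input_label (leaf_colour_lt _ ltl).
rewrite -[t]subst_id; apply/andP; split; first by rewrite (out_colour_subst E) oc.
exact: well_coloured_subst E _ wt_.
Qed.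

Lemma free_ind (S : P n chi c -> Prop) : is_submodule S ->
  (forall t (Ht : monomial chi c t), S (mono k Ht)) -> forall x, S x.
Proof.
move=> HS Sm x; pose f (s : tree_monomial G chi c) : P n chi c := mono k (valP s).
have -> : x = mextend f x.
  apply: (eq_linear_malg (f := fun x : {malg k[tree_monomial G chi c]} => x)) => //.
    exact: mextend_linear.
  by move=> [t Ht]; rewrite (mextendU f); apply: mono_eq.
by apply: submod_sum => // s; apply: submodZ => //; apply: Sm.
Qed.

Variables (V : lmodType k) (pi : P n chi c -> V).
Hypotheses (pi_linear : linear pi) (pi_surj : forall q, exists x, pi x = q).

(** The map [pi] will be a quotient projection or the identity, so presented operads and the free
    one are treated alike. *)
Definition input_tree (t : tree G) : V := pi (nt k chi c (iota 0 n) t).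

Lemma nt_input (t : tree G) (Ht : monomial chi c t) : nt k chi c (iota 0 n) t = mono k Ht.
Proof.
have [wt_ pt] := monomial_wt Ht; have mt : lmono input_label (iota 0 n) c t by rewrite lmonoE wt_.
rewrite /nt (tmE k (lmono_monomial input_labelP (iota_uniq 0 n) mt)); apply: mono_eq.
rewrite -[RHS]subst_id; apply: subst_ext => l.
rewrite (perm_mem pt) mem_iota /= => ltl; congr Leaf.
by rewrite -[l in LHS](nth_iota 0%N 0%N ltl) index_uniq ?iota_uniq ?size_iota.
Qed.

Lemma input_tree_ind (S : V -> Prop) : is_submodule S ->
  (forall t, wt input_label c t -> perm_eq (leaves t) (iota 0 n) -> S (input_tree t)) ->
  forall q, S q.
Proof.
move=> HS St q; have [x <-] := pi_surj q.
move: x; apply: (free_ind (S := fun x => S (pi x))); first exact: submod_preim.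
by move=> t Ht; have [wt_ pt] := monomial_wt Ht; rewrite -nt_input; apply: St.
Qed.

(** Relations die under [pi] once [null_perm] has put their labels in standard order. This is
    soundness at the root, from which the spanning inductions start. *)
Lemma input_tree_sound (J : elements P) (S : V -> Prop) D : is_ideal J ->
  (forall x : P n chi c, J n chi c x -> pi x = 0) -> is_submodule S ->
  perm_eq D (iota 0 n) -> sound J S input_tree input_label D c.
Proof.
move=> HJ Jpi HS pD D' F pD' nF.
have pD'' : perm_eq D' (iota 0 n) by apply: perm_trans pD' pD.
have uD' : uniq D' by rewrite (perm_uniq pD'') iota_uniq.
have [_ JF] := null_perm HJ uD' pD'' nF.
rewrite /input_tree -(linear_lincomb (nt k chi c (iota 0 n))) // (Jpi _ (JF _ _ input_labelP)).
exact: submod0.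
Qed.

Variables (A : word_algebra k) (kind : G -> aff_gen) (r : V -> A).
Hypothesis r_pi : forall x, r (pi x) = rl A kind x.

Lemma r_input_tree (t : tree G) : wt input_label c t -> perm_eq (leaves t) (iota 0 n) ->
  r (input_tree t) = ev kind (letter A) t.
Proof.
move=> wt_ pt; have mt : lmono input_label (iota 0 n) c t by rewrite lmonoE wt_.
by rewrite /input_tree (nt_input (lmono_iota input_labelP mt)) r_pi rl_mono.
Qed.

End Family.

(** * Leading words of left-normed commutators *)

Section CombValues.
Variables (k : fieldType) (A : word_algebra k).

Definition comb_value x s : A :=
  foldl (fun y l => wmul y (letter A l) - wmul (letter A l) y) (letter A x) s.

Lemma ev_comb (I : finType) (G : signature I) (kind : G -> aff_gen) g x s : kind g = Gbeta ->
  ev kind (letter A) (comb g x s) = comb_value x s.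
Proof.
move=> kg; elim/last_ind: s => // s l IH.
by rewrite comb_rcons /= kg /= IH /comb_value -cats1 foldl_cat.
Qed.

(* Modulo words that do not start with [x], bracketing with letters other than [x]
   is concatenation, so that combs starting with [x] have distinct leading words. *)
Definition avoids x (y : A) : Prop := forall S : A -> Prop, is_submodule S ->
  (forall l w, l != x -> S (word A (l :: w))) -> S y.

Lemma comb_value_lead x s : x \notin s ->
  exists2 y, comb_value x s = word A (x :: s) + y & avoids x y.
Proof.
elim/last_ind: s => [_|s l IH]; first by exists 0; rewrite ?addr0 // => S HS _; apply: submod0.
rewrite mem_rcons inE negb_or => /andP[xl /IH[y Ey ay]].
(* Words of the first product inherit their first letter from [y]; those of the subtracted one start
   with [l], which differs from [x]. *)
exists (wmul y (letter A l) - wmul (letter A l) (word A (x :: s) + y)).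
  rewrite /comb_value -cats1 foldl_cat /= -/(comb_value x s) Ey.
  by rewrite (linD _ _ (wmul_linear_l _)) wmul_word addrA.
move=> S HS Sw; apply: submodB => //.
  apply: (ay (fun y => S (wmul y (letter A l)))) => [|l' w l'x].
    exact: submod_preim (wmul_linear_l _).
  by rewrite wmul_word; apply: Sw.
rewrite (linD _ _ (wmul_linear_r _)) wmul_word; apply: submodD => //.
  by apply: Sw; rewrite eq_sym.
apply: (ay (fun y => S (wmul (letter A l) y))) => [|l' w l'x].
  exact: submod_preim (wmul_linear_r _).
by rewrite wmul_word; apply: Sw; rewrite eq_sym.
Qed.

Lemma coefD w (x y : A) : coef w (x + y) = coef w x + coef w y.
Proof. exact: (linD x y (coef_linear w)). Qed.

Lemma coef_kernel w : is_submodule (fun y : A => coef w y = 0).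
Proof.
split=> [|a x y Ex Ey]; first exact (lin0 (W := k^o) (coef_linear w)).
by rewrite (coef_linear w a x y) Ex Ey scaler0 addr0.
Qed.

Lemma coef_comb_value x s w : x \notin s ->
  coef (x :: w) (comb_value x s) = (w == s)%:R.
Proof.
move=> /comb_value_lead[y -> ay]; rewrite coefD coef_word.
rewrite (ay _ (coef_kernel (x :: w))) ?addr0 ?eqseq_cons ?eqxx // => l u lx.
by rewrite coef_word eqseq_cons eq_sym (negPf lx).
Qed.

End CombValues.

Section CombBasis.
Variables (k : fieldType) (A : word_algebra k).
Variables (I : finType) (G : signature I) (kind : G -> aff_gen) (g : G) (c : I).
Hypotheses (inputs_g : inputs g = [:: c; c]) (output_g : output g = c)
  (only_g : forall g', output g' = c -> g' = g) (kind_g : kind g = Gbeta).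
Variable J : elements (free_operad G k).
Hypothesis HJ : is_ideal J.
Hypothesis skew : forall lc t u, uniq (leaves t ++ leaves u) -> wt lc c t -> wt lc c u ->
  null J lc (leaves t ++ leaves u) c [:: (1, bracket g t u); (1, bracket g u t)].
Hypothesis jacobi : forall lc t u w, uniq (leaves t ++ leaves u ++ leaves w) ->
  wt lc c t -> wt lc c u -> wt lc c w ->
  null J lc (leaves t ++ leaves u ++ leaves w) c
    [:: (1, bracket g t (bracket g u w)); (-1, bracket g (bracket g t u) w);
        (1, bracket g (bracket g t w) u)].

(** These index the classical basis of Lie(n), with (n-1)! elements: the first input stays in front
    and the others are permuted. Arity 0 gets no words, as its space vanishes. *)
Definition comb_words n : seq (seq nat) :=
  if n is n'.+1 then map (cons 0%N) (permutations (iota 1 n')) else [::].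

Variables (n : nat) (chi : {ffun 'I_n -> I}).
Variables (V : lmodType k) (pi : free_operad G k n chi c -> V) (r : V -> A).
Hypotheses (pi_linear : linear pi) (pi_surj : forall q, exists x, pi x = q)
  (pi_J : forall x : free_operad G k n chi c, J x -> pi x = 0)
  (r_linear : linear r) (r_pi : forall x, r (pi x) = rl A kind x).

Definition comb_element w : V := input_tree pi (comb g (head 0%N w) (behead w)).

Definition monochrome : bool := [forall i, chi i == c].

(** With an input of another colour there is no tree of output colour [c] at all, so the basis must
    be empty. *)
Definition monochrome_words : seq (seq nat) := if monochrome then comb_words n else [::].

Lemma mem_comb_words w : w \in comb_words n ->
  exists2 s, w = 0%N :: s & perm_eq (0%N :: s) (iota 0 n).
Proof.
rewrite /comb_words; case: (n) => // n' /mapP[s]; rewrite mem_permutations => ps ->.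
by exists s => //; rewrite /= perm_cons.
Qed.

Lemma r_comb_element w : monochrome -> w \in comb_words n ->
  r (comb_element w) = comb_value A 0 (behead w).
Proof.
move=> mono_chi /mem_comb_words[s -> ps]; rewrite /comb_element /= (r_input_tree r_pi).
- exact: ev_comb.
- rewrite (wt_comb inputs_g output_g); apply/allP => l; rewrite (perm_mem ps) mem_iota /= => ltl.
  by rewrite /input_label (leaf_colour_lt _ ltl) /=; apply: (forallP mono_chi).
- by rewrite leaves_comb.
Qed.

Lemma comb_basis : word_basis r monochrome_words comb_element.
Proof.
split=> //; rewrite /monochrome_words.
- case: ifP => // _; rewrite /comb_words; case: (n) => // n'.
  by rewrite map_inj_uniq ?permutations_uniq // => s s' [].
- move=> S HS Sv; apply: (input_tree_ind pi_linear pi_surj HS) => t wt_ pt.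
  have ut : uniq (leaves t) by rewrite (perm_uniq pt) iota_uniq.
  have gt := wt_colours inputs_g output_g only_g wt_.
  have mono_chi : monochrome.
    apply/forallP => i; have := allP gt i; rewrite (perm_mem pt) mem_iota /= ltn_ord.
    by rewrite /input_label leaf_colourE; apply.
  (* A tree has at least one leaf, so the label 0 that is to head the combs does occur. *)
  have n0 : (0 < n)%N.
    by case/andP: wt_ => _ /leaves_neq0; rewrite -size_eq0 (perm_size pt) size_iota lt0n.
  apply: (comb_span inputs_g output_g HJ only_g skew jacobi HS wt_ (v := input_tree pi) (x := 0%N)) => //.
  + by rewrite (perm_mem pt) mem_iota.
  + exact (input_tree_sound pi_linear HJ pi_J HS pt).
  move=> s ps; apply: (Sv (0%N :: s)); rewrite mono_chi /comb_words.
  have := perm_trans ps pt; case: (n) n0 => // n' _; rewrite /= perm_cons => ps'.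
  by rewrite map_f // mem_permutations.
- case: ifP => // mono_chi i j iw jw; rewrite r_comb_element //.
  case/mem_comb_words: iw => s -> _; case/mem_comb_words: jw => s' -> ps'.
  rewrite coef_comb_value ?eqseq_cons ?eqxx //=.
  by have := iota_uniq 0 n; rewrite -(perm_uniq ps') => /andP[].
Qed.

End CombBasis.

Section RightCombBasis.
Variables (k : fieldType) (A : word_algebra k).
Variables (G : signature colour) (kind : G -> aff_gen) (gi gm : G).
Hypotheses (inputs_i : inputs gi = [:: Cg]) (output_i : output gi = Ch).
Hypotheses (inputs_m : inputs gm = [:: Cg; Ch]) (output_m : output gm = Ch).
Hypotheses (kind_i : kind gi = Gi) (kind_m : kind gm = Gm).

(** Acting by [l] appends the letter [l], and [i] leaves no trace, so the value is one word whatever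
    the colour of [x]. *)
Lemma ev_rcomb lc x s : ev kind (letter A) (rcomb gi gm lc x s) = word A (x :: s).
Proof.
elim/last_ind: s => [|s l IH].
  by rewrite /rcomb /=; case: (lc x); rewrite /= ?kind_i.
by rewrite rcomb_rcons /= kind_m /= IH wmul_word cats1.
Qed.

Variables (n : nat) (chi : {ffun 'I_n -> colour}).
Variables (V : lmodType k) (pi : free_operad G k n chi Ch -> V) (r : V -> A).
Local Notation lc := (input_label chi Ch).
Local Notation is_g := (fun l => lc l == Cg).
Hypotheses (pi_linear : linear pi) (pi_surj : forall q, exists x, pi x = q)
  (r_linear : linear r) (r_pi : forall x, r (pi x) = rl A kind x).
(** The only point where the two applications differ: AffHS needs its relations here, while in the
    free operad every tree with output h already has this shape. *)
Hypothesis rcomb_spanning : forall S : V -> Prop, is_submodule S ->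
  (forall x s, perm_eq (x :: s) (iota 0 n) -> all is_g s ->
     S (input_tree pi (rcomb gi gm lc x s))) ->
  forall t, wt lc Ch t -> perm_eq (leaves t) (iota 0 n) -> S (input_tree pi t).

Definition rcomb_element w : V := input_tree pi (rcomb gi gm lc (head 0%N w) (behead w)).

(** Only the first letter may have colour h: it is the element acted upon, the later letters act.
    The empty word is excluded because it would arise in arity 0. *)
Definition rcomb_words : seq (seq nat) :=
  [seq w <- permutations (iota 0 n) | (w != [::]) && all is_g (behead w)].

Lemma r_rcomb_element w : w \in rcomb_words -> r (rcomb_element w) = word A w.
Proof.
rewrite mem_filter mem_permutations => /andP[/andP[]].
case: w => // x s _ gs pw; rewrite /rcomb_element /= (r_input_tree r_pi) ?ev_rcomb //.
  by rewrite (wt_rcomb inputs_i output_i inputs_m output_m).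
by apply: perm_trans (leaves_rcomb _ _ _ _ _) pw.
Qed.

Lemma rcomb_basis : word_basis r rcomb_words rcomb_element.
Proof.
split=> //.
- by rewrite filter_uniq // permutations_uniq.
- move=> S HS Sv; apply: (input_tree_ind pi_linear pi_surj HS) => t wt_ pt.
  apply: rcomb_spanning wt_ pt => // x s ps gs.
  by apply: (Sv (x :: s)); rewrite mem_filter /= gs mem_permutations.
- by move=> i j iw jw; rewrite r_rcomb_element // coef_word.
Qed.

End RightCombBasis.

(** * Bases of AffHS, Lie and the free operad *)

Section AffBasis.
Variables (k : fieldType) (A : word_algebra k).

Definition aff_ideal := ideal_generated_is_ideal (@aff_relations k).

Definition aff_rl : realization A (AffHS k) := @qrl k A colour aff_sig aff_kind (@aff_relations k).

Lemma aff_rl_proj n (chi : {ffun 'I_n -> colour}) c (x : free_operad aff_sig k n chi c) :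
  aff_rl (proj aff_ideal x) = rl A aff_kind x.
Proof. exact (qrl_proj (@aff_relations_kernel k A) x). Qed.

Lemma aff_rl_linear n (chi : {ffun 'I_n -> colour}) c : linear (@aff_rl n chi c).
Proof. exact (qrl_linear (@aff_relations_kernel k A) (c := c)). Qed.

Lemma aff_proj_ideal n (chi : {ffun 'I_n -> colour}) c (x : free_operad aff_sig k n chi c) :
  ideal_generated (@aff_relations k) x -> proj aff_ideal x = 0.
Proof.
move=> Jx; rewrite -(lin0 (@proj_linear _ _ _ _ aff_ideal n chi c)).
by apply/projE; rewrite subr0.
Qed.

Lemma aff_output_g (g : aff_sig) : output g = Cg -> g = Gbeta.
Proof. by case: g. Qed.

Lemma aff_output_h (g : aff_sig) : output g = Ch -> g = Gi \/ g = Gm.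
Proof. by case: g => //; [left | right]. Qed.

Section Components.
Variables (n : nat) (chi : {ffun 'I_n -> colour}).

Lemma aff_g_basis : word_basis (@aff_rl n chi Cg) (monochrome_words Cg chi)
  (comb_element (G := aff_sig) Gbeta (@proj _ _ _ _ aff_ideal n chi Cg)).
Proof.
exact: (comb_basis (g := (Gbeta : aff_sig)) erefl erefl aff_output_g erefl aff_ideal
  (@aff_skew k) (@aff_jacobi k) (@proj_linear _ _ _ _ aff_ideal n chi Cg)
  (@proj_surj _ _ _ _ aff_ideal n chi Cg) (@aff_proj_ideal n chi Cg)
  (@aff_rl_linear n chi Cg) (@aff_rl_proj n chi Cg)).
Qed.

Lemma aff_h_basis : word_basis (@aff_rl n chi Ch) (rcomb_words chi)
  (rcomb_element (G := aff_sig) Gi Gm (@proj _ _ _ _ aff_ideal n chi Ch)).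
Proof.
apply: (@rcomb_basis k A aff_sig aff_kind Gi Gm erefl erefl erefl erefl erefl erefl n chi _ _ _
  (@proj_linear _ _ _ _ aff_ideal n chi Ch) (@proj_surj _ _ _ _ aff_ideal n chi Ch)
  (@aff_rl_linear n chi Ch) (@aff_rl_proj n chi Ch)).
move=> S HS Sr t wt_ pt.
have ut : uniq (leaves t) by rewrite (perm_uniq pt) iota_uniq.
apply: (@rcomb_span k aff_sig Gi Gm erefl erefl erefl erefl Gbeta _ erefl erefl aff_ideal
  aff_output_g aff_output_h (@aff_action k) (@aff_cocycle k) _ S _ HS t wt_
  (input_tree (@proj _ _ _ _ aff_ideal n chi Ch)) ut).
  exact (input_tree_sound (@proj_linear _ _ _ _ aff_ideal n chi Ch) aff_ideal
    (@aff_proj_ideal n chi Ch) HS pt).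
by move=> x s ps; apply: Sr; apply: perm_trans ps pt.
Qed.

End Components.

Lemma aff_rl_inj n (chi : {ffun 'I_n -> colour}) c : injective (@aff_rl n chi c).
Proof. case: c; [exact: word_basis_inj (aff_g_basis chi) | exact: word_basis_inj (aff_h_basis chi)]. Qed.

Lemma aff_realization : operad_realization aff_rl.
Proof.
apply: (@presented_realization k A colour aff_sig aff_kind) => //; last exact: aff_rl_inj.
exact (@aff_relations_kernel k A).
Qed.

End AffBasis.

Section LieBasis.
Variables (k : fieldType) (A : word_algebra k).

Definition lie_ideal := ideal_generated_is_ideal (@lie_relations k).

Definition lie_rl : realization A (Lie k) := @qrl k A unit lie_sig lie_kind (@lie_relations k).

Lemma lie_rl_proj n (chi : {ffun 'I_n -> unit}) c (x : free_operad lie_sig k n chi c) :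
  lie_rl (proj lie_ideal x) = rl A lie_kind x.
Proof. exact (qrl_proj (@lie_relations_kernel k A) x). Qed.

Lemma lie_rl_linear n (chi : {ffun 'I_n -> unit}) c : linear (@lie_rl n chi c).
Proof. exact (qrl_linear (@lie_relations_kernel k A) (c := c)). Qed.

Lemma lie_proj_ideal n (chi : {ffun 'I_n -> unit}) c (x : free_operad lie_sig k n chi c) :
  ideal_generated (@lie_relations k) x -> proj lie_ideal x = 0.
Proof.
move=> Jx; rewrite -(lin0 (@proj_linear _ _ _ _ lie_ideal n chi c)).
by apply/projE; rewrite subr0.
Qed.

Lemma lie_basis n (chi : {ffun 'I_n -> unit}) :
  word_basis (@lie_rl n chi tt) (monochrome_words tt chi)
    (comb_element (G := lie_sig) tt (@proj _ _ _ _ lie_ideal n chi tt)).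
Proof.
have only (g : lie_sig) : output g = tt -> g = tt by case: g.
exact: (comb_basis (g := (tt : lie_sig)) erefl erefl only erefl lie_ideal
  (@lie_skew k) (@lie_jacobi k) (@proj_linear _ _ _ _ lie_ideal n chi tt)
  (@proj_surj _ _ _ _ lie_ideal n chi tt) (@lie_proj_ideal n chi tt)
  (@lie_rl_linear n chi tt) (@lie_rl_proj n chi tt)).
Qed.

Lemma lie_rl_inj n (chi : {ffun 'I_n -> unit}) c : injective (@lie_rl n chi c).
Proof. case: c; exact: word_basis_inj (lie_basis chi). Qed.

Lemma lie_realization : operad_realization lie_rl.
Proof.
apply: (@presented_realization k A unit lie_sig lie_kind) => //; last exact: lie_rl_inj.
exact (@lie_relations_kernel k A).
Qed.

End LieBasis.

Section FreeBasis.
Variables (k : fieldType) (A : word_algebra k).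

Definition mi_i : mi_sig := exist _ Gi isT.
Definition mi_m : mi_sig := exist _ Gm isT.

Lemma mi_output_h (g : mi_sig) : output g = Ch /\ (g = mi_i \/ g = mi_m).
Proof.
case: g => -[] H //; split=> //; [left | right]; apply: val_inj => //.
Qed.

Definition free_rl : realization A (F_mi k) := @rl k A colour mi_sig mi_kind.

Lemma wt_mi_g lc (t : tree mi_sig) : wt lc Cg t -> exists2 l, t = Leaf l & lc l = Cg.
Proof.
case: t => [l|g ts]; first by rewrite wt_leaf => /eqP; exists l.
by case/andP=> /eqP[Eg] _; have [Eh _] := mi_output_h g; have := etrans (esym Eg) Eh.
Qed.

(** Without [beta] no generator has output g, so the acting argument of every [m] and the argument
    of every [i] is a leaf. *)
Lemma wt_mi_h lc (t : tree mi_sig) : wt lc Ch t ->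
  exists x s, [/\ t = rcomb mi_i mi_m lc x s & all (fun l => lc l == Cg) s].
Proof.
have only g : output g = Ch -> g = mi_i \/ g = mi_m by case: (mi_output_h g).
move: t; apply: (wt_h_ind (gi := mi_i) (gm := mi_m) erefl erefl erefl erefl only).
- by move=> l El; exists l, [::]; rewrite /rcomb /= El.
- by move=> t /wt_mi_g[l -> El]; exists l, [::]; rewrite /rcomb /= El.
move=> t u /wt_mi_g[l -> El] _ [x [s [-> gs]]]; exists x, (rcons s l).
by rewrite rcomb_rcons all_rcons El eqxx.
Qed.

Section Components.
Variables (n : nat) (chi : {ffun 'I_n -> colour}).

Lemma free_h_basis : word_basis (@free_rl n chi Ch) (rcomb_words chi)
  (rcomb_element (G := mi_sig) mi_i mi_m (fun x : F_mi k n chi Ch => x)).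
Proof.
apply: (@rcomb_basis k A mi_sig mi_kind mi_i mi_m erefl erefl erefl erefl erefl erefl n chi _
  (fun x => x) (@free_rl n chi Ch)) => //.
- by move=> q; exists q.
- exact: rl_linear.
move=> S HS Sr t wt_ pt; have [x [s [Et gs]]] := wt_mi_h wt_; rewrite Et.
apply: Sr => //; rewrite -(permPr pt) Et perm_sym.
exact: leaves_rcomb.
Qed.

(** The component of output g of the free operad consists of multiples of the identity: one word in
    arity 1 with input g, none otherwise. *)
Definition unit_words : seq (seq nat) :=
  [seq w <- [:: [:: 0%N]] | monomial chi Cg (Leaf 0 : tree mi_sig)].

Lemma free_g_basis : word_basis (@free_rl n chi Cg) unit_words
  (fun _ => tm k chi Cg (Leaf 0 : tree mi_sig)).
Proof.
split; first exact: rl_linear.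
- exact: filter_uniq.
- move=> S HS Sv; apply: free_ind => // t Ht; have [wt_ pt] := monomial_wt Ht.
  have [l El _] := wt_mi_g wt_; subst t.
  have l0 : l = 0%N.
    by move: pt (perm_size pt); rewrite /= size_iota => + n1; rewrite -n1 => /perm_mem/(_ 0%N);
       rewrite !inE => /eqP.
  subst l; rewrite -(tmE k Ht); apply: (Sv [:: 0%N]).
  by rewrite mem_filter Ht inE eqxx.
move=> i j; rewrite !mem_filter !inE => /andP[mt /eqP ->] /andP[_ /eqP ->].
by rewrite (tmE k mt) /free_rl rl_mono coef_word.
Qed.

End Components.

Lemma free_rl_inj n (chi : {ffun 'I_n -> colour}) c : injective (@free_rl n chi c).
Proof. case: c; [exact: word_basis_inj (free_g_basis chi) | exact: word_basis_inj (free_h_basis chi)]. Qed.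

Lemma free_rl_realization : operad_realization free_rl.
Proof. by apply: (@free_realization k A colour mi_sig mi_kind) => [[[]]|] //; exact: free_rl_inj. Qed.

End FreeBasis.

(** * Comparison of the operads *)

Section Comparison.
Variables (k : fieldType) (A : word_algebra k).
Notation aff_comb chi :=
  (comb_element (G := aff_sig) Gbeta (@proj _ _ _ _ (aff_ideal k) _ chi Cg)).
Notation lie_comb chi :=
  (comb_element (G := lie_sig) tt (@proj _ _ _ _ (lie_ideal k) _ chi tt)).
Notation aff_rcomb chi :=
  (rcomb_element (G := aff_sig) Gi Gm (@proj _ _ _ _ (aff_ideal k) _ chi Ch)).
Notation free_rcomb chi :=
  (rcomb_element (G := mi_sig) mi_i mi_m (fun x : F_mi k _ chi Ch => x)).

Lemma aff_rl_comb n (chi : {ffun 'I_n -> colour}) w : all_g chi -> w \in comb_words n ->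
  aff_rl A (aff_comb chi w) = comb_value A 0 (behead w).
Proof.
move=> gchi wn.
exact: (r_comb_element (g := (Gbeta : aff_sig)) erefl erefl erefl (@aff_rl_proj k A n chi Cg) gchi wn).
Qed.

Lemma lie_rl_comb n (chi : {ffun 'I_n -> unit}) w : w \in comb_words n ->
  lie_rl A (lie_comb chi w) = comb_value A 0 (behead w).
Proof.
move=> wn; have gchi : monochrome tt chi by apply/forallP => i; case: (chi i).
exact: (r_comb_element (g := (tt : lie_sig)) erefl erefl erefl (@lie_rl_proj k A n chi tt) gchi wn).
Qed.

Lemma aff_rl_rcomb n (chi : {ffun 'I_n -> colour}) w : w \in rcomb_words chi ->
  aff_rl A (aff_rcomb chi w) = word A w.
Proof.
move=> wn; exact: (@r_rcomb_element k A aff_sig aff_kind Gi Gm erefl erefl erefl erefl erefl erefl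
  n chi _ _ _ (@aff_rl_proj k A n chi Ch) w wn).
Qed.

Lemma free_rl_rcomb n (chi : {ffun 'I_n -> colour}) w : w \in rcomb_words chi ->
  free_rl A (free_rcomb chi w) = word A w.
Proof.
move=> wn; exact: (@r_rcomb_element k A mi_sig mi_kind mi_i mi_m erefl erefl erefl erefl erefl erefl
  n chi _ _ (@free_rl k A n chi Ch) (fun _ => erefl) w wn).
Qed.

Lemma aff_to_lie n (chi : {ffun 'I_n -> colour}) (psi : {ffun 'I_n -> unit}) :
  forall x, exists y, @lie_rl k A n psi tt y = @aff_rl k A n chi Cg x.
Proof.
apply: (word_basis_image (aff_g_basis A chi) (@lie_rl_linear k A n psi tt)) => w.
rewrite /monochrome_words; case: ifP => // gchi wn.
by exists (lie_comb psi w); rewrite lie_rl_comb // aff_rl_comb.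
Qed.

Lemma lie_to_aff n (chi : {ffun 'I_n -> colour}) (psi : {ffun 'I_n -> unit}) : all_g chi ->
  forall x, exists y, @aff_rl k A n chi Cg y = @lie_rl k A n psi tt x.
Proof.
move=> gchi; apply: (word_basis_image (lie_basis A psi) (@aff_rl_linear k A n chi Cg)) => w.
rewrite /monochrome_words; case: ifP => // _ wn.
by exists (aff_comb chi w); rewrite lie_rl_comb // aff_rl_comb.
Qed.

Lemma aff_rl_g0 n (chi : {ffun 'I_n -> colour}) (x : AffHS k n chi Cg) :
  ~~ all_g chi -> aff_rl A x = 0.
Proof.
move=> ngchi; have [lr _ sv _] := aff_g_basis A chi.
apply: (sv (fun x => aff_rl A x = 0)).
  by split=> [|a y z Ey Ez]; rewrite ?(lin0 lr) ?lr ?Ey ?Ez ?scaler0 ?addr0.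
by rewrite /monochrome_words (negPf (ngchi : ~~ monochrome Cg chi)).
Qed.

(** This inclusion of values holds for both output colours and so yields an operad morphism; the
    reverse one holds only for output h, since the bracket has no counterpart in the free operad. *)
Lemma free_to_aff n (chi : {ffun 'I_n -> colour}) c :
  forall x, exists y, @aff_rl k A n chi c y = @free_rl k A n chi c x.
Proof.
case: c.
  apply: (word_basis_image (free_g_basis A chi) (@aff_rl_linear k A n chi Cg)) => w.
  rewrite mem_filter => /andP[mt _].
  exists (proj (aff_ideal k) (mono k (mt : monomial chi Cg (Leaf 0 : tree aff_sig)))).
  rewrite aff_rl_proj rl_mono (tmE k mt).
  exact: (esym (rl_mono A mi_kind mt)).
apply: (word_basis_image (free_h_basis A chi) (@aff_rl_linear k A n chi Ch)) => w wn.
by exists (aff_rcomb chi w); rewrite aff_rl_rcomb // free_rl_rcomb.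
Qed.

Lemma aff_to_free_h n (chi : {ffun 'I_n -> colour}) :
  forall x, exists y, @free_rl k A n chi Ch y = @aff_rl k A n chi Ch x.
Proof.
apply: (word_basis_image (aff_h_basis A chi)) => [|w wn]; first exact: rl_linear.
by exists (free_rcomb chi w); rewrite aff_rl_rcomb // free_rl_rcomb.
Qed.

Definition if_rl b (V : lmodType k) (r : V -> A) : if_space b V -> A :=
  if b return if_space b V -> A then r else fun _ => 0.

Lemma if_rl_linear b (V : lmodType k) (r : V -> A) : linear r -> linear (@if_rl b V r).
Proof. by case: b => //= _ a x y; rewrite scaler0 addr0. Qed.

Lemma if_rl_inj b (V : lmodType k) (r : V -> A) : injective r -> injective (@if_rl b V r).
Proof. by case: b => //= _ x y _; rewrite [x]zero_module0 [y]zero_module0. Qed.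

Lemma if_rl_map b b' (V W : lmodType k) (r : V -> A) (r' : W -> A) (f : V -> W) (F : A -> A) :
  b' = b -> F 0 = 0 -> (forall x, r' (f x) = F (r x)) ->
  forall x, @if_rl b' W r' (@if_map k b b' V W f x) = F (@if_rl b V r x).
Proof. by move=> ->; case: b. Qed.

Lemma if_rl_image (b : bool) (V : lmodType k) (r : V -> A) (Q : A -> Prop) :
  (b -> exists y, Q (r y)) -> (~~ b -> Q 0) -> exists y, Q (@if_rl b V r y).
Proof. by case: b => /= H H'; [apply: H | exists 0; apply: H']. Qed.

Lemma if_rl_all (b : bool) (V : lmodType k) (r : V -> A) (Q : A -> Prop) :
  (b -> forall x, Q (r x)) -> Q 0 -> forall x, Q (@if_rl b V r x).
Proof. by case: b => /= H H' // x; apply: H. Qed.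

Definition pair_rl : realization A (pair_coll (Lie k) (F_mi k)) := fun n chi c =>
  match c return pair_space (Lie k) (F_mi k) chi c -> A with
  | Cg => @if_rl (all_g chi) _ (@lie_rl k A n (uncoloured n) tt)
  | Ch => @free_rl k A n chi Ch
  end.

Lemma pair_realization : coll_realization pair_rl.
Proof.
have [[_ _ la] _ _] := lie_realization A; have [[_ _ fa] _ _] := free_rl_realization A.
split=> [n chi [] | n chi [] | n chi s chi' [] H x].
- exact/if_rl_linear/lie_rl_linear.
- exact: rl_linear.
- exact/if_rl_inj/lie_rl_inj.
- exact: free_rl_inj.
- apply: if_rl_map => [||y]; first exact: all_g_permutes H.
    exact: lin0 (substitution_linear _).
  exact: la.
- exact: fa.
Qed.

Lemma aff_pair_isomorphic : coll_isomorphic (AffHS k) (pair_coll (Lie k) (F_mi k)).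
Proof.
have [aR _ _] := aff_realization A; have pR := pair_realization.
have [|f [mf fE jf]] := coll_transfer aR pR.
  move=> n chi [] x; last exact: aff_to_free_h.
  apply: (if_rl_image (r := @lie_rl k A n (uncoloured n) tt) (Q := fun z => z = aff_rl A x)).
    by move=> _; apply: aff_to_lie.
  by move=> ng; rewrite aff_rl_g0.
exists f; split=> //; apply: (transfer_bijective pR fE jf) => n chi [] x; last exact: free_to_aff.
apply: (if_rl_all (Q := fun z => exists y, @aff_rl k A n chi Cg y = z)) => [gchi|].
  exact: lie_to_aff.
by exists 0; rewrite (lin0 (@aff_rl_linear k A n chi Cg)).
Qed.

Lemma all_g_recolour n (chi : {ffun 'I_n -> unit}) : all_g (recolour (fun _ => Cg) chi).
Proof. by apply/forallP => i; rewrite ffunE. Qed.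

(** Restricted to colour g, AffHS keeps the evaluation [aff_rl], which already respects composition.
    So the agreement with Lie holds for the operad structure, beyond the underlying collections. *)
Lemma lie_aff_isomorphic :
  operad_isomorphic (Lie k) (pullback_operad (fun _ : unit => Cg) (AffHS k)).
Proof.
have [[al ai aa] ae am] := aff_realization A.
pose r : realization A (pullback_operad (fun _ : unit => Cg) (AffHS k)) :=
  fun n chi c => @aff_rl k A n (recolour (fun _ => Cg) chi) Cg.
have rR : operad_realization r.
  split=> [|chi c e|n m r' chi j d psi theta c H x y]; last exact: am; last exact: ae.
  split=> [n chi c|n chi c|n chi s chi' c H x]; [exact: al | exact: ai | exact: aa].
have [|f [mf fE jf]] := operad_transfer (lie_realization A) rR.
  move=> n chi [] x; exact: (lie_to_aff (all_g_recolour chi)).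
exists f; split=> //; have [rc _ _] := rR; apply: (transfer_bijective rc fE jf) => n chi [] x.
exact: aff_to_lie.
Qed.

End Comparison.

(** * The free operad is generated by its corollas *)

Section Generation.
Variables (k : fieldType) (T : elements (F_mi k)).
Hypotheses (HT : is_suboperad T) (T_gen : forall g : mi_sig, T (generator k g)).

Lemma corolla_generated n (chi : {ffun 'I_n -> colour}) (g : mi_sig) t :
  t = corolla g -> n = size (inputs g) ->
  (forall i : 'I_n, chi i = nth Cg (inputs g) i) -> T (tm k chi (output g) t).
Proof.
move=> -> En; subst n => Ec.
have -> : chi = input_colouring g.
  by apply/ffunP => i; rewrite Ec ffunE (tnth_nth Cg).
by rewrite (tmE k (corolla_monomial g)); apply: T_gen.
Qed.

Lemma ident_generated (chi : {ffun 'I_1 -> colour}) c t :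
  t = Leaf 0 -> chi ord0 = c -> T (tm k chi c t).
Proof. by move=> -> e; case: HT => _ _ + _ => /(_ _ _ e); rewrite (tmE k (monomial1 mi_sig e)). Qed.

(** The last action is peeled off: the comb is the corolla of [m], with leaves [l] and a fresh [z]
    of colour h, composed at [z] with the shorter comb. *)
Lemma rcomb_generated lc x s n (chi : {ffun 'I_n -> colour}) :
  let r := rcomb mi_i mi_m lc x s in
  labelled lc (leaves r) chi -> uniq (leaves r) -> all (fun l => lc l == Cg) s ->
  T (nt k chi Ch (leaves r) r).
Proof.
elim/last_ind: s n chi => [|s l IH] n chi /=.
  rewrite /rcomb /=; case: eqP => [E|E] /= [En Ec] _ _; subst n.
    apply: (@corolla_generated 1 chi mi_i) => //; first by rewrite /relabel /= eqxx.
    by case=> [[|//] H]; rewrite Ec /= E.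
  apply: ident_generated; first by rewrite /relabel /= eqxx.
  by rewrite Ec /=; case: (lc x) E.
rewrite rcomb_rcons leaves2 /= all_rcons; set r := rcomb _ _ _ _ _ => hD uD /andP[/eqP lcl gs].
have [HTs HTa _ HTc] := HT.
pose z := fresh (l :: leaves r); pose lc' := upd lc z Ch.
have zD : z \notin l :: leaves r by rewrite -[z]addn0 fresh_notin.
have E : {in l :: leaves r, lc =1 lc'}.
  by move=> l' l'D; rewrite /lc' /upd; case: eqP zD => // <-; rewrite l'D.
have hD' : labelled lc' ([:: l] ++ leaves r ++ [::]) chi.
  by case: hD => En Ec; rewrite cats0; split=> // i; rewrite Ec E // mem_nth // -En.
have lz : l != z by apply: contraNneq zD => ->; rewrite mem_head.
have lcz : lc' z = Ch by rewrite /lc' /upd eqxx.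
have pr := leaves_rcomb mi_i mi_m lc x s.
have wr : wt lc Ch r by rewrite /r wt_rcomb.
have mr : lmono lc' (leaves r) (lc' z) r.
  rewrite lcz; apply: (eq_lmono (lc := lc)); last exact: lmono_leaves.
  by move=> l' l'r; apply: E; rewrite inE l'r orbT.
have uz : uniq ([:: l] ++ z :: [::]) by rewrite /= inE lz.
have ur : uniq ([:: l] ++ leaves r ++ [::]) by rewrite cats0.
have mm : lmono lc' ([:: l] ++ z :: [::]) Ch (app_m mi_m (Leaf l) (Leaf z)).
  rewrite lmonoE (wt_m (erefl : inputs mi_m = [:: Cg; Ch]) erefl) !wt_leaf lcz -E ?mem_head //.
  by rewrite lcl /= perm_refl.
have [j [H Hc]] := nt_comp k mi_sig (label_colouringP lc' ([:: l] ++ z :: [::]))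
  (label_colouringP lc' (leaves r)) hD' uz ur.
have := Hc _ _ _ mm mr.
have -> : tsubst (upd Leaf z r) (app_m mi_m (Leaf l) (Leaf z)) = app_m mi_m (Leaf l) r.
  by rewrite /= /upd (negPf lz) eqxx.
rewrite cats0 => <-; apply: HTc.
  apply: (@corolla_generated _ _ mi_m) => //.
    by rewrite /relabel /= eqxx (negPf lz) eqxx.
  by case=> [[|[|//]] H']; rewrite ffunE /= ?lcz // -E ?mem_head.
have lcr : labelled lc (leaves r) (label_colouring lc' (leaves r)).
  split=> // i; rewrite ffunE -E // inE mem_nth ?orbT //.
rewrite lcz; apply: IH => //.
by move: uD => /= /andP[].
Qed.

Lemma F_mi_generated n chi c (x : F_mi k n chi c) : T x.
Proof.
have [HTs HTa HTi HTc] := HT.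
move: x; apply: free_ind => // t Ht; have [wt_ pt] := monomial_wt Ht.
case: c Ht wt_ => Ht wt_.
  have [l El El'] := wt_mi_g wt_; subst t.
  have l0 : l = 0%N.
    by move: pt (perm_size pt); rewrite /= size_iota => + n1; rewrite -n1 => /perm_mem/(_ 0%N);
       rewrite !inE => /eqP.
  have n1 : n = 1%N by have := perm_size pt; rewrite size_iota.
  subst l n; rewrite -(tmE k Ht); apply: ident_generated => //.
  by move: El'; rewrite /input_label (leaf_colour_lt _ (ltn0Sn 0)) => <-; congr (chi _); apply: val_inj.
have [y [s [Et gs]]] := wt_mi_h wt_.
have ut : uniq (leaves t) by rewrite (perm_uniq pt) iota_uniq.
(* With inputs numbered in the order of the leaves of [t], the tree is a composite of corollas; a
   permutation then restores the original numbering. *)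
pose chi' := [ffun i : 'I_n => input_label chi Ch (nth 0%N (leaves t) i)].
have hD' : labelled (input_label chi Ch) (leaves t) chi'.
  by split=> [|i]; rewrite ?ffunE // (perm_size pt) size_iota.
have [s' [H E]] := nt_perm k mi_sig hD' (input_labelP chi Ch) ut pt.
rewrite -(nt_input k Ht) -E; last exact: lmono_leaves.
by apply: HTa; move: hD' ut; rewrite Et => hD' ut; apply: rcomb_generated.
Qed.

End Generation.

Lemma mi_generate_free_suboperad (k : fieldType) :
  generate_free_suboperad (P := AffHS k) (AffHS_mi k).
Proof.
pose A := free_algebra k.
have [|f [mf fE jf]] := operad_transfer (free_rl_realization A) (aff_realization A).
  exact: free_to_aff.
have [[lf af] f1 fM] := mf.
(* The morphism is known only through its values, which determine it on generators by injectivity of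
   [aff_rl]. *)
have f_gen g : f _ _ _ (generator k g) = AffHS_mi k g.
  apply: (@aff_rl_inj k A); rewrite fE.
  have -> : aff_rl A (AffHS_mi k g) = rl A aff_kind (generator k (val g)).
    exact: aff_rl_proj.
  apply: (etrans (rl_mono A mi_kind (corolla_monomial g))).
  apply: (etrans _ (esym (rl_mono A aff_kind (corolla_monomial (val g : aff_sig))))).
  by case: g => -[].
exists f; split=> // n chi c y; split=> [gy | [x <-] S HS AS].
  (* The image of [f] is itself a suboperad containing the generators. *)
  apply: (gy (fun n chi c y => exists x, f n chi c x = y)) => [|m psi d z [g]]; last first.
    by exists (generator k g).
  split=> [m psi d|m psi s chi' d H _ [x <-]|psi d e|m p r psi j d phi theta e H _ _ [x <-] [x' <-]].
  - split; first by exists 0; apply: lin0 (lf _ _ _).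
    by move=> a _ _ [x <-] [x' <-]; exists (a *: x + x'); rewrite lf.
  - by exists (sact _ H x); rewrite af.
  - by exists (ident _ e); rewrite f1.
  - by exists (pcomp _ H x x'); rewrite fM.
have [HSs HSa HSi HSc] := HS.
(* Conversely, the preimage of [S] under [f] is a suboperad containing the generators, hence
   everything. *)
apply: (F_mi_generated (T := fun n chi c x => S n chi c (f n chi c x))) => [|g].
  split=> [m psi d|m psi s chi' d H z Sz|psi d e|m p r psi j d phi theta e H z z' Sz Sz'].
  - by apply: submod_preim (lf _ _ _); apply: HSs.
  - by rewrite af; apply: HSa.
  - by rewrite f1; apply: HSi.
  - by rewrite fM; apply: HSc.
by rewrite f_gen; apply: AS.
Qed.

(** * Generating series *)

Section Series.

Definition fmono (x : rat) (p q : nat) : fps2 := fun a b =>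
  if (a == p) && (b == q) then x else 0.

Lemma fmul_fmono f g x p q : (forall a b, f a b = fmono x p q a b) ->
  forall a b, fmul f g a b = if (p <= a)%N && (q <= b)%N then x * g (a - p)%N (b - q)%N else 0.
Proof.
move=> Ef a b; rewrite /fmul; case: (leqP p a) => [lpa|lap] /=; last first.
  rewrite big1 // => i _; rewrite big1 // => j _; rewrite Ef /fmono.
  have -> : (i == p :> nat) = false by apply/eqP => E; have := ltn_ord i; rewrite E; lia.
  by rewrite /= mul0r.
have ltp : (p < a.+1)%N by [].
rewrite (bigD1 (Ordinal ltp)) //= [X in _ + X]big1 ?addr0; last first.
  move=> i ip; rewrite big1 // => j _; rewrite Ef /fmono.
  have -> : (i == p :> nat) = false by apply: contraNF ip => /eqP E; apply/eqP/val_inj.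
  by rewrite /= mul0r.
case: (leqP q b) => [lqb|lbq]; last first.
  rewrite big1 // => j _; rewrite Ef /fmono.
  have -> : (j == q :> nat) = false by apply/eqP => E; have := ltn_ord j; rewrite E; lia.
  by rewrite andbF mul0r.
have ltq : (q < b.+1)%N by [].
rewrite (bigD1 (Ordinal ltq)) //= [X in _ + X]big1 ?addr0; last first.
  move=> j jq; rewrite Ef /fmono.
  have -> : (j == q :> nat) = false by apply: contraNF jq => /eqP E; apply/eqP/val_inj.
  by rewrite andbF mul0r.
by rewrite Ef /fmono !eqxx.
Qed.

Lemma fmul_addl f g h a b : fmul (fadd f g) h a b = fmul f h a b + fmul g h a b.
Proof.
rewrite /fmul -big_split /=; apply: eq_bigr => i _; rewrite -big_split /=.
by apply: eq_bigr => j _; rewrite /fadd mulrDl.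
Qed.

Lemma fexp_fmono f x l : (forall a b, f a b = fmono x 1 0 a b) ->
  forall a b, fexp f l a b = fmono (x ^+ l) l 0 a b.
Proof.
move=> Ef; elim: l => [|l IH] a b; first by rewrite /fexp /= /fconst /fmono expr0.
rewrite -[fexp f l.+1 a b]/(fmul f (fexp f l) a b) (fmul_fmono _ Ef) IH /fmono subn0 andbT.
case: a => [|a] //=; rewrite subn1 eqSS exprS.
by rewrite /=; case: (_ && _); rewrite ?mulr0.
Qed.

(** The [l]-th power of [x t1] lives only in degree [(l, 0)], so at most the term [l = a] survives;
    the truncation at [a + b] includes it. *)
Lemma fsubst_fmono c f x a b : (forall a b, f a b = fmono x 1 0 a b) ->
  fsubst c f a b = if b == 0%N then c a * x ^+ a else 0.
Proof.
move=> Ef; rewrite /fsubst; case: eqVneq => [->|b0]; last first.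
  by rewrite big1 // => l _; rewrite (fexp_fmono _ Ef) /fmono (negPf b0) andbF mulr0.
have lta : (a < (a + 0).+1)%N by rewrite addn0.
rewrite (bigD1 (Ordinal lta)) //= (fexp_fmono _ Ef) /fmono !eqxx big1 ?addr0 // => l la.
rewrite (fexp_fmono _ Ef) /fmono eq_sym.
have -> : (l == a :> nat) = false by apply: contraNF la => /eqP E; apply/eqP/val_inj.
by rewrite /= mulr0.
Qed.

Lemma log_series a b : fopp (fln (fsub (fconst 1) ft1)) a b
  = if b == 0%N then (if a == 0%N then 0 else a%:R^-1) else 0.
Proof.
(* The logarithm expands in powers of [(1 - t1) - 1 = - t1], whence the coefficient -1. *)
rewrite /fopp /fln (@fsubst_fmono _ _ (-1)); last first.
  move=> {}a {}b; rewrite /fsub /fadd /fopp /fconst /ft1 /fmono addrAC subrr sub0r.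
  by case: andP.
case: eqP => _; last by rewrite oppr0.
case: eqP => a0; first by rewrite mul0r oppr0.
by rewrite exprS mulN1r mulNr mulNr opprK mulrAC -expr2 sqrr_sign mul1r.
Qed.

(** The inverse of [1 - t1] is the geometric series in [t1]; the two summands are its shifts by [t1]
    and by [t2]. *)
Lemma free_series a b : fdiv (fadd ft1 ft2) (fsub (fconst 1) ft1) a b
  = ((0 < a)%N && (b == 0%N))%:R + (b == 1%N)%:R.
Proof.
have Ei a' b' : finv (fsub (fconst 1) ft1) a' b' = (b' == 0%N)%:R.
  rewrite /finv (@fsubst_fmono _ _ 1) => [|c d]; first by rewrite expr1n mulr1; case: eqP.
  rewrite /fsub /fadd /fopp /fconst /ft1 /fmono opprD opprK addrA subrr add0r.
  by case: andP.
rewrite /fdiv fmul_addl (@fmul_fmono ft1 _ 1 1 0); last by move=> c d; rewrite /ft1 /fmono; case: andP.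
rewrite (@fmul_fmono ft2 _ 1 0 1); last by move=> c d; rewrite /ft2 /fmono; case: andP.
rewrite !Ei !mul1r subn0 andbT /=; congr (_ + _); first by case: (0 < a)%N.
by case: b => [|[|b]].
Qed.

End Series.

(** * Counting basis words *)

Section Counting.
Variables (n m1 m2 : nat) (chi : {ffun 'I_n -> colour}).
Hypotheses (En : n = (m1 + m2)%N) (card_g : #|[pred i | chi i == Cg]| = m1) (card_h : #|[pred i | chi i == Ch]| = m2).
Local Notation lc := (input_label chi Ch).

Lemma count_h : count (fun l => lc l != Cg) (iota 0 n) = m2.
Proof.
rewrite -card_h cardE /enum_mem size_filter -enumT -val_enum_ord count_map.
apply: eq_count => i /=; rewrite /input_label leaf_colourE /=.
by rewrite inE; case: (chi i).
Qed.

Lemma all_g_count : all_g chi = (m2 == 0%N).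
Proof.
rewrite -card_h; apply/forallP/eqP => [H|/eqP].
  by apply: eq_card0 => i; rewrite !inE (eqP (H i)).
by rewrite -leqn0 leqNgt => /card_gt0P H i; case E: (chi i) => //; case: H; exists i; rewrite inE E.
Qed.

Lemma size_monochrome_words : size (monochrome_words Cg chi)
  = if m2 == 0%N then (if m1 == 0%N then 0 else m1.-1`!)%N else 0%N.
Proof.
rewrite /monochrome_words -[monochrome Cg chi]/(all_g chi) all_g_count.
case: eqP => // E; have -> : n = m1 by rewrite En E addn0.
by rewrite /comb_words; case: (m1) => //= m; rewrite size_map size_permutations ?iota_uniq // size_iota.
Qed.

(** An input of colour h must head the word, so at most one is allowed. With none, all permutations
    count, except in arity 0; with one, its place is forced and the m1 others are permuted
    freely. *)
Lemma size_rcomb_words : size (rcomb_words chi)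
  = (if m2 == 0%N then (if m1 == 0%N then 0 else m1`!) else if m2 == 1%N then m1`! else 0)%N.
Proof.
have size_perm : size (permutations (iota 0 n)) = n`!.
  by rewrite size_permutations ?iota_uniq // size_iota.
case: (eqVneq m2 0%N) => [E|m20].
  case: eqP => [E1|m10].
    apply/eqP; rewrite size_filter -leqn0 leqNgt -has_count; apply/hasPn => w.
    rewrite mem_permutations => /perm_size sw; suff /size0nil -> : size w = 0%N by [].
    by rewrite sw size_iota En E1 E.
  rewrite /rcomb_words; suff /all_filterP -> : all (fun w => (w != [::])
      && all (fun l => lc l == Cg) (behead w)) (permutations (iota 0 n)).
    by rewrite size_perm En E addn0.
  apply/allP => w; rewrite mem_permutations => pw; apply/andP; split.
    by apply/eqP => w0; have := perm_size pw; rewrite w0 size_iota /=; clear -En m10; lia.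
  apply/allP => l /mem_behead lw.
  have : ~~ has (fun l => lc l != Cg) (iota 0 n) by rewrite has_count count_h E.
  by move/hasPn/(_ l); rewrite -(perm_mem pw) negbK; apply.
have key w : w \in rcomb_words chi -> exists x s,
    [/\ w = x :: s, perm_eq (x :: s) (iota 0 n), all (fun l => lc l == Cg) s, lc x != Cg & m2 = 1%N].
  rewrite mem_filter mem_permutations => /andP[/andP[]]; case: w => // x s _ /= gs pw.
  exists x, s; have := count_h; rewrite -(seq.permP pw) /=.
  have -> : count (fun l => lc l != Cg) s = 0%N.
    by apply/eqP; rewrite -leqn0 leqNgt -has_count; apply/hasPn => l /(allP gs); rewrite negbK.
  by case: (lc x != Cg) => /= E; split => //; move: m20; rewrite -E.
case: (eqVneq m2 1%N) => [E|m21]; last first.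
  by case E: (rcomb_words chi) => [|w s] //; case: (key w) => [|x [s' [_ _ _ _ E1]]];
     [rewrite E mem_head | rewrite E1 eqxx in m21].
(* The unique input [x] of colour h; prefixing [x] gives a bijection from the permutations of the
   other inputs to the words. *)
have /hasP[x xn xh] : has (fun l => lc l != Cg) (iota 0 n) by rewrite has_count count_h E.
have gx l : l \in rem x (iota 0 n) -> lc l == Cg.
  move=> lr; have := count_h; rewrite E (seq.permP (perm_to_rem xn)) /= xh => -[] /eqP.
  by rewrite -leqn0 leqNgt -has_count => /hasPn/(_ l lr); rewrite negbK.
have -> : m1 = size (rem x (iota 0 n)) by rewrite size_rem // size_iota En E addn1.
rewrite -size_permutations ?rem_uniq ?iota_uniq // -(size_map (cons x)).
apply/perm_size/uniq_perm.
- by rewrite filter_uniq // permutations_uniq.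
- by rewrite map_inj_uniq ?permutations_uniq // => s s' [].
move=> w; apply/idP/mapP => [/key[y [s [-> ps gs yh _]]] | [s]].
  have yx : y = x.
    have := perm_mem ps x; rewrite xn inE => /orP[/eqP-> // | /(allP gs)].
    by rewrite (negPf xh).
  subst y; exists s => //; rewrite mem_permutations.
  by have := perm_trans ps (perm_to_rem xn); rewrite perm_cons.
rewrite mem_permutations => ps ->; rewrite mem_filter /= mem_permutations.
apply/andP; split; first by apply/allP => l; rewrite (perm_mem ps); apply: gx.
by rewrite perm_sym; apply: perm_trans (perm_to_rem xn) _; rewrite perm_cons perm_sym.
Qed.

End Counting.

Lemma aff_generating_series (k : fieldType) : has_generating_series (AffHS k)
  (fun c => match c with
            | Cg => fopp (fln (fsub (fconst 1) ft1))
            | Ch => fdiv (fadd ft1 ft2) (fsub (fconst 1) ft1)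
            end).
Proof.
move=> m1 m2 chi [] card_g card_h.
  exists (size (monochrome_words Cg chi)).
    exact: word_basis_dim (aff_g_basis (free_algebra k) chi).
  rewrite log_series (size_monochrome_words erefl card_h).
  case: eqP => [->|_]; last by rewrite mul0r.
  case: m1 {chi card_g card_h} => [|m]; first by rewrite mul0r.
  (* This is (m1 - 1)!/m1! = 1/m1 with m1 = m + 1. *)
  rewrite /= fact0 muln1 factS natrM invfM mulrCA mulfV ?mulr1 //.
  by rewrite Num.Theory.pnatr_eq0 -lt0n fact_gt0.
exists (size (rcomb_words chi)).
  exact: word_basis_dim (aff_h_basis (free_algebra k) chi).
have fact_neq0 m : m`!%:R != 0 :> rat by rewrite Num.Theory.pnatr_eq0 -lt0n fact_gt0.
rewrite free_series (size_rcomb_words erefl card_h).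
case: m2 {chi card_g card_h} => [|[|m2]] /=; rewrite ?andbF ?andbT.
- by case: m1 => [|m1]; rewrite /= addr0 ?mul0r // fact0 muln1 divff.
- by rewrite add0r (_ : 1`! = 1%N) // muln1 divff.
- by rewrite add0r mul0r.
Qed.

Theorem corollary4p6 (k : fieldType) (char0 : [pchar k] =i pred0) :
  [/\ generate_free_suboperad (P := AffHS k) (AffHS_mi k),
      coll_isomorphic (AffHS k) (pair_coll (Lie k) (F_mi k)),
      operad_isomorphic (Lie k) (pullback_operad (fun _ : unit => Cg) (AffHS k))
    & has_generating_series (AffHS k)
        (fun c => match c with
                  | Cg => fopp (fln (fsub (fconst 1) ft1))
                  | Ch => fdiv (fadd ft1 ft2) (fsub (fconst 1) ft1)
                  end)].
Proof.
split.
- exact: mi_generate_free_suboperad.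
- exact: aff_pair_isomorphic (free_algebra k).
- exact: lie_aff_isomorphic (free_algebra k).
- exact: aff_generating_series.
Qed.
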